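(* Let $p>1$, $p^*=\frac{p}{p-1}$. The $(p,\beta,\lambda)$-Fisher--Rényi complexity is non-trivially lower bounded as follows: for every $$(\beta,\lambda)\in\widetilde{\mathcal{D}}_p=\left\{(\beta,\lambda)\in(0,\infty)^2:\ \lambda>1-\beta p^*\right\},\qquad C_{p,\beta,\lambda}[\rho]\ \ge\ K_{p,\beta,\lambda}.$$ The minimizers are explicitly given by $$\operatorname{argmin}_\rho C_{p,\beta,\lambda}[\rho]=g_{p,\beta,\lambda},$$ the $(p,\beta,\lambda)$-Gaussian (up to a shift and a scaling factor). The following symmetry holds on $\widetilde{\mathcal{D}}_p$: with the involution $\mathfrak{T}_p(\beta,\lambda)=\left(\frac{\beta p^*+\lambda-1}{\lambda p^*},\frac1\lambda\right)$, the minimizers $\rho_{p,\beta,\lambda}=g_{p,\beta,\lambda}$ and the optimal bounds satisfy $$\rho_{p,\mathfrak{T}_p(\beta,\lambda)}\propto\big[\rho_{p,\beta,\lambda}\big]^\lambda\qquad\text{and}\qquad K_{p,\mathfrak{T}_p(\beta,\lambda)}=\lambda^2\,K_{p,\beta,\lambda}.$$ Moreover, the tight bound is $$K_{p,\beta,\lambda}=\left(\frac{2}{p^*\zeta}\left(\frac{p^*\zeta}{|1-\lambda|}\right)^{\frac1{p^*}}\left(\frac{p^*\zeta}{p^*\zeta-|1-\lambda|}\right)^{\frac{\zeta}{|1-\lambda|}+\frac1p}B\!\left(\frac1{p^*},\frac{\zeta}{|1-\lambda|}+\frac1p\right)\right)^2\quad\text{if }\lambda\ne1,$$ $$K_{p,\beta,\lambda}=\left(\frac{2\,e^{1/p^*}\,\Gamma\!\left(\frac1{p^*}\right)}{\beta\,(p^*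 )^{1/p}}\right)^2\quad\text{if }\lambda=1,$$ with $\zeta=\zeta_{p,\beta,\lambda}=\beta+\frac{(\lambda-1)_+}{p^*}$.
   Context: Notation: $(t)_+=\max(t,0)$; $\mathbf 1_A$ is the indicator function of the set $A$; $\propto$ means ''proportional to''; by convention $1/0=+\infty$. For $\lambda>0$, the Rényi entropy power of a probability density $\rho$ on $\mathbb{R}$ is, provided the integral exists, $N_\lambda[\rho]=\exp(2H_\lambda[\rho])$ with $H_\lambda[\rho]=\frac{1}{1-\lambda}\log\int_{\mathbb{R}}[\rho(x)]^\lambda\,dx$; the limiting case $\lambda\to1$ gives the Shannon entropy power, with $H_1[\rho]=-\int_{\mathbb{R}}\rho(x)\log\rho(x)\,dx$. For $p\in(1,\infty)$ and $\beta>0$, the $(p,\beta)$-Fisher information of a continuously differentiable density $\rho$ is $$F_{p,\beta}[\rho]=\left(\int_{\mathbb{R}}\left|[\rho(x)]^{\beta-1}\,\frac{d}{dx}\log[\rho(x)]\right|^p\rho(x)\,dx\right)^{\frac{2}{p\beta}},$$ provided that this integral exists. When $\rho$ is strictly positive on a bounded support, the integration is to be understood over this support, but $\rho$ must be differentiable on the closure of this support. The $(p,\beta,\lambda)$-Fisher--Rényi complexity is $C_{p,\beta,\lambda}[\rho]=\big(F_{p,\beta}[\rho]\,N_\lambda[\rho]\big)^\beta$, provided that the involved quantities exist. It is invariant under replacing $\rho$ by $\frac1\sigma\rho\big(\frac{x-x_0}{\sigma}\big)$, $x_0\in\mathbb{R}$, $\sigma>0$; all densities are given up to such a shift and scaling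 factor. For $p>1$ and $(\beta,\lambda)\in(0,\infty)^2$, the $(p,\beta,\lambda)$-Gaussian distribution is defined as follows. - If $\lambda\neq1$: $$g_{p,\beta,\lambda}(x)\propto\left[1-\mathfrak{B}^{-1}\!\left(\tfrac1{p^*},q_{p,\beta,\lambda};\tfrac{p^*|x|}{|1-\lambda|^{1/p^*}}\right)\right]^{\frac1{|1-\lambda|}}\mathbf 1_{\left[0,\,B\left(\frac1{p^*},q_{p,\beta,\lambda}\right)\right]}\!\left(\tfrac{p^*|x|}{|1-\lambda|^{1/p^*}}\right).$$ - If $\lambda=1$ and $\beta\neq1$: $$g_{p,\beta,\lambda}(x)\propto\exp\!\left(-\frac{\mathfrak{G}^{-1}\!\left(\frac1{p^*};\left(\frac{\beta-1}{\beta}\right)^{\frac1{p^*}}p^*|x|\right)}{\beta-1}\right)\mathbf 1_{\left[0,\,\frac{\Gamma(1/p^* )}{\mathbf 1_{(0,1)}(\beta)}\right]}\big(p^*|x|\big).$$ - If $\beta=\lambda=1$: $g_{p,\beta,\lambda}(x)\propto\exp(-|x|^{p^*})$. Here $q_{p,\beta,\lambda}=\frac{\beta-1}{|1-\lambda|}+\frac{\mathbf 1_{\mathbb{R}_+}(1-\lambda)}{p}$. The incomplete beta function is $\mathfrak{B}(a,b,x)=\int_0^xt^{a-1}(1-t)^{b-1}dt$, defined for $a>0$ and $x\in[0,1)$; $B(a,b)=\lim_{x\to1}\mathfrak{B}(a,b,x)$ is the standard beta function if $b>0$ and is infinite otherwise; $\mathfrak{B}^{-1}$ is the inverse incomplete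 beta function (inverse in $x$). The incomplete gamma function is $\mathfrak{G}(a,x)=\int_0^xt^{a-1}\exp(-t)\,dt$, defined for $a>0$ and $x\in\mathbb{R}$; $\Gamma(a)=\lim_{x\to+\infty}\mathfrak{G}(a,x)$ is the gamma function; $\mathfrak{G}^{-1}$ is the inverse incomplete gamma function (inverse in $x$). Powers are defined by $z^\alpha=|z|^\alpha e^{i\alpha\,\mathrm{Arg}(z)}$ with $0\le\mathrm{Arg}(z)<2\pi$.
   Formalization: For λ=1, β≠1 the cutoff of g is corrected to (|β−1|/β)^{1/p*} p*|x| in [0, Γ(1/p* )/1_{(1,∞)}(β)); densities are taken continuous on ℝ and C¹ where positive, so all minimizers are admitted and jumps at the ends of the support (uniform density, C=0) are excluded. *)

(* Defs.v *)
From HB Require Import structures.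
From mathcomp Require Import all_boot all_order all_algebra.
From mathcomp Require Import all_classical all_reals all_analysis.
From mathcomp Require Import complex.

Set Implicit Arguments.
Unset Strict Implicit.
Unset Printing Implicit Defensive.

Import Order.TTheory GRing.Theory Num.Theory.
Import numFieldNormedType.Exports.

Local Open Scope classical_set_scope.
Local Open Scope ring_scope.

Definition conj_exp {R : realType} (p : R) : R := p / (p - 1).

Definition supp {R : realType} (rho : R -> R) : set R := [set x | 0 < rho x].

(* Every continuously differentiable density qualifies.  Continuity on the whole
   line makes rho vanish at the finite endpoints of its support, so that the
   uniform density, whose Fisher information would be zero, is excluded.
   Differentiability is not required at those endpoints: for beta > 2 the
   extremal densities have bounded support and infinite slope there. *)
Definition smooth_density {R : realType} (rho : R -> R) : Prop :=
  [/\ forall x, 0 <= rho x,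
      continuous rho,
      (forall x, supp rho x ->
         derivable rho x 1 /\ {for x, continuous (derive1 rho)}) &
      (\int[lebesgue_measure]_x (rho x)%:E = 1)%E].

Definition fisher_integrand {R : realType} (p b : R) (rho : R -> R) (x : R) : R :=
  `| rho x `^ (b - 1) * derive1 (fun y => ln (rho y)) x | `^ p * rho x.

Definition fisher_exists {R : realType} (p b : R) (rho : R -> R) : Prop :=
  lebesgue_measure.-integrable (supp rho) (EFin \o fisher_integrand p b rho).

Definition fisher {R : realType} (p b : R) (rho : R -> R) : R :=
  (\int[lebesgue_measure]_(x in supp rho) fisher_integrand p b rho x)
    `^ (2 / (p * b)).

(* [ln 0 = 0], so the Shannon integrand vanishes off the support. *)
Definition renyi_integrand {R : realType} (l : R) (rho : R -> R) (x : R) : R :=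
  if l == 1 then rho x * ln (rho x) else rho x `^ l.

Definition renyi_exists {R : realType} (l : R) (rho : R -> R) : Prop :=
  lebesgue_measure.-integrable setT (EFin \o renyi_integrand l rho).

Definition renyi_entropy {R : realType} (l : R) (rho : R -> R) : R :=
  let I := \int[lebesgue_measure]_x renyi_integrand l rho x in
  if l == 1 then - I else (1 - l)^-1 * ln I.

Definition renyi_power {R : realType} (l : R) (rho : R -> R) : R :=
  expR (2 * renyi_entropy l rho).

Definition complexity {R : realType} (p b l : R) (rho : R -> R) : R :=
  (fisher p b rho * renyi_power l rho) `^ b.

Definition complexity_domain {R : realType} (p b l : R) : set (R -> R) :=
  [set rho | [/\ smooth_density rho, fisher_exists p b rho & renyi_exists l rho]].

Definition optimal_bound {R : realType} (p b l : R) : R :=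
  inf [set complexity p b l rho | rho in complexity_domain p b l].

Definition minimizers {R : realType} (p b l : R) : set (R -> R) :=
  [set rho | complexity_domain p b l rho /\
     forall f, complexity_domain p b l f ->
       complexity p b l rho <= complexity p b l f].

Definition shift_scale_class {R : realType} (f : R -> R) : set (R -> R) :=
  [set rho | exists x0 s : R,
     0 < s /\ rho = (fun x => s^-1 * f ((x - x0) / s))].

Definition proportional_upto_shift_scale {R : realType} (f h : R -> R) : Prop :=
  exists c x0 s : R, [/\ 0 < c, 0 < s & forall x, f x = c * h ((x - x0) / s)].

Definition inc_beta {R : realType} (a b x : R) : R :=
  \int[lebesgue_measure]_(t in `[0, x]) (t `^ (a - 1) * (1 - t) `^ (b - 1)).

(* Possibly [+oo], namely when b <= 0. *)
Definition euler_beta {R : realType} (a b : R) : \bar R :=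
  lim ((inc_beta a b x)%:E @[x --> 1^'-]).

(* The default value 1 is only met on [y >= euler_beta a b]; at [y = euler_beta a b] it is
   the continuous extension. *)
Definition inc_beta_inv {R : realType} (a b y : R) : R :=
  xget 1 [set x | 0 <= x < 1 /\ inc_beta a b x = y].

(* |x|^a exp(i a Arg x) with 0 <= Arg < 2 pi, for real x. *)
Definition cpow {R : realType} (x a : R) : R[i] :=
  let arg := if 0 <= x then 0 else pi in
  Complex (`|x| `^ a * cos (a * arg)) (`|x| `^ a * sin (a * arg)).

Definition oriented_integral {R : realType} (f : R -> R) (x y : R) : R :=
  if x <= y then \int[lebesgue_measure]_(t in `[x, y]) f t
  else - \int[lebesgue_measure]_(t in `[y, x]) f t.

Definition inc_gamma {R : realType} (a x : R) : R[i] :=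
  let f (t : R) : R[i] := cpow t (a - 1) * real_complex R (expR (- t)) in
  Complex (oriented_integral (fun t => complex.Re (f t)) 0 x)
          (oriented_integral (fun t => complex.Im (f t)) 0 x).

(* [inc_gamma a x] is real for x >= 0. *)
Definition euler_gamma {R : realType} (a : R) : R :=
  lim (complex.Re (inc_gamma a x) @[x --> +oo]).

Definition inc_gamma_inv {R : realType} (a : R) (z : R[i]) : R :=
  xget 0 [set x | inc_gamma a x = z].

Definition gauss_q {R : realType} (p b l : R) : R :=
  (b - 1) / `|1 - l| + (0 <= 1 - l)%R%:R / p.

Definition gauss_beta_kernel {R : realType} (p b l x : R) : R :=
  let a := (conj_exp p)^-1 in
  let q := gauss_q p b l in
  let y := conj_exp p * `|x| / `|1 - l| `^ a in
  (1 - inc_beta_inv a q y) `^ (`|1 - l|^-1)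
    * \1_[set y | 0 <= y /\ (y%:E <= euler_beta a q)%E] y.

(* The indicator cuts off where [inc_gamma_inv] stops being defined: for b > 1
   the argument ((b - 1) / b)^a p^* |x| is a nonnegative real, which is a value
   of the incomplete gamma function iff it is < euler_gamma a, and the exponential
   tends to 0 as it tends to euler_gamma a; for b < 1 every argument lies on the
   half-line exp(i a pi) [0, +oo[ covered by the values at x <= 0, and there is
   no cut-off. *)
Definition gauss_gamma_kernel {R : realType} (p b x : R) : R :=
  let a := (conj_exp p)^-1 in
  let r := conj_exp p * `|x| in
  let upper : \bar R := if 1 < b then (euler_gamma a)%:E else +oo%E in
  expR (- (inc_gamma_inv a (cpow ((b - 1) / b) a * real_complex R r) / (b - 1)))
    * \1_[set y | 0 <= y /\ (y%:E < upper)%E] (`|(b - 1) / b| `^ a * r).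

Definition gauss_kernel {R : realType} (p b l x : R) : R :=
  if l != 1 then gauss_beta_kernel p b l x
  else if b != 1 then gauss_gamma_kernel p b x
  else expR (- (`|x| `^ conj_exp p)).

Definition gauss {R : realType} (p b l x : R) : R :=
  gauss_kernel p b l x / \int[lebesgue_measure]_t gauss_kernel p b l t.

Definition param_domain {R : realType} (p : R) : set (R * R) :=
  [set bl | [/\ 0 < bl.1, 0 < bl.2 & 1 - bl.1 * conj_exp p < bl.2]].

Definition involution_T {R : realType} (p : R) (bl : R * R) : R * R :=
  ((bl.1 * conj_exp p + bl.2 - 1) / (bl.2 * conj_exp p), bl.2^-1).

Definition zeta_par {R : realType} (p b l : R) : R :=
  b + Num.max (l - 1) 0 / conj_exp p.

Definition explicit_bound {R : realType} (p b l : R) : R :=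
  let ps := conj_exp p in
  let z := zeta_par p b l in
  let d := `|1 - l| in
  if l != 1 then
    (2 / (ps * z) * (ps * z / d) `^ (ps^-1)
       * (ps * z / (ps * z - d)) `^ (z / d + p^-1)
       * fine (euler_beta (ps^-1) (z / d + p^-1))) ^+ 2
  else
    (2 * expR (ps^-1) * euler_gamma (ps^-1) / (b * ps `^ (p^-1))) ^+ 2.

(* Main.v *)
(** Let [q = p / (p - 1)], let [m] be the maximum of a density [rho], [u = rho / m],
    and let [ell] be the Tsallis logarithm [ell s = (1 - s^(l-1)) / (l - 1)]
    ([- ln s] if [l = 1]).  Take [G] with
    [G' = s^(b-1) ell^(1/q)] and [G(0) = 0].  Young's inequality bounds
    [k |G(u)'|] by [k^p |u^(b-2) u'|^p u / p + u ell(u) / q]; integrating on both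
    sides of a maximum point gives [2 k G(1) <= k^p A / p + L / q], with
    [A = \int |u^(b-2) u'|^p u] and [L = \int u ell(u)], and optimizing over [k]
    gives [2 G(1) <= A^(1/p) L^(1/q)].  For [r = exp (- H) / m] one has
    [ell r = L / \int u], and the square root of the complexity equals
    [A^(1/p) L^(1/q) / Q(r)] with [Q(s) = s^b ell(s)^(1/q)].  Since [Q] has a
    unique maximum point [r0], the complexity is at least [(2 G(1) / Q(r0))^2].

    In the equality case [u] solves [k |u'| = u^(2-b) ell(u)^(1/p)] on both sides of
    its plateau, i.e. [Phi(u)] is the distance to the plateau divided by [k], where
    [Phi' = - s^(b-2) ell^(-1/p)] and [Phi(1) = 0]; comparing masses shows that the
    plateau is a point.  Both [Phi] and [G(1)] are incomplete beta or gamma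
    integrals, which identifies [u] with the Gaussian profile and makes the bound
    explicit; the symmetry can then be read off these formulas. *)
Require Import Defs.
From mathcomp Require Import all_boot all_order all_algebra.
From mathcomp Require Import all_classical all_reals all_analysis.
From mathcomp Require Import complex measurable_realfun ring lra.

Set Implicit Arguments.
Unset Strict Implicit.
Unset Printing Implicit Defensive.

Import Order.TTheory GRing.Theory Num.Theory.
Import numFieldNormedType.Exports.

Local Open Scope classical_set_scope.
Local Open Scope ring_scope.

(** * Calculus and integration on the line *)

Section RealAnalysis.
Context {R : realType}.
Implicit Types (f F df : R -> R) (a b c d v x y t : R).

(** Neither boundedness nor decay is assumed of a density; it may vanish between bumps, and it is
    differentiable only where it is positive. Division by the maximum makes [ell] nonnegative on the
    range of [u], so that one Young inequality serves [l < 1], [l = 1] and [l > 1]; hence a maximum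
    must be produced beforehand, from a bound on the variation of [rho^b]. Integrals are not cut
    along the support: they enter as monotone cumulative functions on the whole line, and a
    half-line is followed only up to the first time [u] reaches a small level. The boundary terms
    disappear because [G] and [Q] vanish at 0, which for [l < 1] rests on the condition
    [1 - b * ps < l]. The two scalings separate: dilation is the [k] of Young's inequality, height
    is [m], seen only through [r]. The critical value is [ell r0 = 1 / (ps * zt)] with
    [zt = b + (l - 1) / ps], since [Q'] has the sign of [zt * ell - 1 / ps]. The involution
    exchanges [b] and [zt] up to the factor [1 / l], which is the source of the symmetry. *)

Lemma mean_value f df a b : a < b ->
  (forall x, a < x < b -> is_derive x 1 f (df x)) ->
  (forall x, a <= x <= b -> {for x, continuous f}) ->
  exists2 c, a < c < b & f b - f a = df c * (b - a).
Proof.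
move=> ab fdf cf.
have [c cab fE] : exists2 c, c \in `]a, b[%R & f b - f a = df c * (b - a).
  apply: MVT => //.
  apply: continuous_in_subspaceT => x; rewrite inE/= in_itv/= => xab.
  exact: cf.
by exists c => //; move: cab; rewrite in_itv.
Qed.

Lemma derive_ge0_le f df a b : a <= b ->
  (forall x, a < x < b -> is_derive x 1 f (df x)) ->
  (forall x, a <= x <= b -> {for x, continuous f}) ->
  (forall x, a < x < b -> 0 <= df x) -> f a <= f b.
Proof.
rewrite le_eqVlt => /predU1P[->//|ab] fdf cf df0.
have [c cab fE] := mean_value ab fdf cf.
by rewrite -subr_ge0 fE mulr_ge0 ?df0// subr_ge0 ltW.
Qed.

Lemma derive_gt0_lt f df a b : a < b ->
  (forall x, a < x < b -> is_derive x 1 f (df x)) ->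
  (forall x, a <= x <= b -> {for x, continuous f}) ->
  (forall x, a < x < b -> 0 < df x) -> f a < f b.
Proof.
move=> ab fdf cf df0; have [c cab fE] := mean_value ab fdf cf.
by rewrite -subr_gt0 fE mulr_gt0 ?df0// subr_gt0.
Qed.

Lemma derive0_eq f df a b : a <= b ->
  (forall x, a < x < b -> is_derive x 1 f (df x)) ->
  (forall x, a <= x <= b -> {for x, continuous f}) ->
  (forall x, a < x < b -> df x = 0) -> f a = f b.
Proof.
rewrite le_eqVlt => /predU1P[->//|ab] fdf cf df0.
have [c cab fE] := mean_value ab fdf cf.
by apply/eqP; rewrite eq_sym -subr_eq0 fE df0 ?mul0r.
Qed.

Lemma intermediate_value f a b v : a <= b ->
  (forall x, a <= x <= b -> {for x, continuous f}) ->
  (f a <= v <= f b) || (f b <= v <= f a) ->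
  exists2 c, a <= c <= b & f c = v.
Proof.
move=> ab cf fv.
have [||c cab <-] := @IVT _ f a b v ab.
- apply: continuous_in_subspaceT => x; rewrite inE/= in_itv/= => xab.
  exact: cf.
- by rewrite ge_min le_max; case/orP: fv => /andP[-> ->]; rewrite ?orbT.
by exists c => //; move: cab; rewrite in_itv.
Qed.

(** Infimum of the closed set where [f <= d]. A density may vanish and become positive again, so
    every half-line argument is run only up to such a first crossing. *)
Lemma first_hit f d t1 : continuous f -> d < f 0 -> 0 <= t1 -> f t1 <= d ->
  exists t, [/\ 0 < t, t <= t1, f t = d & forall y, 0 <= y < t -> d < f y].
Proof.
move=> cf f0 t10 ft1.
pose S := [set t | 0 <= t /\ f t <= d].
have S0 : S !=set0 by exists t1.
have lS : lbound S 0 by move=> t [].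
have hS : has_inf S by split => //; exists 0.
pose t := inf S.
have t0 : 0 <= t by exact: lb_le_inf.
have ltd y : 0 <= y < t -> d < f y.
  move=> /andP[y0 yt]; rewrite ltNge; apply/negP => fyd.
  by move: yt; rewrite ltNge => /negP; apply; apply: ge_inf => //; exists 0.
have ftd : f t <= d.
  rewrite leNgt; apply/negP => dft.
  have /nbhs_ballP[e /= e0 be] : \forall y \near t, d < f y.
    exact: (cvgr_gt _ (cf t) _ dft).
  have [y [y0 fy] yte] := inf_adherent e0 hS.
  have ty : t <= y by apply: ge_inf => //; exists 0.
  suff : d < f y by rewrite ltNge fy.
  by apply: be; rewrite /ball/= distrC ger0_norm ?subr_ge0// ltrBlDl.
have tgt0 : 0 < t.
  by rewrite lt_neqAle t0 andbT; apply/eqP => t_0; move: f0; rewrite t_0 ltNge ftd.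
have tt1 : t <= t1 by apply: ge_inf => //; exists 0.
exists t; split => //; apply/eqP; rewrite eq_le ftd/=.
have [y yt fy] : exists2 y, 0 <= y <= t & f y = d.
  apply: intermediate_value => //; first by move=> x _; exact: cf.
  by rewrite ftd (ltW f0) orbT.
move: yt => /andP[y0 yt]; have [yt'|ty] := ltP y t.
  by have := ltd y; rewrite y0 yt' fy ltxx => /(_ isT).
have <- : y = t by apply/le_anti; rewrite yt ty.
by rewrite fy.
Qed.

(** By the mean value theorem a difference quotient at [c] is a value of [f] nearby. This settles
    the points where derivative formulas do not apply: the peak of the extremal profile and, for
    primitives, the edge of its support. *)
Lemma is_derive_extend f F c :
  {for c, continuous F} -> {for c, continuous f} ->
  (\forall x \near c, x != c -> is_derive x 1 F (f x)) ->
  is_derive c 1 F (f c).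
Proof.
move=> cF cf dF.
have FC h : h != 0 -> (forall x, x != c -> `|x - c| <= `|h| -> is_derive x 1 F (f x)) ->
    exists2 x, `|x - c| <= `|h| & h^-1 * (F (c + h) - F c) = f x.
  move=> h0 dFh.
  have [hgt0|hlt0|h_0] := ltgtP 0 h; last by rewrite h_0 eqxx in h0.
  - have [|||x /andP[cx xch] FE] := @mean_value F f c (c + h).
    + by rewrite ltrDl.
    + move=> x /andP[cx xch]; apply: dFh; first by rewrite gt_eqF.
      by rewrite !gtr0_norm ?subr_gt0//; lra.
    + move=> x /andP[]; rewrite le_eqVlt => /predU1P[<-//|cx] xch.
      apply: differentiable_continuous; apply/derivable1_diffP.
      have : is_derive x 1 F (f x).
        apply: dFh; first by rewrite gt_eqF.
        by rewrite !gtr0_norm ?subr_gt0//; lra.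
      by case.
    exists x; first by rewrite !gtr0_norm ?subr_gt0//; lra.
    by rewrite FE addrAC subrr add0r mulrCA mulVf ?mulr1.
  - have [|||x /andP[cx xch] FE] := @mean_value F f (c + h) c.
    + by rewrite gtrDl.
    + move=> x /andP[cx xch]; apply: dFh; first by rewrite lt_eqF.
      by rewrite !ltr0_norm ?subr_lt0//; lra.
    + move=> x /andP[cx]; rewrite le_eqVlt => /predU1P[->//|xch].
      apply: differentiable_continuous; apply/derivable1_diffP.
      have : is_derive x 1 F (f x).
        apply: dFh; first by rewrite lt_eqF.
        by rewrite !ltr0_norm ?subr_lt0//; lra.
      by case.
    exists x; first by rewrite !ltr0_norm ?subr_lt0//; lra.
    rewrite -opprB FE mulrN; have -> : c - (c + h) = - h by ring.
    by rewrite !mulrN opprK mulrCA mulVf ?mulr1.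
suff lF : h^-1 *: ((F \o shift c) (h *: 1) - F c) @[h --> 0^'] --> f c.
  by split; [apply/cvg_ex; exists (f c)|apply/cvg_lim].
apply/cvgrPdist_lt => e e0.
move/cvgrPdist_lt : cf => /(_ _ e0) /nbhs_ballP[r1 /= r10 br1].
move: dF => /nbhs_ballP[r2 /= r20 br2].
near=> h.
have h0 : h != 0 by near: h; exact: nbhs_dnbhs_neq.
have hr1 : `|h| < r1 by near: h; apply: dnbhs0_lt.
have hr2 : `|h| < r2 by near: h; apply: dnbhs0_lt.
have [x cx xch|x xch] := FC h h0.
  by apply: br2 => //; rewrite /ball/= distrC (le_lt_trans xch).
rewrite /= [h *: 1]mulr1 [h + c]addrC /GRing.scale/= => ->.
by apply: br1; rewrite /ball/= distrC (le_lt_trans xch).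
Unshelve. all: by end_near.
Qed.

End RealAnalysis.

Section LebesgueLine.
Context {R : realType}.
Implicit Types (f F : R -> R) (a b c l x y : R).
Local Notation mu := (@lebesgue_measure R).

Lemma le_Rintegral_subset (A B : set (measurableTypeR R)) f :
  measurable A -> measurable B -> A `<=` B ->
  (forall x, B x -> 0 <= f x) -> mu.-integrable B (EFin \o f) ->
  \int[mu]_(x in A) f x <= \int[mu]_(x in B) f x.
Proof.
move=> mA mB AB f0 fB; have fA := integrableS mB mA AB fB.
rewrite /Rintegral fine_le ?integrable_fin_num//.
apply: ge0_subset_integral => //; first exact: measurable_int fB.
Qed.

(** With base point at -oo and [f] nonnegative, this is monotone and lies between 0 and the total
    integral. It is differentiable wherever [f] is continuous, so integrands that are irregular off
    the support cause no trouble. *)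
Definition lower_integral f x := \int[mu]_(t in `]-oo, x]) f t.

Section Cumulative.
Variable f : R -> R.
Hypothesis f0 : forall x, 0 <= f x.
Hypothesis fint : mu.-integrable setT (EFin \o f).

Lemma lower_integral_ge0 x : 0 <= lower_integral f x.
Proof. by apply: Rintegral_ge0. Qed.

Lemma lower_integral_le_total x : lower_integral f x <= \int[mu]_t f t.
Proof. by apply: le_Rintegral_subset. Qed.

Lemma lower_integral_nd x y : x <= y -> lower_integral f x <= lower_integral f y.
Proof.
move=> xy; apply: le_Rintegral_subset => //.
- by move=> t /=; rewrite !in_itv/= => /le_trans; apply.
- exact: integrableS fint.
Qed.

Lemma is_derive_lower_integral x : {for x, continuous f} ->
  is_derive x 1 (lower_integral f) (f x).
Proof.
move=> cf.
have x1 : x < x + 1 by rewrite ltrDl.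
have fx1 : mu.-integrable `]-oo, (x + 1)] (EFin \o f) by exact: integrableS fint.
have [d1 d2] : derivable (lower_integral f) x 1 /\ derive1 (lower_integral f) x = f x.
  exact: (continuous_FTC1 x1 fx1 (ltNyr x) cf).
by split; [exact: d1|rewrite -derive1E d2].
Qed.

End Cumulative.

Lemma is_derive_continuous f d x : is_derive x 1 f d -> {for x, continuous f}.
Proof.
by move=> [df _]; apply: differentiable_continuous; apply/derivable1_diffP.
Qed.

Lemma ge0_integral_line f F l1 l2 : (forall x, 0 <= f x) -> continuous f ->
  (forall x, is_derive x 1 F (f x)) ->
  F x @[x --> -oo] --> l1 -> F x @[x --> +oo] --> l2 ->
  mu.-integrable setT (EFin \o f) /\ \int[mu]_x f x = l2 - l1.
Proof.
move=> f0 cf dF F1 F2.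
have cfw A : {within A, continuous f} by apply: continuous_subspaceT.
have right : (\int[mu]_(x in `[0%R, +oo[) (f x)%:E = l2%:E - (F 0)%:E)%E.
  apply: ge0_continuous_FTC2y => //.
  - by apply: cvg_at_right_filter; exact: is_derive_continuous (dF 0).
  - by move=> x _; rewrite derive1E; apply: derive_val; exact: dF.
have left : (\int[mu]_(x in `]-oo, 0%R]) (f x)%:E = (F 0)%:E - l1%:E)%E.
  rewrite -[X in `]-oo, X]]oppr0 ge0_integration_by_substitutionNy//.
  have dG x : is_derive x 1 (fun y => - F (- y)) (f (- x)).
    have dN : is_derive x 1 (-%R : R -> R) (-1) by exact: is_deriveNid.
    have := is_deriveN (@is_derive1_comp _ F _ _ _ _ (dF _) dN).
    by rewrite mulrN1 opprK.
  rewrite (@ge0_continuous_FTC2y R _ (fun y => - F (- y)) 0 (- l1)) => //.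
  - by rewrite oppr0 -!EFinB opprK addrC.
  - by move=> x _; exact: f0.
  - apply: continuous_subspaceT => x; apply: continuous_comp => //.
      exact: opp_continuous.
    exact: cf.
  - apply: cvgN.
    exact: ((cvgNy_compNP F (nbhs l1)).1 F1).
  - by apply: cvg_at_right_filter; exact: is_derive_continuous (dG 0).
  - by move=> x _; rewrite derive1E; apply: derive_val; exact: dG.
have total : (\int[mu]_x (f x)%:E = (l2 - l1)%:E)%E.
  have -> : [set: R] = `]-oo, 0%R] `|` `]0%R, +oo[.
    by rewrite -itv_bndbnd_setU// set_itvE.
  rewrite ge0_integral_setU//=; last 3 first.
  - by apply/measurable_EFinP; apply: measurable_funTS; exact: continuous_measurable_fun.
  - by move=> x _; rewrite lee_fin.
  - rewrite disj_set2E; apply/eqP; rewrite -subset0 => x [] /=.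
    by rewrite !in_itv/= andbT => x0 /(le_lt_trans x0); rewrite ltxx.
  rewrite left integral_itv_obnd_cbnd; last first.
    by apply/measurable_EFinP; apply: measurable_funTS; exact: continuous_measurable_fun.
  by rewrite right -!EFinB -EFinD; congr EFin; ring.
split; last by rewrite /Rintegral total.
apply/integrableP; split.
  by apply/measurable_EFinP; exact: continuous_measurable_fun.
under eq_integral do rewrite /= ger0_norm//.
by rewrite total ltry.
Qed.

Lemma ge0_integral_affine f F l1 l2 x0 s : 0 < s ->
  (forall x, 0 <= f x) -> continuous f ->
  (forall x, is_derive x 1 F (f x)) ->
  F x @[x --> -oo] --> l1 -> F x @[x --> +oo] --> l2 ->
  mu.-integrable setT (EFin \o (fun x => f ((x - x0) / s))) /\
  \int[mu]_x f ((x - x0) / s) = s * (l2 - l1).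
Proof.
move=> s0 f0 cf dF F1 F2.
have dA x : is_derive x 1 (fun y => (y - x0) / s) s^-1.
  by apply: is_derive_eq; rewrite subr0 /GRing.scale/= mulr0 add0r mulr1.
rewrite mulrBr; apply: (@ge0_integral_line _ (fun x => s * F ((x - x0) / s))) => //.
- move=> x; apply: (@continuous_comp _ _ _ (fun y => (y - x0) / s) f); last exact: cf.
  exact: is_derive_continuous (dA x).
- move=> x; rewrite -[f _](mulfVK (lt0r_neq0 s0)) mulrC.
  apply: is_deriveZ; exact: is_derive1_comp (dF _) (dA x).
- apply: cvgMr; apply: cvg_comp F1; apply/cvgrNyPle => A.
  exists (s * A + x0); split; first exact: num_real.
  by move=> y /= yA; rewrite ler_pdivrMr// lerBlDr mulrC ltW.
- apply: cvgMr; apply: cvg_comp F2; apply/cvgryPge => A.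
  exists (s * A + x0); split; first exact: num_real.
  by move=> y /= yA; rewrite ler_pdivlMr// lerBrDr mulrC ltW.
Qed.

(** The exponent may be negative, so the integral is improper at 0: monotone convergence along
    truncations whose integrals are at most [x^a / a]. *)
Lemma integrable_powR a x : 0 < a -> 0 < x ->
  mu.-integrable `[0, x] (EFin \o (fun t => t `^ (a - 1))).
Proof.
move=> a0 x0.
have mp (A : set (measurableTypeR R)) :
    measurable_fun A (EFin \o (fun t : R => t `^ (a - 1))).
  by apply/measurable_EFinP; apply: measurable_funTS; exact: measurable_powR.
apply/integrableP; split; first exact: mp.
under eq_integral do rewrite /= ger0_norm ?powR_ge0//.
(* [n.+2] keeps the lower endpoint strictly below [x] even for [n = 0]. The truncations exhaust only
   []0, x]]; the point 0 is negligible. *)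
pose E (n : nat) : set (measurableTypeR R) := [set` `[x / n.+2%:R, x]].
have En n : (\int[mu]_(t in E n) (t `^ (a - 1))%:E <= (x `^ a / a)%:E)%E.
  have xn : 0 < x / n.+2%:R by rewrite divr_gt0.
  have xnx : x / n.+2%:R < x.
    by rewrite ltr_pdivrMr// ltr_pMr// ltr1n.
  have dpow (t : R) : 0 < t -> is_derive t 1 (fun t : R => t `^ a / a) (t `^ (a - 1)).
    move=> t0; have dt := is_derive1_powR a t0.
    apply: is_derive_eq; rewrite /GRing.scale/= mulr0 add0r.
    by rewrite mulrC mulrAC mulfV ?mul1r// gt_eqF.
  rewrite (@continuous_FTC2 _ _ (fun t => t `^ a / a))//.
  - by rewrite -EFinB lee_fin lerBlDr lerDl divr_ge0 ?powR_ge0// ltW.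
  - apply: continuous_in_subspaceT => t; rewrite inE/= in_itv/= => /andP[xt _].
    exact: is_derive_continuous (is_derive1_powR _ (lt_le_trans xn xt)).
  - split.
    + by move=> t; rewrite in_itv/= => /andP[xt _]; case: (dpow t (lt_trans xn xt)).
    + by apply: cvg_at_right_filter; exact: is_derive_continuous (dpow _ xn).
    + by apply: cvg_at_left_filter; exact: is_derive_continuous (dpow _ x0).
  - move=> t; rewrite in_itv/= => /andP[xt _]; rewrite derive1E.
    by apply: derive_val; exact: dpow (lt_trans xn xt).
have -> : (\int[mu]_(t in `[0%R, x]) (t `^ (a - 1))%:E =
    \int[mu]_(t in \bigcup_n E n) (t `^ (a - 1))%:E)%E.
  rewrite -integral_itv_obnd_cbnd; last exact: mp.
  congr (integral _ _ _); apply/seteqP; split => t /=; rewrite in_itv/=.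
    move=> /andP[t0 tx].
    have xt0 : 0 <= x / t by rewrite divr_ge0// ltW// (lt_le_trans t0).
    exists (Num.bound (x / t)) => //; rewrite /E/= in_itv/= tx andbT ler_pdivrMr// mulrC -ler_pdivrMr//.
    by rewrite (le_trans (ltW (archi_boundP xt0)))// ler_nat leqW.
  by move=> [n _]; rewrite /E/= in_itv/= => /andP[/(lt_le_trans _)-> //]; rewrite divr_gt0.
have ndE : nondecreasing_seq E.
  move=> m n mn; apply/subsetPset => t; rewrite /E/= !in_itv/= => /andP[xt ->].
  by rewrite andbT (le_trans _ xt)// ler_pM2l// lef_pV2 ?posrE// ler_nat !ltnS.
apply: (@le_lt_trans _ _ (x `^ a / a)%:E); last by rewrite ltry.
have := @ge0_nondecreasing_set_cvg_integral _ _ R E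
  (EFin \o (fun t => t `^ (a - 1))) mu ndE.
move/(_ (fun=> measurable_itv _) (fun=> mp _)).
have p0 i t : E i t -> (0 <= (t `^ (a - 1))%:E)%E by rewrite lee_fin powR_ge0.
move=> /(_ p0); apply: cvge_le; exact: nearW.
Qed.

Section WeightedPower.
Variables (a : R) (g : R -> R).
Hypothesis a0 : 0 < a.
Hypothesis mg : measurable_fun setT g.

(** [g] is only required to be bounded on [[0, x]]: it will be [exp (- c t)] or [(1 - t)^(q - 1)],
    the latter unbounded near 1 when [q < 1]. *)
Lemma integrable_powR_mul x C : 0 < x -> (forall t, 0 <= t <= x -> `|g t| <= C) ->
  mu.-integrable `[0, x] (EFin \o (fun t => t `^ (a - 1) * g t)).
Proof.
move=> x0 gC.
have ic : mu.-integrable `[0, x] (EFin \o (fun t => C * t `^ (a - 1))).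
  exact: (integrableZl _ C (integrable_powR a0 x0)).
apply: le_integrable ic => //.
  apply/measurable_EFinP; apply: measurable_funM.
    by apply: measurable_funTS; exact: measurable_powR.
  exact: measurable_funTS.
move=> t /= t0x; rewrite lee_fin normrM [leRHS]normrM mulrC.
by rewrite ler_wpM2r// (le_trans (gC _ _)) ?ler_norm//.
Qed.

Lemma weighted_power_integral_le0 x : x <= 0 ->
  \int[mu]_(t in `[0, x]) (t `^ (a - 1) * g t) = 0.
Proof.
rewrite le_eqVlt => /predU1P[->|x0]; first by rewrite set_itv1 Rintegral_set1.
by rewrite set_itv_ge ?Rintegral_set0// bnd_simp -ltNge.
Qed.

(** At 0 the derivative may be infinite, so continuity comes from integrability; for [x <= 0] the
    interval is empty or a point and the function is 0. *)
Lemma continuous_weighted_power_integral x C : 0 < x ->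
  (forall t, 0 <= t <= x -> `|g t| <= C) ->
  {for 0, continuous (fun x => \int[mu]_(t in `[0, x]) (t `^ (a - 1) * g t))}.
Proof.
move=> x0 gC; rewrite /prop_for /continuous_at weighted_power_integral_le0//.
exact: (parameterized_integral_cvg_left x0 (integrable_powR_mul x0 gC)).
Qed.

Lemma is_derive_weighted_power_integral x u C : 0 < x -> x < u ->
  (forall t, 0 <= t <= u -> `|g t| <= C) -> {for x, continuous g} ->
  is_derive x 1 (fun x => \int[mu]_(t in `[0, x]) (t `^ (a - 1) * g t))
    (x `^ (a - 1) * g x).
Proof.
move=> x0 xu gC gx.
have cf : {for x, continuous (fun t => t `^ (a - 1) * g t)}.
  by apply: continuousM gx; exact: is_derive_continuous (is_derive1_powR _ x0).
have [d1 d2] := continuous_FTC1_closed xu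
  (integrable_powR_mul (lt_trans x0 xu) gC) x0 cf.
by split; [exact: d1|rewrite -derive1E d2].
Qed.

End WeightedPower.

End LebesgueLine.

(** * Young's inequality and the Tsallis logarithm *)

Section Powers.
Context {R : realType}.
Implicit Types (x y r s t : R).

Lemma powRE x r : 0 < x -> x `^ r = expR (r * ln x).
Proof. by move=> x0; rewrite /powR gt_eqF. Qed.

Lemma powR_add x r s : 0 < x -> x `^ (r + s) = x `^ r * x `^ s.
Proof. by move=> x0; rewrite powRD// (gt_eqF x0) implybT. Qed.

Lemma powRK x r : r != 0 -> 0 <= x -> (x `^ r) `^ r^-1 = x.
Proof. by move=> r0 x0; rewrite -powRrM mulfV// powRr1. Qed.

Lemma continuous_powR r x : 0 < x -> {for x, continuous (fun t : R => t `^ r)}.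
Proof. by move=> x0; exact: is_derive_continuous (is_derive1_powR r x0). Qed.

(** The truncation is there because [powR] of a negative base does not tend to 0. It is inserted
    wherever a power of a nonnegative function that may vanish is shown to be continuous. *)
Lemma continuous_powR_ge0 r : 0 < r -> continuous (fun t : R => Num.max 0 t `^ r).
Proof.
move=> r0 x; have [x0|x0|->] := ltgtP x 0.
- have : {near x, (fun=> 0) =1 (fun t : R => Num.max 0 t `^ r)}.
    near=> t; have t0 : t < 0 by near: t; exact: lt_nbhsl.
    by rewrite (max_idPl (ltW t0)) powR0 ?gt_eqF.
  move=> /near_eq_cvg/cvg_trans; apply.
  by rewrite (max_idPl (ltW x0)) powR0 ?gt_eqF//; exact: cvg_cst.
- have : {near x, (fun t : R => t `^ r) =1 (fun t : R => Num.max 0 t `^ r)}.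
    near=> t; have t0 : 0 < t by near: t; exact: lt_nbhsr.
    by rewrite (max_idPr (ltW t0)).
  move=> /near_eq_cvg/cvg_trans; apply.
  by rewrite (max_idPr (ltW x0)); exact: continuous_powR.
- rewrite /continuous_at maxxx powR0 ?gt_eqF//; apply/cvgrPdist_lt => e e0; near=> t.
  rewrite sub0r normrN ger0_norm ?powR_ge0//.
  have -> : e = (e `^ r^-1) `^ r by rewrite -powRrM mulVf ?gt_eqF// powRr1// ltW.
  rewrite gt0_ltr_powR ?nnegrE ?powR_ge0//; first by rewrite le_max lexx.
  rewrite gt_max powR_gt0//=.
  by near: t; apply: lt_nbhsl; exact: powR_gt0.
Unshelve. all: by end_near. Qed.

End Powers.

Section Young.
Context {R : realType}.
Variables p : R.
Hypothesis p1 : 1 < p.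
Notation ps := (conj_exp p).
Implicit Types x y : R.

Lemma p_gt0 : 0 < p. Proof. exact: lt_trans ltr01 p1. Qed.
Lemma conj_exp_gt1 : 1 < ps.
Proof. by rewrite /conj_exp ltr_pdivlMr ?subr_gt0//; lra. Qed.
Lemma conj_exp_gt0 : 0 < ps. Proof. exact: lt_trans ltr01 conj_exp_gt1. Qed.
Lemma conj_expV : ps^-1 = 1 - p^-1.
Proof.
rewrite /conj_exp; field; rewrite ?gt_eqF ?p_gt0//=; have := p1; lra.
Qed.

Lemma conj_exp_split x : x / p + x / ps = x.
Proof. by rewrite conj_expV; ring. Qed.

(** Tangent line of [expR] at the weighted mean [c]: the two tangent values average to [expR c], and
    the tangent inequality is strict away from [c], which differs from [x] unless [x = y]. *)
Let young_expR x y : expR (x / p + y / ps) <= expR x / p + expR y / ps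
  ?= iff (x == y).
Proof.
have pV0 : 0 < p^-1 by rewrite invr_gt0 p_gt0.
have qV0 : 0 < ps^-1 by rewrite invr_gt0 conj_exp_gt0.
set c := x / p + y / ps.
have pq : p^-1 + ps^-1 = 1 by rewrite conj_expV; ring.
have tan t : expR c * (1 + (t - c)) <= expR t.
  have {2}-> : t = c + (t - c) by ring.
  by rewrite (expRD c) ler_pM2l ?expR_gt0// expR_ge1Dx.
have c0 : (1 + (x - c)) / p + (1 + (y - c)) / ps = 1.
  have -> : (1 + (x - c)) / p + (1 + (y - c)) / ps =
    (1 - c) * (p^-1 + ps^-1) + c by rewrite /c; ring.
  by rewrite pq; ring.
have E : expR c = expR c * (1 + (x - c)) / p + expR c * (1 + (y - c)) / ps.
  by rewrite -!mulrA -mulrDr c0 mulr1.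
have [xy|xy] := eqVneq x y; split => //.
- by rewrite [leLHS]E lerD// ler_pM2r// tan.
- apply/eqP; rewrite -xy -mulrDr pq mulr1 /c -xy -mulrDr pq mulr1//.
- by rewrite [leLHS]E lerD// ler_pM2r// tan.
- apply: lt_eqF; rewrite [ltLHS]E; apply: ltr_leD; last by rewrite ler_pM2r// tan.
  rewrite ltr_pM2r//.
  have {2}-> : x = c + (x - c) by ring.
  rewrite (expRD c) ltr_pM2l ?expR_gt0//; apply: expR_gt1Dx; rewrite subr_eq0.
  have -> : c = x + (y - x) / ps by rewrite /c conj_expV; ring.
  rewrite -subr_eq0 opprD addNKr oppr_eq0 mulf_eq0 (gt_eqF qV0) orbF subr_eq0 eq_sym; exact: xy.
Qed.

Lemma young_powR x y : 0 <= x -> 0 < y -> x * y <= x `^ p / p + y `^ ps / ps.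
Proof.
move=> x0 y0; move: x0; rewrite le_eqVlt => /predU1P[<-|x0].
  by rewrite mul0r addr_ge0// divr_ge0 ?powR_ge0// ltW// ?p_gt0 ?conj_exp_gt0.
rewrite !powRE//; have [+ _] := young_expR (p * ln x) (ps * ln y).
rewrite [p * _]mulrC [ps * _]mulrC !mulfK ?(lt0r_neq0 p_gt0) ?(lt0r_neq0 conj_exp_gt0)//.
by rewrite expRD !lnK ?posrE.
Qed.

Lemma young_powR_eq x y : 0 <= x -> 0 < y ->
  x * y = x `^ p / p + y `^ ps / ps -> x `^ p = y `^ ps.
Proof.
move=> x0 y0; move: x0; rewrite le_eqVlt => /predU1P[<-|x0].
  rewrite mul0r => /esym/eqP; rewrite powR0 ?gt_eqF ?p_gt0// mul0r add0r.
  by rewrite divr_gt0 ?powR_gt0 ?conj_exp_gt0.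
rewrite !powRE//; have [_] := young_expR (p * ln x) (ps * ln y).
rewrite [p * _]mulrC [ps * _]mulrC !mulfK ?(lt0r_neq0 p_gt0) ?(lt0r_neq0 conj_exp_gt0)//.
rewrite expRD !lnK ?posrE// => + xyE.
by rewrite xyE eqxx => /esym/eqP ->.
Qed.

End Young.

Section TsallisLog.
Context {R : realType}.
Implicit Types (l s t c x : R).

Definition tlog l s : R := if l == 1 then - ln s else (1 - s `^ (l - 1)) / (l - 1).

(** Among positive arguments the truncation acts only beyond 1, where a density divided by its
    maximum never goes. It makes [ell] nonnegative and continuous on both sides of 1, so that its
    fractional powers can be handled at the maximum. *)
Definition ell l s : R := Num.max 0 (tlog l s).

Let tlog1 l : tlog l 1 = 0.
Proof. by rewrite /tlog ln1 powR1 oppr0 subrr mul0r if_same. Qed.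

Let is_derive_tlog l s : 0 < s -> is_derive s 1 (tlog l) (- s `^ (l - 2)).
Proof.
move=> s0; rewrite /tlog; have [->|l1] := eqVneq l 1.
  have dl := is_derive1_ln s0.
  have -> : 1 - 2 = - 1 :> R by ring.
  by rewrite powR_inv1 ?ltW//; apply: is_deriveN.
have dp := is_derive1_powR (l - 1) s0.
apply: is_derive_eq; rewrite /GRing.scale/= mulr0 !add0r mul1r.
have -> : l - 1 - 1 = l - 2 by ring.
by rewrite mulrN mulKf// subr_eq0.
Qed.

Let tlog_lt l s t : 0 < s -> s < t -> tlog l t < tlog l s.
Proof.
move=> s0 st; rewrite -ltrN2.
apply: (@derive_gt0_lt _ (fun x => - tlog l x) (fun x => x `^ (l - 2))) => //.
- move=> x /andP[sx _]; have := is_derive_tlog l (lt_trans s0 sx).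
  by move/is_deriveN; rewrite opprK.
- move=> x /andP[sx _]; apply: continuousN.
  exact: is_derive_continuous (is_derive_tlog l (lt_le_trans s0 sx)).
- by move=> x /andP[sx _]; rewrite powR_gt0// (lt_trans s0).
Qed.

Lemma ell_ge0 l s : 0 <= ell l s. Proof. by rewrite /ell le_max lexx. Qed.

Lemma ell_ge1 l s : 1 <= s -> ell l s = 0.
Proof.
rewrite le_eqVlt => /predU1P[<-|s1]; first by rewrite /ell tlog1 maxxx.
by apply/max_idPl; rewrite -[leRHS](tlog1 l) ltW// tlog_lt.
Qed.

Lemma ellE l s : 0 < s -> s <= 1 -> ell l s = tlog l s.
Proof.
move=> s0; rewrite le_eqVlt => /predU1P[->|s1]; first by rewrite /ell tlog1 maxxx.
by apply/max_idPr; rewrite -[leLHS](tlog1 l) ltW// tlog_lt.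
Qed.

Lemma ell_tlog l s : 0 < s -> 0 < tlog l s -> s < 1 /\ ell l s = tlog l s.
Proof.
move=> s0 es; suff s1 : s < 1 by rewrite ellE// ltW.
rewrite ltNge; apply/negP; rewrite le_eqVlt => /predU1P[s1|s1].
  by move: es; rewrite -s1 tlog1 ltxx.
by have := lt_trans es (tlog_lt l ltr01 s1); rewrite tlog1 ltxx.
Qed.

Lemma ell_lt l s t : 0 < s -> s < t -> t <= 1 -> ell l t < ell l s.
Proof.
move=> s0 st t1; rewrite ellE ?(lt_trans s0 st)// ellE ?(le_trans (ltW st) t1)//.
exact: tlog_lt.
Qed.

Lemma ell_gt0 l s : 0 < s -> s < 1 -> 0 < ell l s.
Proof. by move=> s0 s1; rewrite -(ell_ge1 l (lexx 1)) ell_lt. Qed.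

Lemma ell_inj l s t : 0 < s <= 1 -> 0 < t <= 1 -> ell l s = ell l t -> s = t.
Proof.
move=> /andP[s0 s1] /andP[t0 t1] est; have [st|ts|//] := ltgtP s t.
- by have := ell_lt l s0 st t1; rewrite est ltxx.
- by have := ell_lt l t0 ts s1; rewrite est ltxx.
Qed.

Lemma continuous_ell l s : 0 < s -> {for s, continuous (ell l)}.
Proof.
move=> s0; apply: continuous_max; first exact: cst_continuous.
exact: is_derive_continuous (is_derive_tlog l s0).
Qed.

Lemma is_derive_ell l s : 0 < s < 1 -> is_derive s 1 (ell l) (- s `^ (l - 2)).
Proof.
move=> /andP[s0 s1]; have := is_derive_tlog l s0.
apply: near_eq_is_derive.
near=> t; rewrite ellE//; first by near: t; exact: lt_nbhsr.
by apply: ltW; near: t; exact: lt_nbhsl.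
Unshelve. all: by end_near. Qed.

Lemma mul_ell l s : 0 < l -> l != 1 -> 0 <= s <= 1 ->
  s * ell l s = (s - s `^ l) / (l - 1).
Proof.
move=> l0 l1 /andP[]; rewrite le_eqVlt => /predU1P[<- _|s0 s1].
  by rewrite powR0 ?gt_eqF// subrr !mul0r.
by rewrite ellE// /tlog (negbTE l1) mulrA mulrBr mulr1 mulr_powRB1// ltW.
Qed.

Lemma mul_ell1 s : 0 <= s <= 1 -> s * ell 1 s = - (s * ln s).
Proof.
move=> /andP[]; rewrite le_eqVlt => /predU1P[<- _|s0 s1].
  by rewrite !mul0r oppr0.
by rewrite ellE// /tlog eqxx mulrN.
Qed.

Lemma ellE_neq1 l s : l != 1 -> 0 < s <= 1 ->
  ell l s = (1 - s `^ (l - 1)) / (l - 1).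
Proof. by move=> l1 /andP[s0 s1]; rewrite ellE// /tlog (negbTE l1). Qed.

Lemma ellE_1 s : 0 < s <= 1 -> ell 1 s = - ln s.
Proof. by move=> /andP[s0 s1]; rewrite ellE// /tlog eqxx. Qed.

(** For [l <= 1] the function [ell] is unbounded at 0. Comparing derivatives on [[s, 1]] bounds it
    by the Tsallis logarithm of the smaller parameter [x], which is at most a pure power. *)
Lemma ell_le_powR l x s : x < l -> x < 1 -> 0 < s <= 1 ->
  ell l s <= s `^ (x - 1) / (1 - x).
Proof.
move=> xl x1 /andP[s0 s1]; rewrite ellE//.
apply: (@le_trans _ _ (tlog x s)).
  rewrite -subr_ge0.
  have -> : 0 = tlog x 1 - tlog l 1 by rewrite !tlog1 subrr.
  rewrite -lerN2.
  apply: (@derive_ge0_le _ (fun t => - (tlog x t - tlog l t))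
      (fun t => - (- t `^ (x - 2) - - t `^ (l - 2)))) => //.
  - move=> t /andP[st _]; have t0 := lt_trans s0 st.
    exact: (is_deriveN (is_deriveB (is_derive_tlog x t0) (is_derive_tlog l t0))).
  - move=> t /andP[st _]; have t0 := lt_le_trans s0 st.
    by apply: continuousN; apply: continuousB;
      exact: is_derive_continuous (is_derive_tlog _ t0).
  - move=> t /andP[st t1]; rewrite opprD !opprK subr_ge0.
    apply: ger_powR; last by lra.
    by rewrite (lt_trans s0 st) ltW.
rewrite /tlog lt_eqF// -[leLHS]opprK -mulrN -invrN opprB -mulNr.
by rewrite ler_pM2r ?invr_gt0 ?subr_gt0// opprB gerBl.
Qed.

Lemma powR_small c e : 0 < c -> 0 < e ->
  exists2 d, 0 < d < 1 & forall s, 0 <= s <= d -> s `^ c < e.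
Proof.
move=> c0 e0; pose d := Num.min (2^-1) ((e / 2) `^ c^-1).
have d0 : 0 < d by rewrite lt_min invr_gt0 ltr0n powR_gt0 ?divr_gt0.
exists d.
  by rewrite d0/= gt_min invf_lt1 ?ltr1n.
move=> s /andP[s0 sd]; apply: (@le_lt_trans _ _ (e / 2)); last by lra.
have -> : e / 2 = ((e / 2) `^ c^-1) `^ c.
  by rewrite -powRrM mulVf ?gt_eqF// powRr1// divr_ge0// ltW.
rewrite ge0_ler_powR ?nnegrE ?powR_ge0 ?(ltW c0)//.
by rewrite (le_trans sd)// ge_min lexx orbT.
Qed.

Lemma powR_ell_small l c e : 0 < c -> 1 - c < l -> 0 < e ->
  exists2 d, 0 < d < 1 & forall s, 0 <= s <= d -> s `^ c * ell l s < e.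
Proof.
(* The midpoint of [1 - c] and [min(1, l)] satisfies [x < 1], [x < l] and [c + x - 1 > 0], so a
   positive power of [s] is left over. *)
move=> c0 cl e0; pose x := ((1 - c) + Num.min 1 l) / 2.
have cm : 1 - c < Num.min 1 l by rewrite lt_min cl andbT; lra.
have xm : x < Num.min 1 l by rewrite /x; lra.
have [x1 xl] : x < 1 /\ x < l by move: xm; rewrite lt_min => /andP[].
have cx : 0 < c + (x - 1) by rewrite /x; lra.
have ex : 0 < e * (1 - x) by rewrite mulr_gt0// subr_gt0.
have [d d01 hd] := powR_small cx ex.
exists d => // s /andP[]; rewrite le_eqVlt => /predU1P[<- _|s0 sd].
  by rewrite powR0 ?gt_eqF// mul0r.
apply: (@le_lt_trans _ _ (s `^ c * (s `^ (x - 1) / (1 - x)))).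
  rewrite ler_wpM2l ?powR_ge0// ell_le_powR// s0 (le_trans sd)//.
  by case/andP: d01 => _ /ltW.
rewrite mulrA -powR_add// ltr_pdivrMr ?subr_gt0// hd//.
by rewrite (ltW s0).
Qed.

End TsallisLog.

(** * The weights G' and Q, and the pointwise Young inequality *)

Section Profile.
Context {R : realType}.
Variables p b l : R.
Hypotheses (p1 : 1 < p) (b0 : 0 < b) (l0 : 0 < l).
Notation ps := (conj_exp p).
Hypothesis bl : 1 - b * ps < l.
Implicit Types (s t x : R).

Let pgt0 := p_gt0 p1.
Let psgt0 := conj_exp_gt0 p1.

(* [zeta_par] without the positive part; it is positive exactly on the parameter domain. *)
Definition zeta_min : R := b + (l - 1) / ps.

Lemma zeta_min_gt0 : 0 < zeta_min.
Proof.
have -> : zeta_min = (b * ps + l - 1) / ps.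
  by rewrite /zeta_min; field; rewrite gt_eqF.
by rewrite divr_gt0//; have := bl; lra.
Qed.

Definition gn_deriv s := s `^ (b - 1) * ell l s `^ ps^-1.

Definition gn_weight s := s `^ b * ell l s `^ ps^-1.

(** Trades powers of [s] for [ell], also at [l = 1]; through it the last factor of [dgn_weight]
    becomes affine in [ell], with one formula for all [l]. *)
Lemma powR_ell s : 0 < s <= 1 -> s `^ (l - 1) = 1 - (l - 1) * ell l s.
Proof.
move=> s01; have [->|l1] := eqVneq l 1.
  by rewrite subrr powRr0 mul0r subr0.
by rewrite ellE_neq1// mulrC divfK ?subr_eq0//; ring.
Qed.

Lemma gn_weight_ge0 s : 0 <= gn_weight s.
Proof. by rewrite mulr_ge0 ?powR_ge0. Qed.

Lemma gn_weight_gt0 s : 0 < s < 1 -> 0 < gn_weight s.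
Proof. by move=> /andP[s0 s1]; rewrite mulr_gt0 ?powR_gt0 ?ell_gt0. Qed.

Lemma gn_weight1 : gn_weight 1 = 0.
Proof. by rewrite /gn_weight ell_ge1// powR0 ?mulr0// invr_eq0 gt_eqF. Qed.

Lemma continuous_ell_powR r s : 0 < r -> 0 < s ->
  {for s, continuous (fun t => ell l t `^ r)}.
Proof.
move=> r0 s0.
have -> : (fun t => ell l t `^ r) = (fun x => Num.max 0 x `^ r) \o ell l.
  by apply/funext => t /=; rewrite (max_idPr (ell_ge0 _ _)).
apply: continuous_comp; first exact: continuous_ell.
exact: continuous_powR_ge0.
Qed.

Lemma continuous_gn_weight s : 0 < s -> {for s, continuous gn_weight}.
Proof.
move=> s0; apply: continuousM; first exact: continuous_powR.
by apply: continuous_ell_powR => //; rewrite invr_gt0.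
Qed.

Definition dgn_weight s :=
  s `^ (b - 1) * ell l s `^ (- p^-1) * (zeta_min * ell l s - ps^-1).

Lemma is_derive_gn_weight s : 0 < s < 1 ->
  is_derive s 1 gn_weight (dgn_weight s).
Proof.
move=> s01; have /andP[s0 s1] := s01; have e0 := ell_gt0 l s0 s1.
have d1 := is_derive1_powR b s0.
have d2 : is_derive s 1 (fun t => ell l t `^ ps^-1)
    (ps^-1 * ell l s `^ (ps^-1 - 1) * (- s `^ (l - 2))).
  exact: (is_derive1_comp (is_derive1_powR ps^-1 e0) (is_derive_ell l s01)).
apply: is_derive_eq; rewrite /GRing.scale/=.
have -> : ps^-1 - 1 = - p^-1 by rewrite conj_expV//; ring.
have E : ell l s `^ ps^-1 = ell l s `^ (- p^-1) * ell l s.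
  rewrite -[X in _ * X]powRr1 ?ltW// -powR_add//; congr (_ `^ _).
  by rewrite conj_expV//; ring.
have sE : s `^ b * s `^ (l - 2) = s `^ (b - 1) * (1 - (l - 1) * ell l s).
  rewrite -powR_ell ?s0 ?ltW// -!powR_add//; congr (_ `^ _); ring.
rewrite /dgn_weight E /zeta_min.
transitivity (- (ps^-1 * ell l s `^ (- p^-1)) * (s `^ b * s `^ (l - 2)) +
  ell l s `^ (- p^-1) * ell l s * (b * s `^ (b - 1))); first by ring.
by rewrite sE; ring.
Qed.

(* Expresses the mass of the extremal profile through [G 1]. *)
Lemma is_derive_mass_primitive (G : R -> R) s : 0 < s < 1 ->
  is_derive s 1 G (gn_deriv s) ->
  is_derive s 1 (fun t => ps * (zeta_min * G t - gn_weight t))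
    (s `^ (b - 1) * ell l s `^ (- p^-1)).
Proof.
move=> s01 d1; have /andP[s0 s1] := s01; have e0 := ell_gt0 l s0 s1.
have d2 := is_derive_gn_weight s01.
apply: is_derive_eq; rewrite /GRing.scale/= /gn_deriv /dgn_weight.
have -> : ell l s `^ ps^-1 = ell l s `^ (- p^-1) * ell l s.
  rewrite -[X in _ * X]powRr1 ?ltW// -powR_add//; congr (_ `^ _).
  by rewrite conj_expV//; ring.
by field; rewrite (gt_eqF psgt0).
Qed.

(** The sign of [dgn_weight] is that of [zeta_min * ell - 1 / ps]; as [ell] decreases, it changes
    once, at [r0], from positive to negative. *)
Lemma gn_weight_max r0 r : 0 < r0 < 1 -> ell l r0 = (ps * zeta_min)^-1 ->
  0 < r < 1 -> gn_weight r <= gn_weight r0 ?= iff (r == r0).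
Proof.
move=> /andP[r00 r01] er0 /andP[rgt0 r1].
have z0 := zeta_min_gt0.
have sgn s : s \in `]0, 1[ -> 0 < s `^ (b - 1) * ell l s `^ (- p^-1).
  rewrite in_itv/= => /andP[s0 s1].
  by rewrite mulr_gt0 ?powR_gt0 ?ell_gt0.
have zE : zeta_min * ell l r0 = ps^-1.
  by rewrite er0; field; rewrite !gt_eqF.
have [rr|rr|->] := ltgtP r r0; last by split; rewrite ?eqxx.
- suff : gn_weight r < gn_weight r0 by move=> H; split; [exact: ltW|exact: lt_eqF].
  apply: (@derive_gt0_lt _ _ dgn_weight) => //.
  + move=> x /andP[rx xr0]; apply: is_derive_gn_weight.
    by rewrite (lt_trans rgt0 rx) (lt_trans xr0 r01).
  + by move=> x /andP[rx _]; apply: continuous_gn_weight; exact: lt_le_trans rx.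
  + move=> x /andP[rx xr0]; have x0 := lt_trans rgt0 rx.
    rewrite mulr_gt0 ?sgn ?in_itv/= ?x0 ?(lt_trans xr0)//.
    by rewrite subr_gt0 -zE ltr_pM2l// ell_lt// ltW.
- suff : gn_weight r < gn_weight r0 by move=> H; split; [exact: ltW|exact: lt_eqF].
  rewrite -ltrN2.
  apply: (@derive_gt0_lt _ (fun x => - gn_weight x) (fun s => - dgn_weight s)) => //.
  + move=> x /andP[rx xr0]; apply: is_deriveN; apply: is_derive_gn_weight.
    by rewrite (lt_trans r00 rx) (lt_trans xr0 r1).
  + move=> x /andP[rx _]; apply: continuousN; apply: continuous_gn_weight.
    exact: lt_le_trans rx.
  + move=> x /andP[rx xr0]; have x0 := lt_trans r00 rx.
    rewrite -mulrN mulr_gt0 ?sgn ?in_itv/= ?x0 ?(lt_trans xr0)//.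
    by rewrite opprB subr_gt0 -zE ltr_pM2l// ell_lt// ltW// (lt_trans xr0).
Qed.

(** The [ps]-th power of the weight is [s^(b ps) ell], and the condition [1 - b * ps < l] is what
    [powR_ell_small] asks for. *)
Lemma gn_weight_small e : 0 < e ->
  exists2 d, 0 < d < 1 & forall s, 0 <= s <= d -> gn_weight s < e.
Proof.
move=> e0.
have [||d d01 hd] := @powR_ell_small _ l (b * ps) (e `^ ps) _ bl.
- by rewrite mulr_gt0.
- by rewrite powR_gt0.
exists d => // s /[dup] sd /hd h.
have -> : e = (e `^ ps) `^ ps^-1 by rewrite powRK ?gt_eqF// ltW.
have -> : gn_weight s = (s `^ (b * ps) * ell l s) `^ ps^-1.
  by rewrite powRM ?powR_ge0 ?ell_ge0// powRrM powRK ?powR_ge0// gt_eqF.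
by rewrite gt0_ltr_powR ?nnegrE ?invr_gt0 ?mulr_ge0 ?powR_ge0 ?ell_ge0.
Qed.

(** To be read at a point where the normalized density has value [x] and derivative [dx]; [k] is the
    free dilation parameter. *)
Definition young_rhs k x dx :=
  k `^ p * (`|x `^ (b - 2) * dx| `^ p * x) / p + x * ell l x / ps.

Section Young.
Variables k x dx : R.
Hypotheses (k0 : 0 < k) (x01 : 0 < x < 1).

Let x0 : 0 < x. Proof. by case/andP: x01. Qed.
Let e0 : 0 < ell l x. Proof. by case/andP: x01 => ? ?; exact: ell_gt0. Qed.

(** Splitting [x^(b-1)] as [x^(b-2) x^(1/p) x^(1/ps)] makes the [p]-th power of the first factor and
    the [ps]-th power of the second the two terms of [young_rhs], up to the divisors [p] and
    [ps]. *)
Let lhs1 := k * `|x `^ (b - 2) * dx| * x `^ p^-1.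
Let lhs2 := (x * ell l x) `^ ps^-1.

Let lhs1_ge0 : 0 <= lhs1.
Proof. by rewrite !mulr_ge0 ?powR_ge0// ltW. Qed.

Let lhs2_gt0 : 0 < lhs2.
Proof. by rewrite powR_gt0// mulr_gt0. Qed.

Let lhs1X : lhs1 `^ p = k `^ p * (`|x `^ (b - 2) * dx| `^ p * x).
Proof.
rewrite /lhs1 !powRM ?mulr_ge0 ?powR_ge0 ?(ltW k0)// mulrA; congr (_ * _).
by rewrite -powRrM mulVf ?gt_eqF// powRr1// ltW.
Qed.

Let lhs2X : lhs2 `^ ps = x * ell l x.
Proof. by rewrite /lhs2 -powRrM mulVf ?gt_eqF// powRr1// mulr_ge0// ltW. Qed.

Let lhsM : lhs1 * lhs2 = k * (gn_deriv x * `|dx|).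
Proof.
rewrite /lhs1 /lhs2 normrM (ger0_norm (powR_ge0 _ _)) powRM ?ltW// /gn_deriv.
have -> : x `^ (b - 1) = x `^ (b - 2) * x `^ p^-1 * x `^ ps^-1.
  rewrite -!powR_add//; congr (_ `^ _); rewrite conj_expV//; ring.
ring.
Qed.

Let rhsE : young_rhs k x dx = lhs1 `^ p / p + lhs2 `^ ps / ps.
Proof. by rewrite lhs1X lhs2X. Qed.

(** With the signed [dx], the sum is the derivative of [V + k G(u)], whose monotonicity replaces the
    integration of the inequality. *)
Lemma young_rhs_ge : 0 <= young_rhs k x dx + k * (gn_deriv x * dx).
Proof.
rewrite -lerBlDr sub0r -mulrN -mulrN rhsE.
apply: (le_trans _ (young_powR p1 lhs1_ge0 lhs2_gt0)).
rewrite lhsM ler_pM2l// ler_wpM2l ?mulr_ge0 ?powR_ge0//.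
by rewrite -normrN ler_norm.
Qed.

(** Equality forces [dx <= 0] as well as equality of the two powers in Young's inequality; the
    latter, solved for [dx], is the differential equation of the extremal profile. *)
Lemma young_rhs_eq : young_rhs k x dx + k * (gn_deriv x * dx) = 0 ->
  dx = - (k^-1 * (x `^ (2 - b) * ell l x `^ p^-1)).
Proof.
move=> /eqP; rewrite addr_eq0 -mulrN -mulrN rhsE => /eqP E.
have g0 : 0 < gn_deriv x by rewrite mulr_gt0 ?powR_gt0.
have dxN : `|dx| = - dx.
  apply/le_anti; rewrite -{2}normrN ler_norm andbT.
  rewrite -(ler_pM2l g0) -(ler_pM2l k0) -lhsM -E.
  exact: young_powR.
have {E} : lhs1 * lhs2 = lhs1 `^ p / p + lhs2 `^ ps / ps.
  by rewrite lhsM dxN E.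
move=> /(young_powR_eq p1 lhs1_ge0 lhs2_gt0).
rewrite lhs2X => /(congr1 (fun y => y `^ p^-1)).
rewrite powRK ?gt_eqF// /lhs1 normrM (ger0_norm (powR_ge0 _ _)) dxN => E.
have {}E : k * (x `^ (b - 2) * - dx) = ell l x `^ p^-1.
  apply: (mulIf (lt0r_neq0 (powR_gt0 p^-1 x0))).
  by rewrite E powRM ?(ltW x0) ?(ltW e0)// mulrC.
have xb : x `^ (2 - b) * x `^ (b - 2) = 1.
  by rewrite -powR_add// -(opprB 2 b) subrr powRr0.
rewrite -E.
transitivity (x `^ (2 - b) * x `^ (b - 2) * dx); first by rewrite xb mul1r.
by field; rewrite gt_eqF.
Qed.

End Young.

End Profile.

(** * The sharp inequality and its equality case *)

Section OneSided.
Context {R : realType}.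
Variables p b l : R.
Hypotheses (p1 : 1 < p) (b0 : 0 < b) (l0 : 0 < l).
Notation ps := (conj_exp p).
Variables Phi G : R -> R.
Hypothesis dPhi : forall s : R, 0 < s < 1 ->
  is_derive s 1 Phi (- (s `^ (b - 2) * ell l s `^ (- p^-1))).
Hypothesis cPhi : forall s : R, 0 < s -> {for s, continuous Phi}.
Hypothesis Phi1 : Phi 1 = 0.
Hypothesis dG : forall s : R, 0 < s < 1 -> is_derive s 1 G (gn_deriv p b l s).
Hypothesis cG : forall s : R, 0 < s -> {for s, continuous G}.
Hypothesis G0 : forall e : R, 0 < e ->
  exists2 d : R, 0 < d < 1 & forall s : R, 0 <= s <= d -> `|G s| < e.

Variables (u du V : R -> R) (k : R).
Hypothesis k0 : 0 < k.
Hypothesis cu : continuous u.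
Hypothesis u_0 : u 0 = 1.
Hypothesis u_lt1 : forall t : R, 0 < t -> u t < 1.
Hypothesis u_ge0 : forall t : R, 0 <= t -> 0 <= u t.
Hypothesis u_small : forall d : R, 0 < d -> exists2 t : R, 0 < t & u t <= d.
Hypothesis u_deriv : forall t : R, 0 < t -> 0 < u t -> is_derive t 1 u (du t).
Hypothesis V_nd : forall s t : R, 0 <= s -> s <= t -> V s <= V t.
Hypothesis V_deriv : forall t : R, 0 <= t -> 0 < u t ->
  is_derive t 1 V (young_rhs p b l k (u t) (du t)).

Let pos (T : R) := forall s : R, 0 <= s <= T -> 0 < u s.

(* Nondecreasing by Young's inequality. *)
Let D t := V t + k * G (u t).
Let dD t := young_rhs p b l k (u t) (du t) + k * (gn_deriv p b l (u t) * du t).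

Let is_derive_D (t : R) : 0 < t -> 0 < u t -> is_derive t 1 D (dD t).
Proof.
move=> t0 ut0; apply: is_deriveD; first exact: V_deriv (ltW t0) ut0.
apply: is_deriveZ; apply: is_derive1_comp; first by apply: dG; rewrite ut0 u_lt1.
exact: u_deriv.
Qed.

Let continuous_D (t : R) : 0 <= t -> 0 < u t -> {for t, continuous D}.
Proof.
move=> t0 ut0; apply: continuousD; first exact: is_derive_continuous (V_deriv t0 ut0).
apply: continuousM; first exact: cst_continuous.
by apply: continuous_comp; [exact: cu|exact: cG].
Qed.

Let D_nd (s T : R) : 0 <= s <= T -> pos T -> D s <= D T.
Proof.
move=> /andP[s0 sT] posT; apply: (@derive_ge0_le _ D dD) => //.
- move=> t /andP[st tT]; have t0 := le_lt_trans s0 st.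
  by apply: is_derive_D => //; apply: posT; rewrite !ltW.
- move=> t /andP[st tT]; have t0 := le_trans s0 st.
  by apply: continuous_D => //; apply: posT; rewrite t0.
- move=> t /andP[st tT]; have t0 := le_lt_trans s0 st.
  by rewrite /dD; apply: young_rhs_ge => //; rewrite u_lt1// posT// !ltW.
Qed.

(** Works alike whether [u] reaches 0 at a finite point or only at infinity: [T] is the first time
    after [S] at which [u] equals a small positive level, so [u] is still positive up to [T] and the
    boundary term is below [e]. *)
Let pos_small (S e : R) : 0 <= S -> pos S -> 0 < e ->
  exists T, [/\ S < T, pos T & `|G (u T)| < e].
Proof.
move=> S0 posS e0; have [d /andP[d0 d1] hd] := G0 e0.
have uS : 0 < u S by apply: posS; rewrite S0 lexx.
pose d' := Num.min d (u S / 2).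
have d'0 : 0 < d' by rewrite lt_min d0 divr_gt0.
have d'S : d' < u S by rewrite gt_min [u S / 2 < _]ltr_pdivrMr// ltr_pMr// ltr1n orbT.
have cs : continuous (fun t => u (S + t)).
  move=> t; apply: (@continuous_comp _ _ _ (fun t => S + t) u); last exact: cu.
  by apply: continuousD; [exact: cst_continuous|exact: cvg_id].
have [m m0 um] : exists2 t : R, 0 < t & u (S + t) <= d'.
  (* [q] lies below the minimum of [u] on [[0, S]], so that a point where [u <= q] necessarily comes
     after [S]. *)
  have [q [q0 qS] hq] : exists2 q, 0 < q /\ q <= d' & forall s : R, 0 <= s <= S -> q < u s.
    have [c c0S hc] : exists2 c, 0 <= c <= S & forall s : R, 0 <= s <= S -> u c <= u s.
      have [|c c0S H] := @EVT_min _ u 0 S S0; first exact: continuous_subspaceT.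
      exists c; first by move: c0S; rewrite in_itv.
      by move=> s s0S; apply: H; rewrite in_itv.
    have uc := posS _ c0S.
    exists (Num.min d' (u c / 2)); first by rewrite lt_min d'0 divr_gt0// ge_min lexx.
    move=> s /hc; apply: lt_le_trans.
    by rewrite gt_min [u c / 2 < _]ltr_pdivrMr// ltr_pMr// ltr1n orbT.
  have [t t0 ut] := u_small q0.
  have St : S < t.
    rewrite ltNge; apply/negP => tS.
    by have := hq t; rewrite (ltW t0) tS => /(_ isT); rewrite ltNge ut.
  by exists (t - S); rewrite ?subr_gt0// addrC subrK (le_trans ut).
have dS0 : d' < u (S + 0) by rewrite addr0.
have [t [t0 _ ut ht]] := first_hit cs dS0 (ltW m0) um.
exists (S + t); split; first by rewrite ltrDl.
  move=> s /andP[s0 sSt]; have [sS|Ss] := leP s S; first by apply: posS; rewrite s0.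
  have [st|ts] := ltP (s - S) t.
    have := ht (s - S); rewrite subr_ge0 (ltW Ss) st [S + _]addrC subrK.
    by move=> /(_ isT); exact: lt_trans.
  have -> : s = S + t by apply/le_anti; rewrite sSt/= -lerBrDl.
  by rewrite ut.
by apply: hd; rewrite ut (ltW d'0) ge_min lexx.
Qed.

Let pos0 : pos 0.
Proof. by move=> s s0; rewrite (_ : s = 0) ?u_0//; apply/le_anti; rewrite andbC. Qed.

Lemma one_sided_bound B : (forall t : R, 0 <= t -> V t <= B) -> k * G 1 <= B - V 0.
Proof.
move=> VB; rewrite lerBrDr; apply/ler_addgt0Pr => e e0.
have ek : 0 < e / k by rewrite divr_gt0.
have [T [T0 posT GT]] := pos_small (lexx 0) pos0 ek.
have := D_nd (_ : 0 <= 0 <= T) posT; rewrite lexx (ltW T0) => /(_ isT).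
rewrite /D u_0 addrC => /le_trans; apply; apply: lerD; first exact/VB/ltW.
by rewrite mulrC -ler_pdivlMr// ltW// (le_lt_trans (ler_norm _)).
Qed.

Section Equality.
Hypothesis VE : forall t : R, 0 <= t -> V t - V 0 <= k * G 1.

(** [D] is nondecreasing, and by [VE] its values far out, where [k G(u)] is negligible, do not
    exceed the initial one. *)
Let D_cst (T : R) : 0 <= T -> pos T -> D T = V 0 + k * G 1.
Proof.
move=> T0 posT; apply/le_anti/andP; split.
  apply/ler_addgt0Pr => e e0.
  have ek : 0 < e / k by rewrite divr_gt0.
  have [S [TS posS GS]] := pos_small T0 posT ek.
  have := D_nd (_ : 0 <= T <= S) posS; rewrite T0 (ltW TS) => /(_ isT).
  move=> /le_trans; apply; apply: lerD.
    by rewrite addrC -lerBlDr VE// (le_trans T0 (ltW TS)).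
  by rewrite mulrC -ler_pdivlMr// ltW// (le_lt_trans (ler_norm _)).
by have := D_nd (_ : 0 <= 0 <= T) posT; rewrite lexx T0 /D u_0 => /(_ isT).
Qed.

Let u_ode (T : R) : 0 < T -> pos T ->
  du T = - (k^-1 * (u T `^ (2 - b) * ell l (u T) `^ p^-1)).
Proof.
move=> T0 posT; have uT : 0 < u T by apply: posT; rewrite lexx ltW.
apply: (@young_rhs_eq _ p b l p1 k) => //; first by rewrite uT u_lt1.
(* Positivity beyond [T] gives a two-sided neighbourhood of [T] on which [D] is constant. *)
have [S [TS posS _]] := pos_small (ltW T0) posT ltr01.
have dDT := is_derive_D T0 uT.
have dc : is_derive T 1 D 0.
  have := is_derive_cst (V 0 + k * G 1) T 1.
  apply: near_eq_is_derive; near=> t.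
  have t0 : 0 < t by near: t; exact: lt_nbhsr.
  have tS : t < S by near: t; exact: lt_nbhsl.
  rewrite D_cst ?ltW// => s /andP[s0 st]; apply: posS.
  by rewrite s0 (le_trans st)// ltW.
by have := @derive_val _ _ _ _ _ _ _ dDT; rewrite (@derive_val _ _ _ _ _ _ _ dc).
Unshelve. all: by end_near. Qed.

(** Separation of variables: [Phi'] is minus the reciprocal of [u^(2-b) ell^(1/p)], so [Phi(u)] has
    derivative [1 / k]. *)
Let u_Phi (T : R) : 0 <= T -> pos T -> Phi (u T) = T / k.
Proof.
move=> T0 posT; apply/eqP; rewrite -subr_eq0; apply/eqP.
have -> : 0 = Phi (u 0) - 0 / k by rewrite u_0 Phi1 mul0r subrr.
have posTt t : t <= T -> pos t.
  by move=> tT s /andP[s0 st]; apply: posT; rewrite s0 (le_trans st).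
apply/esym; apply: (@derive0_eq _ (fun t => Phi (u t) - t / k) (fun t =>
  (- (u t `^ (b - 2) * ell l (u t) `^ (- p^-1))) * du t - k^-1)) => //.
- move=> t /andP[t0 tT]; have ut : 0 < u t by apply: posT; rewrite !ltW.
  apply: is_deriveB.
    by apply: is_derive1_comp; [apply: dPhi; rewrite ut u_lt1|exact: u_deriv].
  by apply: is_derive_eq; rewrite /GRing.scale/= mulr0 add0r mulr1.
- move=> t /andP[t0 tT]; have ut : 0 < u t by apply: posT; rewrite t0.
  apply: continuousB.
    by apply: continuous_comp; [exact: cu|exact: cPhi].
  by apply: continuousM; [exact: cvg_id|exact: cst_continuous].
- move=> t /andP[t0 tT]; have ut : 0 < u t by apply: posT; rewrite !ltW.
  rewrite u_ode//; last exact/posTt/ltW.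
  have e0 := ell_gt0 l ut (u_lt1 t0).
  have E1 : u t `^ (b - 2) * u t `^ (2 - b) = 1.
    by rewrite -powR_add// -(opprB 2 b) addrC subrr powRr0.
  have E2 : ell l (u t) `^ (- p^-1) * ell l (u t) `^ p^-1 = 1.
    by rewrite -powR_add// addrC subrr powRr0.
  transitivity (k^-1 * (u t `^ (b - 2) * u t `^ (2 - b)) *
    (ell l (u t) `^ (- p^-1) * ell l (u t) `^ p^-1) - k^-1); first by ring.
  by rewrite E1 E2 !mulr1 subrr.
Qed.

(** When [u] first vanishes, [V] has exhausted its whole increase. It stays constant afterwards,
    whereas it would increase wherever [0 < u < 1]; so the density cannot reappear after a zero. *)
Lemma one_sided_rigidity (t : R) : 0 <= t ->
  (0 < u t <= 1 /\ Phi (u t) = t / k) \/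
  (u t = 0 /\ forall s : R, 0 < s <= 1 -> Phi s < t / k).
Proof.
move=> t0; have [post|] := pselect (pos t).
  left; split; last exact: u_Phi.
  rewrite post ?t0 ?lexx//=.
  by move: t0; rewrite le_eqVlt => /predU1P[<-|/u_lt1/ltW//]; rewrite u_0.
move=> /existsNP[s /not_implyP[/andP[s0 st] us]].
have {}us : u s <= 0 by rewrite leNgt; apply/negP.
have u01 : 0 < u 0 by rewrite u_0.
have [T [T0 Ts uT uposT]] := first_hit cu u01 s0 us.
have posT S : S < T -> pos S.
  by move=> ST x /andP[x0 xS]; apply: uposT; rewrite x0 (le_lt_trans xS).
have VT : V 0 + k * G 1 <= V T.
  apply/ler_addgt0Pr => e e0.
  have ek : 0 < e / k by rewrite divr_gt0.
  have [S [S0 posS GS]] := pos_small (lexx 0) pos0 ek.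
  have ST : S < T.
    rewrite ltNge; apply/negP => TS.
    by have := posS T; rewrite (ltW T0) TS uT ltxx => /(_ isT).
  rewrite -(D_cst (ltW S0) posS); apply: lerD; first by apply: V_nd; rewrite ltW.
  by rewrite mulrC -ler_pdivlMr// ltW// (le_lt_trans (ler_norm _)).
have Vcst x : T <= x -> V x = V 0 + k * G 1.
  move=> Tx; apply/le_anti/andP; split.
    by rewrite addrC -lerBlDr VE// (le_trans (ltW T0)).
  by apply: le_trans VT _; apply: V_nd => //; exact: ltW.
have u_out x : T < x -> u x = 0.
  move=> Tx; have x0 := lt_trans T0 Tx.
  apply/eqP; rewrite eq_sym eq_le u_ge0 ?(ltW x0)//= leNgt; apply/negP => ux.
  have dV := V_deriv (ltW x0) ux.
  have dc : is_derive x 1 V 0.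
    have := is_derive_cst (V 0 + k * G 1) x 1.
    apply: near_eq_is_derive; near=> y; rewrite (Vcst y)//.
    by apply: ltW; near: y; exact: lt_nbhsr.
  have := @derive_val _ _ _ _ _ _ _ dV; rewrite (@derive_val _ _ _ _ _ _ _ dc).
  move=> /esym/eqP; apply/negP; rewrite gt_eqF// /young_rhs ltr_wpDl//.
    by rewrite divr_ge0 ?(ltW (p_gt0 p1))// !mulr_ge0 ?powR_ge0// ltW.
  by rewrite divr_gt0 ?conj_exp_gt0// mulr_gt0// ell_gt0// u_lt1.
right; split.
  have Tt : T <= t := le_trans Ts st.
  by move: Tt; rewrite le_eqVlt => /predU1P[<-//|]; exact: u_out.
(* Every level in []0, 1]] is taken strictly before the first zero [T], where [Phi(u)] is below
   [T / k]. *)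
move=> x /andP[x0 x1].
have [y /andP[y0 yT] uy] : exists2 y, 0 <= y <= T & u y = x.
  apply: intermediate_value; rewrite ?(ltW T0)//; first by move=> z _; exact: cu.
  by rewrite uT u_0 x1 (ltW x0) orbT.
have {}yT : y < T.
  rewrite lt_neqAle yT andbT; apply/eqP => yE.
  by move: x0; rewrite -uy yE uT ltxx.
rewrite -uy u_Phi//; last exact: posT.
by rewrite ltr_pM2r ?invr_gt0// (lt_le_trans yT)// (le_trans Ts).
Unshelve. all: by end_near. Qed.

Hypothesis bl : 1 - b * ps < l.
Variable M : R -> R.
Hypothesis M_deriv : forall t : R, 0 <= t -> is_derive t 1 M (u t).

Let J s := ps * (zeta_min p b l * G s - gn_weight p b l s).

Let dJ (s : R) : 0 < s < 1 -> is_derive s 1 J (s `^ (b - 1) * ell l s `^ (- p^-1)).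
Proof.
by move=> s01; apply: is_derive_mass_primitive => //; exact: dG.
Qed.

(** By the differential equation [M + k J(u)] is constant, with [J 1 = ps * zeta_min * G 1] because
    the weight [Q] vanishes at 1. At the far end the term [- Q] only helps, so the smallness of [G]
    suffices. *)
Lemma one_sided_mass B : (forall t : R, 0 <= t -> M t <= B) ->
  k * (ps * zeta_min p b l * G 1) <= B - M 0.
Proof.
move=> MB; rewrite lerBrDr; apply/ler_addgt0Pr => e e0.
have z0 := zeta_min_gt0 p1 bl; have ps0 := conj_exp_gt0 p1.
have kz : 0 < k * (ps * zeta_min p b l) by rewrite mulr_gt0// mulr_gt0.
have ek : 0 < e / (k * (ps * zeta_min p b l)) by rewrite divr_gt0.
have [T [T0 posT GT]] := pos_small (lexx 0) pos0 ek.
have posTt t : t <= T -> pos t.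
  by move=> tT s /andP[s0 st]; apply: posT; rewrite s0 (le_trans st).
have : M 0 + k * J (u 0) = M T + k * J (u T).
  apply: (@derive0_eq _ (fun t => M t + k * J (u t)) (fun t => u t + k *
    (u t `^ (b - 1) * ell l (u t) `^ (- p^-1) * du t))).
  - exact: ltW.
  - move=> t /andP[t0 tT]; have ut : 0 < u t by apply: posT; rewrite !ltW.
    apply: is_deriveD; first exact/M_deriv/ltW.
    apply: is_deriveZ; apply: is_derive1_comp; first by apply: dJ; rewrite ut u_lt1.
    exact: u_deriv.
  - move=> t /andP[t0 tT]; have ut : 0 < u t by apply: posT; rewrite t0.
    apply: continuousD; first exact: is_derive_continuous (M_deriv t0).
    apply: continuousM; first exact: cst_continuous.
    apply: continuous_comp; first exact: cu.
    apply: continuousM; first exact: cst_continuous.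
    apply: continuousB; last exact: continuous_gn_weight.
    by apply: continuousM; [exact: cst_continuous|exact: cG].
  - move=> t /andP[t0 tT]; have ut : 0 < u t by apply: posT; rewrite !ltW.
    rewrite u_ode//; last exact/posTt/ltW.
    have ut0 := ell_gt0 l ut (u_lt1 t0).
    have E1 : u t `^ (b - 1) * u t `^ (2 - b) = u t.
      rewrite -powR_add//.
      have -> : (b - 1) + (2 - b) = 1 by ring.
      by rewrite powRr1// ltW.
    have E2 : ell l (u t) `^ (- p^-1) * ell l (u t) `^ p^-1 = 1.
      by rewrite -powR_add// addrC subrr powRr0.
    transitivity (u t - k * k^-1 * (u t `^ (b - 1) * u t `^ (2 - b)) *
      (ell l (u t) `^ (- p^-1) * ell l (u t) `^ p^-1)); first by ring.
    by rewrite E1 E2 mulfV ?gt_eqF// mulr1 mul1r subrr.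
rewrite u_0 /J gn_weight1// subr0 mulrA => ME.
have MT := MB _ (ltW T0).
have GE : k * (ps * zeta_min p b l) * G (u T) <= e.
  by rewrite mulrC -ler_pdivlMr// ltW// (le_lt_trans (ler_norm _)).
have Q0 : 0 <= k * (ps * gn_weight p b l (u T)).
  by apply: mulr_ge0; [exact: ltW|apply: mulr_ge0; [exact: ltW|exact: gn_weight_ge0]].
lra.
Qed.

End Equality.

End OneSided.

(** * Decay at infinity and existence of a maximum *)

Section Decay.
Context {R : realType}.
Variables (b B BM : R) (f df V v M : R -> R).
Hypothesis b0 : 0 < b.
Hypothesis cf : continuous f.
Hypothesis f0 : forall t : R, 0 <= f t.
Hypothesis f_deriv : forall t : R, 0 < f t -> is_derive t 1 f (df t).
Hypothesis V_nd : forall s t : R, s <= t -> V s <= V t.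
Hypothesis V_le : forall t : R, V t <= B.
Hypothesis V_deriv : forall t : R, 0 < f t -> is_derive t 1 V (v t).
Hypothesis f_le_v : forall t : R, 0 < f t -> `|f t `^ (b - 1) * df t| <= v t.
Hypothesis M_deriv : forall t : R, is_derive t 1 M (f t).
Hypothesis M_le : forall t : R, M t <= BM.

Let variation (s t : R) : s <= t -> (forall x, s <= x <= t -> 0 < f x) ->
  f s `^ b - f t `^ b <= b * (V t - V s).
Proof.
move=> st fst.
suff : b * V s + f s `^ b <= b * V t + f t `^ b by lra.
apply: (@derive_ge0_le _ (fun x => b * V x + f x `^ b)
  (fun x => b * v x + (b * f x `^ (b - 1)) * df x)) => //.
- move=> x /andP[sx xt]; have fx : 0 < f x by rewrite fst// !ltW.
  apply: is_deriveD; first by apply: is_deriveZ; exact: V_deriv.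
  exact: (is_derive1_comp (is_derive1_powR b fx) (f_deriv fx)).
- move=> x sxt; have fx := fst _ sxt; apply: continuousD.
    apply: continuousM; first exact: cst_continuous.
    exact: is_derive_continuous (V_deriv fx).
  exact: is_derive_continuous (is_derive1_comp (is_derive1_powR b fx) (f_deriv fx)).
- move=> x /andP[sx xt]; have fx : 0 < f x by rewrite fst// !ltW.
  rewrite -mulrA -mulrDr mulr_ge0// ?(ltW b0)//.
  by rewrite -lerBlDr sub0r (le_trans _ (f_le_v fx))// -normrN ler_norm.
Qed.

(* [f^b] has variation at most [b] times that of [V], so it converges at infinity,
   and the limit is 0 because [f] has a bounded primitive. *)
Lemma decay (e : R) : 0 < e -> exists T : R, forall t, T <= t -> f t < e.
Proof.
move=> e0.
have hV : has_sup (range V).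
  by split; [exists (V 0), 0|exists B => _ [t _ <-]].
(* Beyond [T] the variation left to [f^b] is below [b * e1 = e^b / 4], whereas a fall from [e] to
   [d] costs [e^b - d^b = e^b / 2]. *)
pose e1 := e `^ b / (4 * b).
have e10 : 0 < e1 by rewrite divr_gt0 ?powR_gt0// mulr_gt0.
have [_ [T _ <-] VT] := sup_adherent e10 hV.
exists T => t Tt; rewrite ltNge; apply/negP => eft.
pose d := (e `^ b / 2) `^ b^-1.
have db : d `^ b = e `^ b / 2.
  by rewrite /d -powRrM mulVf ?gt_eqF// powRr1// divr_ge0 ?powR_ge0.
have d0 : 0 < d by rewrite powR_gt0// divr_gt0// powR_gt0.
have eb0 : 0 < e `^ b by rewrite powR_gt0.
have de : d < e.
  rewrite ltNge; apply/negP => ed.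
  have : e `^ b <= d `^ b by rewrite ge0_ler_powR ?nnegrE ?(ltW b0) ?(ltW e0) ?(ltW d0).
  by rewrite db; lra.
have dft : d < f t by exact: lt_le_trans eft.
have [s s0 fs] : exists2 s, 0 <= s & f (t + s) <= d.
  (* If [f > d] all along [[t, t + s]], then [M] increases by at least [d * s = BM - M t + 1],
     beyond its bound [BM]. *)
  pose s := (BM - M t + 1) / d.
  have s0 : 0 < s by rewrite divr_gt0// ltr_wpDl// subr_ge0.
  apply: contrapT => /forall2NP H.
  have dfx x : t <= x -> d < f x.
    move=> tx; rewrite ltNge; apply/negP => fx.
    by have [|] := H (x - t); rewrite ?subr_ge0// addrC subrK fx.
  have : M t - d * t <= M (t + s) - d * (t + s).
    apply: (@derive_ge0_le _ (fun x => M x - d * x) (fun x => f x - d)).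
    - by rewrite lerDl ltW.
    - move=> x _; have dd : is_derive x 1 (fun x : R => d * x) d.
        by apply: is_derive_eq; rewrite /GRing.scale/= mulr1.
      exact: (is_deriveB (M_deriv x) dd).
    - move=> x _; apply: continuousB; first exact: is_derive_continuous (M_deriv x).
      by apply: continuousM; [exact: cst_continuous|exact: cvg_id].
    - by move=> x /andP[tx _]; rewrite subr_ge0 ltW// dfx// ltW.
  have -> : d * (t + s) = d * t + (BM - M t + 1).
    by rewrite mulrDr /s mulrCA mulfV ?mulr1// gt_eqF.
  by have := M_le (t + s); lra.
have cs : continuous (fun s => f (t + s)).
  move=> x; apply: (@continuous_comp _ _ _ (fun s => t + s) f); last exact: cf.
  by apply: continuousD; [exact: cst_continuous|exact: cvg_id].
have ft0 : d < f (t + 0) by rewrite addr0.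
have [y [y0 _ fy hy]] := first_hit cs ft0 s0 fs.
have := @variation t (t + y); rewrite lerDl (ltW y0) fy db => /(_ isT).
apply/not_implyP; split.
  move=> x /andP[tx xty]; have [xy|yx] := ltP (x - t) y.
    have := hy (x - t); rewrite subr_ge0 tx xy addrC subrK => /(_ isT).
    exact: lt_trans.
  have -> : x = t + y by apply/le_anti; rewrite xty/= -lerBrDl.
  by rewrite fy.
apply/negP; rewrite -ltNge.
have Vy : V (t + y) - V t < e1.
  have : V (t + y) <= sup (range V) by apply: ub_le_sup; [case: hV|exists (t + y)].
  by have := V_nd Tt; move: VT; lra.
have bV : b * (V (t + y) - V t) < e `^ b / 4.
  have -> : e `^ b / 4 = b * e1 by rewrite /e1; field; rewrite gt_eqF.
  by rewrite ltr_pM2l.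
have : e `^ b <= f t `^ b by rewrite ge0_ler_powR ?nnegrE ?(ltW b0) ?(ltW e0).
by lra.
Qed.

End Decay.

Section Extremum.
Context {R : realType}.

(** [first_hit] for the reversed function [m - f (T - t)], which starts positive because no maximum
    lies beyond [T]. *)
Lemma last_max (f : R -> R) (m x0 T : R) : continuous f -> f x0 = m ->
  (forall t, T <= t -> f t < m) ->
  exists x2, [/\ x0 <= x2, f x2 = m & forall x, x2 < x -> f x < m].
Proof.
move=> cf fx0 fT.
pose g t := m - f (T - t).
have cg : continuous g.
  move=> x; apply: continuousB; first exact: cst_continuous.
  apply: (@continuous_comp _ _ _ (fun s => T - s) f); last exact: cf.
  by apply: continuousB; [exact: cst_continuous|exact: cvg_id].
have TK x : T - (T - x) = x by ring.
have x0T : x0 < T by rewrite ltNge; apply/negP => /fT; rewrite fx0 ltxx.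
have g0 : 0 < g 0 by rewrite /g subr0 subr_gt0 fT.
have Tx0 : 0 <= T - x0 by rewrite subr_ge0 ltW.
have gx0 : g (T - x0) <= 0 by rewrite /g TK fx0 subrr.
have [t [t0 tx /eqP gt ht]] := first_hit cg g0 Tx0 gx0.
exists (T - t); split; first by rewrite lerBrDl -lerBrDr.
  by move: gt; rewrite subr_eq0 => /eqP.
move=> x xt; have [xT|/fT//] := ltP x T.
have := ht (T - x); rewrite /g TK subr_gt0; apply.
by rewrite subr_ge0 (ltW xT) ltrBlDl -ltrBlDr.
Qed.

(** The outermost maximum points are taken, since the half-line analysis needs [u < 1], hence
    [ell > 0], strictly outside them. *)
Lemma exists_max (f : R -> R) : continuous f -> (exists x, 0 < f x) ->
  (forall e, 0 < e -> exists T : R, forall t, T <= t -> f t < e) ->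
  (forall e, 0 < e -> exists T : R, forall t, T <= t -> f (- t) < e) ->
  exists m x1 x2 : R, [/\ 0 < m, x1 <= x2, forall x, f x <= m, f x1 = m /\ f x2 = m &
    (forall x, x < x1 -> f x < m) /\ (forall x, x2 < x -> f x < m)].
Proof.
move=> cf [x0 fx0] fy fNy.
have [T1 hT1] := fy _ fx0; have [T2 hT2] := fNy _ fx0.
pose T := Num.max T1 T2.
have hT x : T <= `|x| -> f x < f x0.
  rewrite /T ge_max => /andP[xT1 xT2]; have [x_ge0|x_lt0] := leP 0 x.
    by apply: hT1; rewrite -(ger0_norm x_ge0).
  by rewrite -[x]opprK; apply: hT2; rewrite -(ltr0_norm x_lt0).
have xT x : f x0 <= f x -> - T <= x <= T.
  by move=> fx; rewrite -ler_norml leNgt; apply/negP => /ltW/hT; rewrite ltNge fx.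
have TT : - T <= T by have /andP[] := xT _ (lexx (f x0)); exact: le_trans.
have [|c cT hc] := @EVT_max _ f (- T) T TT; first exact: continuous_subspaceT.
have fx0c : f x0 <= f c by apply: hc; rewrite in_itv/= xT.
have fc x : f x <= f c.
  have [/xT xTT|/ltW/le_trans->//] := leP (f x0) (f x).
  by apply: hc; rewrite in_itv.
have fc0 : 0 < f c by exact: lt_le_trans fx0 fx0c.
have [S1 hS1] := fy _ fc0; have [S2 hS2] := fNy _ fc0.
have [x2 [cx2 fx2 h2]] := last_max cf (erefl (f c)) hS1.
have cfN : continuous (fun x => f (- x)).
  by move=> x; apply: continuous_comp; [exact: opp_continuous|exact: cf].
have fNc : f (- - c) = f c by rewrite opprK.
have [x1 [cx1 fx1 h1]] := last_max cfN fNc hS2.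
exists (f c), (- x1), x2; split => //.
  by rewrite (le_trans _ cx2)// lerNl.
split=> //.
by move=> x xx1; rewrite -[x]opprK; apply: h1; rewrite ltrNr.
Qed.

End Extremum.

Section Optimize.
Context {R : realType}.
Variables (p A L g : R).
Hypotheses (p1 : 1 < p) (A0 : 0 <= A) (L0 : 0 <= L) (g0 : 0 < g).
Notation ps := (conj_exp p).
Hypothesis H : forall k : R, 0 < k -> k * g <= k `^ p * A / p + L / ps.

(** [A > 0] by taking [k] large and [L > 0] by taking [k] small, as [p > 1]; the best [k] balances
    the two terms, [k^p A = L]. *)
Lemma young_optimal : [/\ 0 < A, 0 < L, g <= A `^ p^-1 * L `^ ps^-1 &
  exists k, [/\ 0 < k, k `^ p * A = L & k * (A `^ p^-1 * L `^ ps^-1) = L]].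
Proof.
have p0 := p_gt0 p1; have ps0 := conj_exp_gt0 p1.
have Agt0 : 0 < A.
  rewrite lt_neqAle A0 andbT; apply/eqP => A_0.
  have k0 : 0 < (L / ps + 1) / g by rewrite divr_gt0// ltr_wpDl// divr_ge0// ltW.
  have := H k0; rewrite -A_0 mulr0 mul0r add0r divfK ?gt_eqF//.
  by rewrite gerDl leNgt ltr01.
have Lgt0 : 0 < L.
  rewrite lt_neqAle L0 andbT; apply/eqP => L_0.
  (* This [k] makes [k^p A / p] equal to half of [k g]. *)
  pose k := (g * p / (2 * A)) `^ (p - 1)^-1.
  have k0 : 0 < k by rewrite powR_gt0// divr_gt0// ?mulr_gt0.
  have := H k0; rewrite -L_0 mul0r addr0.
  have -> : k `^ p = k * (g * p / (2 * A)).
    have -> : p = 1 + (p - 1) by ring.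
    rewrite powR_add// powRr1 ?ltW//; congr (_ * _).
    rewrite /k -powRrM mulVf ?subr_eq0 ?gt_eqF// powRr1; first by congr (_ * _ / _); ring.
    by rewrite divr_ge0 ?mulr_ge0// ltW.
  have -> : k * (g * p / (2 * A)) * A / p = k * g / 2 by field; rewrite !gt_eqF.
  have : 0 < k * g by rewrite mulr_gt0.
  by lra.
pose k := (L / A) `^ p^-1.
have k0 : 0 < k by rewrite powR_gt0// divr_gt0.
have kp : k `^ p * A = L.
  by rewrite /k -powRrM mulVf ?gt_eqF// powRr1 ?divfK ?gt_eqF// divr_ge0.
have kA : k * A `^ p^-1 = L `^ p^-1.
  by rewrite /k -powRM ?divr_ge0// divfK// gt_eqF.
have LE : L `^ p^-1 * L `^ ps^-1 = L.
  rewrite -powR_add// conj_expV//.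
  have -> : p^-1 + (1 - p^-1) = 1 by ring.
  by rewrite powRr1.
split => //; last by exists k; split => //; rewrite mulrA kA.
have := H k0; rewrite kp.
have -> : L / p + L / ps = L by rewrite conj_expV//; ring.
rewrite -ler_pdivlMl//; move=> /le_trans; apply.
by rewrite -[X in _ * X]LE -kA mulrA mulKf// gt_eqF.
Qed.

End Optimize.

(** * Fisher and Rényi integrals of a density *)

Section Functionals.
Context {R : realType}.
Variables p b l : R.
Hypotheses (p1 : 1 < p) (b0 : 0 < b) (l0 : 0 < l).
Implicit Types (rho : R -> R).
Local Notation mu := (@lebesgue_measure R).

Lemma measurable_supp rho : continuous rho ->
  measurable (supp rho : set (measurableTypeR R)).
Proof.
move=> crho; apply: open_measurable.
have -> : supp rho = rho @^-1` [set y | 0 < y] by [].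
by apply: open_comp; [move=> x _; exact: crho|exact: open_gt].
Qed.

Lemma fisher_integrandE rho x d : 0 < rho x -> is_derive x 1 rho d ->
  fisher_integrand p b rho x = `|rho x `^ (b - 2) * d| `^ p * rho x.
Proof.
move=> rx dr; rewrite /fisher_integrand.
have dl : is_derive x 1 (fun y => ln (rho y)) ((rho x)^-1 * d).
  exact: (is_derive1_comp (is_derive1_ln rx) dr).
rewrite derive1E (@derive_val _ _ _ _ _ _ _ dl) mulrA; congr (`|_ * _| `^ _ * _).
rewrite -powR_inv1 ?ltW// -powR_add//; congr (_ `^ _); ring.
Qed.

Lemma fisher_integrand_ge0 rho x : 0 <= rho x -> 0 <= fisher_integrand p b rho x.
Proof. by move=> rx; rewrite mulr_ge0 ?powR_ge0. Qed.

(** The factor [rho x] kills the integrand off the support, so that Fisher integrals can be taken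
    over the whole line. *)
Lemma fisher_integrand_restrict rho : (forall x, 0 <= rho x) ->
  (fisher_integrand p b rho) \_ (supp rho) = fisher_integrand p b rho.
Proof.
move=> r0; apply/funext => x; rewrite patchE; case: ifPn => //.
rewrite notin_setE /supp/= => /negP; rewrite -leNgt => rx.
have -> // : fisher_integrand p b rho x = 0.
by rewrite /fisher_integrand (_ : rho x = 0) ?mulr0//; apply/le_anti; rewrite rx r0.
Qed.

Lemma fisher_existsE rho : (forall x, 0 <= rho x) -> continuous rho ->
  fisher_exists p b rho <->
  mu.-integrable setT (EFin \o fisher_integrand p b rho).
Proof.
move=> r0 crho; rewrite /fisher_exists.
rewrite (integrable_mkcond _ (measurable_supp crho)) restrict_EFin.
by rewrite fisher_integrand_restrict.
Qed.

Lemma complexityE rho : (forall x, 0 <= rho x) ->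
  complexity p b l rho =
  ((\int[mu]_x fisher_integrand p b rho x) `^ p^-1 *
   expR (b * renyi_entropy l rho)) ^+ 2.
Proof.
move=> r0.
have I0 : 0 <= \int[mu]_x fisher_integrand p b rho x.
  by apply: Rintegral_ge0 => x _; exact: fisher_integrand_ge0.
rewrite /complexity /fisher Rintegral_mkcond fisher_integrand_restrict//.
rewrite /renyi_power powRM ?powR_ge0 ?expR_ge0// -powRrM.
have -> : 2 / (p * b) * b = p^-1 * 2%:R.
  by field; rewrite (gt_eqF (p_gt0 p1)) gt_eqF.
rewrite powRrM powR_mulrn ?powR_ge0// exprMn; congr (_ * _).
by rewrite powRE ?expR_gt0// expRK expr2 -expRD; congr expR; ring.
Qed.

(** Coefficients of [u ell(u)], for [u = rho / m], as a combination of [rho] and the Rényi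
    integrand. The second one is nonzero for [m > 0], so integrability passes both ways. *)
Definition ell_coef1 m := if l == 1 then ln m / m else (m * (l - 1))^-1.
Definition ell_coef2 m := if l == 1 then - m^-1 else - (m `^ l * (l - 1))^-1.

Lemma ell_renyi rho m x : 0 < m -> 0 <= rho x -> rho x <= m ->
  rho x / m * ell l (rho x / m) =
  ell_coef1 m * rho x + ell_coef2 m * renyi_integrand l rho x.
Proof.
move=> m0 rx rxm; rewrite /ell_coef1 /ell_coef2 /renyi_integrand.
have rm : 0 <= rho x / m <= 1.
  by rewrite divr_ge0 ?(ltW m0)//= ler_pdivrMr// mul1r.
have [l1|l1] := eqVneq l 1.
  rewrite l1 mul_ell1//; move: rx; rewrite le_eqVlt => /predU1P[<-|rx].
    by rewrite !mul0r !mulr0 oppr0 addr0.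
  by rewrite ln_div ?posrE//; ring.
rewrite mul_ell// powRM ?invr_ge0 ?(ltW m0)//.
have -> : m^-1 `^ l = (m `^ l)^-1.
  by rewrite -powRN -mulN1r powRrM powR_inv1// ltW.
by field; rewrite ?(gt_eqF m0) ?(gt_eqF (powR_gt0 l m0)) ?subr_eq0 ?l1.
Qed.

Lemma ell_coef2_neq0 m : 0 < m -> ell_coef2 m != 0.
Proof.
move=> m0; rewrite /ell_coef2; have [_|l1] := eqVneq l 1.
  by rewrite oppr_eq0 invr_eq0 gt_eqF.
by rewrite oppr_eq0 invr_eq0 mulf_neq0// ?subr_eq0// gt_eqF// powR_gt0.
Qed.

Section Entropy.
Variables (rho : R -> R) (m : R).
Hypothesis r0 : forall x : R, 0 <= rho x.
Hypothesis crho : continuous rho.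
Hypothesis mass : (\int[mu]_x (rho x)%:E = 1)%E.
Hypothesis m0 : 0 < m.
Hypothesis rho_le : forall x : R, rho x <= m.
Let w x := rho x / m * ell l (rho x / m).

Lemma density_integrable : mu.-integrable setT (EFin \o rho).
Proof.
apply/integrableP; split.
  by apply/measurable_EFinP; exact: continuous_measurable_fun.
under eq_integral do rewrite /= ger0_norm//.
by rewrite mass ltry.
Qed.

Lemma density_mass : \int[mu]_x rho x = 1.
Proof. by rewrite /Rintegral mass. Qed.

Lemma density_pos : exists x, 0 < rho x.
Proof.
apply: contrapT => H; have r_0 x : rho x = 0.
  by apply/eqP; rewrite eq_le r0 andbT leNgt; apply/negP => rx; apply: H; exists x.
have := density_mass; rewrite (_ : rho = cst 0); last exact/funext.
by rewrite /Rintegral integral0 => /eqP; rewrite eq_sym oner_eq0.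
Qed.

Let wE : w = fun x => ell_coef1 m * rho x + ell_coef2 m * renyi_integrand l rho x.
Proof. by apply/funext => x; exact: ell_renyi. Qed.

Lemma renyi_existsP :
  renyi_exists l rho <-> mu.-integrable setT (EFin \o w).
Proof.
split=> H.
  have i1 := integrableZl (measurableT) (ell_coef1 m) density_integrable.
  have i2 := integrableZl (measurableT) (ell_coef2 m) H.
  have := integrableD measurableT i1 i2.
  by apply: eq_integrable => // x _; rewrite /= wE.
have i1 := integrableZl (measurableT) (- ell_coef1 m / ell_coef2 m) density_integrable.
have i2 := integrableZl (measurableT) (ell_coef2 m)^-1 H.
have := integrableD measurableT i1 i2.
apply: eq_integrable => // x _; rewrite /= wE -!EFinM -EFinD; congr EFin.
by field; rewrite ell_coef2_neq0.
Qed.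

Hypothesis Hr : renyi_exists l rho.

Lemma ell_integralE : \int[mu]_x w x =
  ell_coef1 m + ell_coef2 m * \int[mu]_x renyi_integrand l rho x.
Proof.
have i1 := integrableZl (measurableT) (ell_coef1 m) density_integrable.
have i2 := integrableZl (measurableT) (ell_coef2 m) Hr.
rewrite wE RintegralD// !RintegralZl//; last exact: density_integrable.
by rewrite density_mass mulr1.
Qed.

(** Otherwise the cumulative function of [rho^l] would be identically 0, against its positive
    derivative at a point of the support. *)
Lemma renyi_integral_gt0 : l != 1 -> 0 < \int[mu]_x renyi_integrand l rho x.
Proof.
move=> l1; have rE : renyi_integrand l rho = fun x => rho x `^ l.
  by apply/funext => x; rewrite /renyi_integrand (negbTE l1).
have rge0 x : 0 <= renyi_integrand l rho x by rewrite rE powR_ge0.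
rewrite lt_neqAle eq_sym Rintegral_ge0// andbT; apply/eqP => E0.
have [x rx] := density_pos.
have cr : continuous (renyi_integrand l rho).
  rewrite rE => y; have -> : (fun x => rho x `^ l) = (fun t => Num.max 0 t `^ l) \o rho.
    by apply/funext => t /=; rewrite (max_idPr (r0 t)).
  by apply: continuous_comp; [exact: crho|exact: continuous_powR_ge0].
have dc := is_derive_lower_integral Hr (cr x).
have d0 : is_derive x 1 (lower_integral (renyi_integrand l rho)) 0.
  have -> : lower_integral (renyi_integrand l rho) = cst 0.
    apply/funext => y; apply/le_anti.
    by rewrite lower_integral_ge0// -[leRHS]E0 lower_integral_le_total.
  exact: is_derive_cst.
have := @derive_val _ _ _ _ _ _ _ dc; rewrite (@derive_val _ _ _ _ _ _ _ d0).
by rewrite rE => /esym/eqP; rewrite gt_eqF// powR_gt0.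
Qed.

(** [r] is a generalized mean of [rho / m]: the integral of [rho ell(rho / m)] is the average of the
    Tsallis logarithm under the density [rho], and [r] has this logarithm. Its positivity places [r]
    below 1. *)
Lemma renyi_mean : 0 < \int[mu]_x w x ->
  let r := expR (- renyi_entropy l rho) / m in
  0 < r < 1 /\ ell l r = m * \int[mu]_x w x.
Proof.
move=> w0 r; have r_gt0 : 0 < r by rewrite divr_gt0// expR_gt0.
suff rE : tlog l r = m * \int[mu]_x w x.
  have r_pos : 0 < tlog l r by rewrite rE mulr_gt0.
  by have [r1 ->] := ell_tlog r_gt0 r_pos; rewrite r_gt0.
rewrite ell_integralE /tlog /r /ell_coef1 /ell_coef2 /renyi_entropy.
have [_|l1] := eqVneq l 1.
  rewrite ln_div ?posrE ?expR_gt0// expRK.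
  by field; rewrite gt_eqF.
have I0 := renyi_integral_gt0 l1; set I := \int[mu]_x _ in I0 *.
have -> : expR (- ((1 - l)^-1 * ln I)) = I `^ (l - 1)^-1.
  rewrite powRE//; congr expR; rewrite -mulNr; congr (_ * _).
  by rewrite -invrN opprB.
rewrite powRM ?powR_ge0 ?invr_ge0 ?(ltW m0)// -powRrM mulVf ?subr_eq0// powRr1 ?ltW//.
have -> : m^-1 `^ (l - 1) = m / m `^ l.
  rewrite -{1}powR_inv1 ?ltW// -powRrM mulN1r opprB powR_add// powRr1 ?ltW//.
  by rewrite powRN.
by field; rewrite ?(gt_eqF m0) ?(gt_eqF (powR_gt0 l m0)) ?subr_eq0 ?l1.
Qed.

End Entropy.

End Functionals.

(** * From a density to its two half-lines *)

Section Density.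
Context {R : realType}.
Variables p b l : R.
Hypotheses (p1 : 1 < p) (b0 : 0 < b) (l0 : 0 < l).
Notation ps := (conj_exp p).
Hypothesis bl : 1 - b * ps < l.
Local Notation mu := (@lebesgue_measure R).

Variable rho : R -> R.
Hypothesis rho_ge0 : forall x : R, 0 <= rho x.
Hypothesis crho : continuous rho.
Hypothesis drho : forall x : R, supp rho x ->
  derivable rho x 1 /\ {for x, continuous (derive1 rho)}.
Hypothesis mass : (\int[mu]_x (rho x)%:E = 1)%E.
Hypothesis fisher_fin : fisher_exists p b rho.

Let F := fisher_integrand p b rho.
Let drho1 := derive1 rho.

Let is_derive_rho (x : R) : 0 < rho x -> is_derive x 1 rho (drho1 x).
Proof. by move=> /drho[d _]; split; [exact: d|rewrite /drho1 derive1E]. Qed.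

Let FE (x : R) : 0 < rho x -> F x = `|rho x `^ (b - 2) * drho1 x| `^ p * rho x.
Proof. by move=> rx; apply: fisher_integrandE => //; exact: is_derive_rho. Qed.

Let F_ge0 x : 0 <= F x. Proof. exact: fisher_integrand_ge0. Qed.

Let F_int : mu.-integrable setT (EFin \o F).
Proof. exact/fisher_existsE. Qed.

Let supp_near (x : R) : 0 < rho x -> \forall y \near x, 0 < rho y.
Proof. by move=> rx; exact: (cvgr_gt _ (@crho x) _ rx). Qed.

Let continuous_F (x : R) : 0 < rho x -> {for x, continuous F}.
Proof.
move=> rx; rewrite /prop_for /continuous_at.
(* The truncated power is used because [drho1] may vanish. *)
have : {near x, (fun y => Num.max 0 `|rho y `^ (b - 2) * drho1 y| `^ p * rho y) =1 F}.
  by near=> y; rewrite FE; [rewrite (max_idPr (normr_ge0 _))|near: y; exact: supp_near].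
move=> /near_eq_cvg/cvg_trans; apply; rewrite FE// -{1}(max_idPr (normr_ge0 _)).
apply: cvgM; last exact: crho.
apply: (@continuous_comp _ _ _ (fun y => `|rho y `^ (b - 2) * drho1 y|)
  (fun t => Num.max 0 t `^ p)).
  apply: (@continuous_comp _ _ _ (fun y => rho y `^ (b - 2) * drho1 y) (fun t : R => `|t|)).
    apply: continuousM; last by case: (drho rx).
    apply: (@continuous_comp _ _ _ rho (fun t => t `^ (b - 2))); first exact: crho.
    exact: continuous_powR.
  exact: norm_continuous.
exact/continuous_powR_ge0/p_gt0.
Unshelve. all: by end_near. Qed.

Let rho_int : mu.-integrable setT (EFin \o rho).
Proof. exact: density_integrable. Qed.

(** Integrable majorant of [|rho^(b-1) rho'|], by Young's inequality; it controls the variation of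
    [rho^b]. *)
Let Z x := p^-1 * F x + ps^-1 * rho x.

Let Z_ge0 x : 0 <= Z x.
Proof.
by rewrite addr_ge0// mulr_ge0// invr_ge0 ltW ?(p_gt0 p1) ?(conj_exp_gt0 p1).
Qed.

Let Z_int : mu.-integrable setT (EFin \o Z).
Proof.
have i1 := integrableZl measurableT p^-1 F_int.
have i2 := integrableZl measurableT ps^-1 rho_int.
by have := integrableD measurableT i1 i2; apply: eq_integrable.
Qed.

Let drho_le_Z (x : R) : 0 < rho x -> `|rho x `^ (b - 1) * drho1 x| <= Z x.
Proof.
move=> rx; set a := `|rho x `^ (b - 2) * drho1 x| * rho x `^ p^-1.
have a0 : 0 <= a by rewrite mulr_ge0 ?powR_ge0.
have rp : 0 < rho x `^ ps^-1 by rewrite powR_gt0.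
have := young_powR p1 a0 rp.
have -> : a `^ p = F x.
  rewrite FE// /a powRM ?powR_ge0//; congr (_ * _).
  by rewrite -powRrM mulVf ?gt_eqF ?(p_gt0 p1)// powRr1// ltW.
rewrite -powRrM mulVf ?(gt_eqF (conj_exp_gt0 p1))// (powRr1 (ltW rx)).
have -> : Z x = F x / p + rho x / ps by rewrite /Z; ring.
move=> aZ; apply: (le_trans _ aZ).
rewrite /a !normrM !(ger0_norm (powR_ge0 _ _)).
have -> : rho x `^ (b - 1) = rho x `^ (b - 2) * rho x `^ p^-1 * rho x `^ ps^-1.
  rewrite -!powR_add//; congr (_ `^ _); rewrite conj_expV//; ring.
by rewrite le_eqVlt; apply/orP; left; apply/eqP; ring.
Qed.

Let e_cancel (e y : R) : e * e = 1 -> y = e * (y * e).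
Proof. by move=> ee; rewrite mulrCA ee mulr1. Qed.

Let e_cases (e : R) : e = 1 \/ e = -1 -> e * e = 1 /\ `|e| = 1.
Proof. by case=> ->; rewrite ?normrN normr1; split => //; ring. Qed.

Let is_derive_line (e c : R) (f : R -> R) d t : is_derive (c + e * t) 1 f d ->
  is_derive t 1 (fun t => f (c + e * t)) (d * e).
Proof.
move=> df; have dl : is_derive t 1 (fun t : R => c + e * t) e.
  by apply: is_derive_eq; rewrite /GRing.scale/=; ring.
exact: (@is_derive1_comp _ f (fun t => c + e * t) t d e df dl).
Qed.

Let continuous_line (e c : R) : continuous (fun t : R => c + e * t).
Proof.
move=> t; apply: continuousD; first exact: cst_continuous.
by apply: continuousM; [exact: cst_continuous|exact: cvg_id].
Qed.

Let nd_line (e c B : R) (V : R -> R) : e = 1 \/ e = -1 ->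
  (forall s t : R, s <= t -> V s <= V t) ->
  forall s t : R, s <= t -> e * V (c + e * s) <= e * V (c + e * t).
Proof.
case=> -> ndV s t st; rewrite ?mul1r ?mulN1r ?lerN2; apply: ndV.
- by rewrite lerD2l.
- by rewrite lerB.
Qed.

Let rho_decay (e : R) : e = 1 \/ e = -1 -> forall d, 0 < d ->
  exists T : R, forall t, T <= t -> rho (0 + e * t) < d.
Proof.
move=> he d d0; have [ee ne] := e_cases he.
pose VZ := lower_integral Z.
apply: (@decay _ b (\int[mu]_x Z x) (\int[mu]_x rho x) (fun t => rho (0 + e * t))
  (fun t => drho1 (0 + e * t) * e) (fun t => e * VZ (0 + e * t))
  (fun t => Z (0 + e * t)) (fun t => e * lower_integral rho (0 + e * t))) => //.
- move=> t; apply: (@continuous_comp _ _ _ (fun t => 0 + e * t) rho).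
    exact: continuous_line.
  exact: crho.
- by move=> t rt; apply: is_derive_line; exact: is_derive_rho.
- by apply: nd_line => // s t; exact: lower_integral_nd.
- move=> t; rewrite (le_trans (ler_norm _))// normrM ne mul1r ger0_norm.
    exact: lower_integral_le_total.
  exact: lower_integral_ge0.
- move=> t rt; rewrite [Z _](e_cancel _ ee); apply: is_deriveZ.
  apply: (@is_derive_line e 0 VZ); apply: is_derive_lower_integral => //.
  apply: continuousD; apply: continuousM; try exact: cst_continuous.
    exact: continuous_F.
  exact: crho.
- by move=> t rt; rewrite mulrA normrM ne mulr1; exact: drho_le_Z.
- move=> t; rewrite [rho _](e_cancel _ ee); apply: is_deriveZ.
  apply: (@is_derive_line e 0 (lower_integral rho)).
  by apply: is_derive_lower_integral => //; exact: crho.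
- move=> t; rewrite (le_trans (ler_norm _))// normrM ne mul1r ger0_norm.
    exact: lower_integral_le_total.
  exact: lower_integral_ge0.
Qed.

Lemma density_max :
  exists m x1 x2 : R, [/\ 0 < m, x1 <= x2, forall x, rho x <= m,
    rho x1 = m /\ rho x2 = m &
    (forall x, x < x1 -> rho x < m) /\ (forall x, x2 < x -> rho x < m)].
Proof.
apply: exists_max => //; first exact: density_pos.
- move=> e e0; have [T hT] := rho_decay (or_introl erefl) e0.
  by exists T => t /hT; rewrite add0r mul1r.
- move=> e e0; have [T hT] := rho_decay (or_intror erefl) e0.
  by exists T => t /hT; rewrite add0r mulN1r.
Qed.

Variables (Phi G : R -> R) (m x1 x2 : R).
Hypothesis dPhi : forall s : R, 0 < s < 1 ->
  is_derive s 1 Phi (- (s `^ (b - 2) * ell l s `^ (- p^-1))).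
Hypothesis cPhi : forall s : R, 0 < s -> {for s, continuous Phi}.
Hypothesis Phi1 : Phi 1 = 0.
Hypothesis dG : forall s : R, 0 < s < 1 -> is_derive s 1 G (gn_deriv p b l s).
Hypothesis cG : forall s : R, 0 < s -> {for s, continuous G}.
Hypothesis G0 : forall e : R, 0 < e ->
  exists2 d : R, 0 < d < 1 & forall s : R, 0 <= s <= d -> `|G s| < e.
Hypothesis m0 : 0 < m.
Hypothesis x12 : x1 <= x2.
Hypothesis rho_le : forall x : R, rho x <= m.
Hypothesis rho1 : rho x1 = m.
Hypothesis rho2 : rho x2 = m.
Hypothesis rho_lt1 : forall x : R, x < x1 -> rho x < m.
Hypothesis rho_lt2 : forall x : R, x2 < x -> rho x < m.

Let u x := rho x / m.
Let du x := drho1 x / m.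
Let W x := u x * ell l (u x).
Hypothesis W_int : mu.-integrable setT (EFin \o W).

Let cu : continuous u.
Proof.
move=> x; rewrite /u.
by apply: cvgM; [exact: crho|exact: cvg_cst].
Qed.

Let u_ge0 x : 0 <= u x. Proof. by rewrite divr_ge0// ltW. Qed.
Let u_le1 x : u x <= 1. Proof. by rewrite ler_pdivrMr// mul1r. Qed.

Let u_rho x : (0 < u x) = (0 < rho x).
Proof. by rewrite pmulr_lgt0// invr_gt0. Qed.

Let is_derive_u (x : R) : 0 < u x -> is_derive x 1 u (du x).
Proof.
rewrite u_rho => rx; have dr := is_derive_rho rx.
by apply: is_derive_eq; rewrite /GRing.scale/= /du; ring.
Qed.

Let W_ge0 x : 0 <= W x. Proof. by rewrite mulr_ge0 ?ell_ge0. Qed.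

Let u_int : mu.-integrable setT (EFin \o u).
Proof.
have := integrableZl measurableT m^-1 rho_int.
by apply: eq_integrable => // x _; rewrite /= /u mulrC EFinM.
Qed.

Let u_mass : \int[mu]_x u x = m^-1.
Proof.
rewrite /u -[RHS]mul1r -(density_mass mass) -RintegralZr//.
Qed.

(** The integral of [|u^(b-2) u'|^p u] for [u = rho / m]; the power of [m] comes from the
    homogeneity of the Fisher integrand. *)
Definition fisher_scaled := (m `^ (1 - b)) `^ p / m * \int[mu]_x F x.
Definition ell_integral := \int[mu]_x W x.

Section Scale.
Variable k : R.
Hypothesis k0 : 0 < k.

(** Expressed by [F] and [W], so that integrability and the total integral follow by linearity; it
    agrees with [young_rhs] where [u > 0]. *)
Let Y x := k `^ p * ((m `^ (1 - b)) `^ p / m * F x) / p + W x / ps.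

Let YE (x : R) : 0 < u x -> Y x = young_rhs p b l k (u x) (du x).
Proof.
move=> ux; have rx : 0 < rho x by rewrite -u_rho.
rewrite /Y /young_rhs FE//; congr (_ * _ / _ + _).
have -> : u x `^ (b - 2) * du x = m `^ (1 - b) * (rho x `^ (b - 2) * drho1 x).
  rewrite /u /du powRM ?invr_ge0 ?ltW// -[m^-1]powR_inv1 ?ltW// -powRrM.
  have -> : m `^ (1 - b) = m `^ (-1 * (b - 2)) * m `^ (-1).
    by rewrite -powR_add//; congr (_ `^ _); ring.
  by ring.
rewrite [in RHS]normrM (ger0_norm (powR_ge0 m _)) [in RHS]powRM ?powR_ge0//.
by rewrite /u; ring.
Qed.

Let Y_ge0 x : 0 <= Y x.
Proof.
have [p0 ps0] := (p_gt0 p1, conj_exp_gt0 p1).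
apply: addr_ge0; apply: mulr_ge0; rewrite ?invr_ge0 ?(ltW p0) ?(ltW ps0) ?W_ge0//.
apply: mulr_ge0; first exact: powR_ge0.
by apply: mulr_ge0 => //; apply: mulr_ge0; rewrite ?powR_ge0// invr_ge0 ltW.
Qed.

Let Y_int : mu.-integrable setT (EFin \o Y).
Proof.
have i1 := integrableZl measurableT (k `^ p * ((m `^ (1 - b)) `^ p / m) / p) F_int.
have i2 := integrableZl measurableT ps^-1 W_int.
have := integrableD measurableT i1 i2.
apply: eq_integrable => // x _; rewrite /= /Y -!EFinM -EFinD; congr EFin.
by ring.
Qed.

Let Y_total : \int[mu]_x Y x = k `^ p * fisher_scaled / p + ell_integral / ps.
Proof.
have i1 := integrableZl measurableT (k `^ p * ((m `^ (1 - b)) `^ p / m) / p) F_int.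
have i2 := integrableZl measurableT ps^-1 W_int.
have -> : Y = fun x => k `^ p * ((m `^ (1 - b)) `^ p / m) / p * F x + ps^-1 * W x.
  by apply/funext => x; rewrite /Y; ring.
rewrite RintegralD// !RintegralZl// /fisher_scaled /ell_integral.
by ring.
Qed.

Let V := lower_integral Y.

Let continuous_W x : 0 < u x -> {for x, continuous W}.
Proof.
move=> ux; apply: continuousM; first exact: cu.
by apply: (@continuous_comp _ _ _ u (ell l)); [exact: cu|exact: continuous_ell].
Qed.

Let is_derive_V (x : R) : 0 < u x ->
  is_derive x 1 V (young_rhs p b l k (u x) (du x)).
Proof.
move=> ux; rewrite -YE//; apply: is_derive_lower_integral => //.
apply: continuousD; apply: continuousM; try exact: cst_continuous.
  apply: continuousM; first exact: cst_continuous.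
  apply: continuousM; first exact: cst_continuous.
  by apply: continuous_F; rewrite -u_rho.
exact: continuous_W.
Qed.

Let V_nd (s t : R) : s <= t -> V s <= V t.
Proof. exact: lower_integral_nd. Qed.

Section Side.
(* [e = 1] (resp. [-1]) for the half-line to the right (resp. left) of [c]. *)
Variables e c : R.
Hypothesis he : e = 1 \/ e = -1.
Hypothesis u_c : u c = 1.
Hypothesis u_side : forall t : R, 0 < t -> u (c + e * t) < 1.

Let us t := u (c + e * t).
Let dus t := du (c + e * t) * e.
(** The factor [e] makes this nondecreasing in [t] on the left half-line as well. *)
Let Vs t := e * V (c + e * t).

Let cus : continuous us.
Proof.
move=> t; apply: (@continuous_comp _ _ _ (fun t => c + e * t) u).
  exact: continuous_line.
exact: cu.
Qed.

Let us0 : us 0 = 1. Proof. by rewrite /us mulr0 addr0. Qed.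

Let us_small (d : R) : 0 < d -> exists2 t : R, 0 < t & us t <= d.
Proof.
move=> d0; have [T hT] := rho_decay he (mulr_gt0 d0 m0).
pose t := Num.max 1 (T - e * c); have [ee _] := e_cases he.
exists t; first by rewrite lt_max ltr01.
rewrite /us /u ler_pdivrMr// ltW//.
have -> : c + e * t = 0 + e * (e * c + t).
  by rewrite add0r mulrDr mulrA ee mul1r.
by apply: hT; rewrite -lerBlDl le_max lexx orbT.
Qed.

Let us_deriv (t : R) : 0 < t -> 0 < us t -> is_derive t 1 us (dus t).
Proof. by move=> _ ut; apply: (@is_derive_line e c u); exact: is_derive_u. Qed.

Let Vs_nd (s t : R) : 0 <= s -> s <= t -> Vs s <= Vs t.
Proof. by move=> _; apply: nd_line. Qed.

Let Vs_deriv (t : R) : 0 <= t -> 0 < us t ->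
  is_derive t 1 Vs (young_rhs p b l k (us t) (dus t)).
Proof.
move=> _ ut; have [ee ne] := e_cases he.
have -> : young_rhs p b l k (us t) (dus t) =
    young_rhs p b l k (u (c + e * t)) (du (c + e * t)).
  by rewrite /young_rhs /dus (mulrA (us t `^ (b - 2))) (normrM _ e) ne mulr1.
rewrite (e_cancel (young_rhs _ _ _ _ _ _) ee); apply: is_deriveZ.
by apply: (@is_derive_line e c V); exact: is_derive_V.
Qed.

Lemma side_bound B :
  (forall t : R, 0 <= t -> e * V (c + e * t) <= B) -> k * G 1 <= B - e * V c.
Proof.
move=> VB; have := @one_sided_bound _ p b l p1 G dG cG G0 us dus Vs k k0 cus us0
  u_side us_small us_deriv Vs_deriv B VB.
by rewrite /Vs mulr0 addr0.
Qed.

Lemma side_rigidity t :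
  (forall t : R, 0 <= t -> e * V (c + e * t) - e * V c <= k * G 1) ->
  0 <= t ->
  (0 < u (c + e * t) <= 1 /\ Phi (u (c + e * t)) = t / k) \/
  (u (c + e * t) = 0 /\ forall s : R, 0 < s <= 1 -> Phi s < t / k).
Proof.
move=> VE t0.
have VE0 (x : R) : 0 <= x -> Vs x - Vs 0 <= k * G 1.
  by move=> x0; rewrite /Vs mulr0 addr0; exact: VE.
exact: (@one_sided_rigidity _ p b l p1 Phi G dPhi cPhi Phi1 dG cG G0 us dus Vs k
  k0 cus us0 u_side (fun t _ => u_ge0 (c + e * t)) us_small us_deriv Vs_nd Vs_deriv VE0 t t0).
Qed.

Lemma side_mass B :
  (forall t : R, 0 <= t -> e * V (c + e * t) - e * V c <= k * G 1) ->
  (forall t : R, e * lower_integral u t <= B) ->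
  k * (ps * zeta_min p b l * G 1) <= B - e * lower_integral u c.
Proof.
move=> VE MB.
have VE0 (x : R) : 0 <= x -> Vs x - Vs 0 <= k * G 1.
  by move=> x0; rewrite /Vs mulr0 addr0; exact: VE.
have dM (t : R) : 0 <= t -> is_derive t 1 (fun t => e * lower_integral u (c + e * t)) (us t).
  move=> _; have [ee _] := e_cases he.
  rewrite (e_cancel (us t) ee); apply: is_deriveZ.
  apply: (@is_derive_line e c (lower_integral u)).
  by apply: is_derive_lower_integral => //; exact: cu.
have := @one_sided_mass _ p b l p1 G dG cG G0 us dus Vs k
  k0 cus us0 u_side us_small us_deriv Vs_deriv VE0 bl _ dM B.
by rewrite mulr0 addr0; apply => t _; exact: MB.
Qed.

End Side.

Let u1 : u x1 = 1. Proof. by rewrite /u rho1 mulfV// gt_eqF. Qed.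
Let u2 : u x2 = 1. Proof. by rewrite /u rho2 mulfV// gt_eqF. Qed.

Let u_right (t : R) : 0 < t -> u (x2 + 1 * t) < 1.
Proof.
by move=> t0; rewrite /u ltr_pdivrMr// !mul1r rho_lt2// ltrDl.
Qed.

Let u_left (t : R) : 0 < t -> u (x1 + -1 * t) < 1.
Proof.
by move=> t0; rewrite /u ltr_pdivrMr// mul1r rho_lt1// mulN1r gtrBl.
Qed.

Let V_ge0 t : 0 <= V t. Proof. exact: lower_integral_ge0. Qed.

Let V_le t : V t <= \int[mu]_x Y x. Proof. exact: lower_integral_le_total. Qed.

Let V_right : k * G 1 <= \int[mu]_x Y x - V x2.
Proof.
have := @side_bound 1 x2 (or_introl erefl) u2 u_right (\int[mu]_x Y x).
by rewrite mul1r; apply => t _; rewrite mul1r.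
Qed.

Let V_left : k * G 1 <= V x1.
Proof.
have := @side_bound (-1) x1 (or_intror erefl) u1 u_left 0.
by rewrite mulN1r sub0r opprK; apply => t _; rewrite mulN1r oppr_le0.
Qed.

Lemma gn_scale_bound :
  k * (2 * G 1) <= k `^ p * fisher_scaled / p + ell_integral / ps.
Proof.
rewrite -Y_total; have := V_nd x12; move: V_right V_left; lra.
Qed.

Section Equality.
Hypothesis YE2 :
  k * (2 * G 1) = k `^ p * fisher_scaled / p + ell_integral / ps.

Let VE_right (t : R) : 0 <= t -> 1 * V (x2 + 1 * t) - 1 * V x2 <= k * G 1.
Proof.
move=> _; move: (V_le (x2 + 1 * t)) V_left (V_nd x12) YE2.
by rewrite Y_total !mul1r; lra.
Qed.

Let VE_left (t : R) : 0 <= t -> -1 * V (x1 + -1 * t) - -1 * V x1 <= k * G 1.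
Proof.
move=> _; move: (V_ge0 (x1 + -1 * t)) V_right (V_nd x12) YE2.
by rewrite Y_total !mulN1r; lra.
Qed.

Lemma gn_rigidity_right t : 0 <= t ->
  (0 < u (x2 + 1 * t) <= 1 /\ Phi (u (x2 + 1 * t)) = t / k) \/
  (u (x2 + 1 * t) = 0 /\ forall s : R, 0 < s <= 1 -> Phi s < t / k).
Proof. exact: (@side_rigidity 1 x2 (or_introl erefl) u2 u_right t VE_right). Qed.

Lemma gn_rigidity_left t : 0 <= t ->
  (0 < u (x1 + -1 * t) <= 1 /\ Phi (u (x1 + -1 * t)) = t / k) \/
  (u (x1 + -1 * t) = 0 /\ forall s : R, 0 < s <= 1 -> Phi s < t / k).
Proof. exact: (@side_rigidity (-1) x1 (or_intror erefl) u1 u_left t VE_left). Qed.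

(** In the equality case the two slopes use up the whole integral of [Y], which leaves no increase
    between [x1] and [x2]. *)
Let V12 x : x1 <= x <= x2 -> V x = V x1.
Proof.
move=> /andP[x1x xx2]; move: (V_nd x1x) (V_nd xx2) V_left V_right YE2.
by rewrite Y_total => ? ? ? ? ?; apply/le_anti/andP; split; lra.
Qed.

Let u_plateau x : x1 < x < x2 -> 0 < u x -> u x = 1.
Proof.
move=> /andP[x1x xx2] ux; apply/eqP; rewrite eq_le u_le1/= leNgt; apply/negP => ux1.
have dV := is_derive_V ux.
have dc : is_derive x 1 V 0.
  have := is_derive_cst (V x1) x 1.
  apply: near_eq_is_derive; near=> y; rewrite V12//; apply/andP; split; apply: ltW.
    by near: y; exact: lt_nbhsr.
  by near: y; exact: lt_nbhsl.
have := @derive_val _ _ _ _ _ _ _ dV; rewrite (@derive_val _ _ _ _ _ _ _ dc).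
move=> /esym/eqP; apply/negP; rewrite gt_eqF// /young_rhs ltr_wpDl//.
  rewrite divr_ge0 ?(ltW (p_gt0 p1))// mulr_ge0 ?powR_ge0//.
  by rewrite mulr_ge0 ?powR_ge0.
by rewrite divr_gt0 ?conj_exp_gt0// mulr_gt0// ell_gt0.
Unshelve. all: by end_near. Qed.

(** Only the values 0 and 1 are possible between [x1] and [x2]; starting from 1, a continuous
    function would pass through 1/2 before vanishing. *)
Let u_plateau1 x : x1 < x < x2 -> u x = 1.
Proof.
move=> x1x2; have [ux|ux] := ltP 0 (u x); first exact: u_plateau.
have /andP[x1x xx2] := x1x2.
have [y /andP[x1y yx] uy] : exists2 y, x1 <= y <= x & u y = 2^-1.
  apply: intermediate_value; rewrite ?(ltW x1x)//; first by move=> z _; exact: cu.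
  rewrite u1; apply/orP; right; apply/andP; split; last by lra.
  by apply: (le_trans ux); lra.
have h0 : 0 < 2^-1 :> R by lra.
have : u y = 1.
  apply: u_plateau; last by rewrite uy.
  rewrite lt_neqAle x1y (le_lt_trans yx xx2) !andbT; apply/eqP => yE.
  by move: uy; rewrite -yE u1; lra.
by rewrite uy; lra.
Qed.

Let U := lower_integral u.

Let dU (x : R) : is_derive x 1 U (u x).
Proof. by apply: is_derive_lower_integral => //; exact: cu. Qed.

Let U12 : U x2 - U x1 = x2 - x1.
Proof.
suff : U x1 - x1 = U x2 - x2 by lra.
apply: (@derive0_eq _ (fun x => U x - x) (fun x => u x - 1)) => //.
- by move=> x _; exact: (is_deriveB (dU x) (is_derive_id x 1)).
- move=> x _; apply: continuousB; first exact: is_derive_continuous (dU x).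
  exact: cvg_id.
- by move=> x x1x2; rewrite u_plateau1// subrr.
Qed.

(* The two slopes already carry the whole mass [m^-1], which leaves none for the plateau. *)
Lemma gn_rigidity_mass :
  2 * (k * (ps * zeta_min p b l * G 1)) + (x2 - x1) <= m^-1.
Proof.
have Br (t : R) : 1 * lower_integral u t <= m^-1.
  by rewrite mul1r -u_mass lower_integral_le_total.
have Bl (t : R) : -1 * lower_integral u t <= 0.
  by rewrite mulN1r oppr_le0 lower_integral_ge0.
have := side_mass (or_introl erefl) u2 u_right VE_right Br.
have := side_mass (or_intror erefl) u1 u_left VE_left Bl.
rewrite mul1r mulN1r sub0r opprK => Hl Hr.
by move: U12 Hr Hl; rewrite /U; lra.
Qed.

End Equality.

End Scale.

End Density.

Section SharpInequality.
Context {R : realType}.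
Variables p b l : R.
Hypotheses (p1 : 1 < p) (b0 : 0 < b) (l0 : 0 < l).
Notation ps := (conj_exp p).
Hypothesis bl : 1 - b * ps < l.
Local Notation mu := (@lebesgue_measure R).
Notation zt := (zeta_min p b l).
Notation Q := (gn_weight p b l).

(** [Phi] and [G] are known only through such properties until the closed forms appear, since the
    latter differ according as [l = 1] or not. *)
Definition profile_primitive (Phi : R -> R) : Prop :=
  [/\ forall s : R, 0 < s < 1 ->
        is_derive s 1 Phi (- (s `^ (b - 2) * ell l s `^ (- p^-1))),
      forall s : R, 0 < s -> {for s, continuous Phi} & Phi 1 = 0].

(** The last clause contains both [G 0 = 0] and right continuity at 0, the end at which the
    integrand may be singular. *)
Definition weight_primitive (G : R -> R) : Prop :=
  [/\ forall s : R, 0 < s < 1 -> is_derive s 1 G (gn_deriv p b l s),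
      forall s : R, 0 < s -> {for s, continuous G} &
      forall e : R, 0 < e ->
        exists2 d : R, 0 < d < 1 & forall s : R, 0 <= s <= d -> `|G s| < e].

(* [s] is the value at [y] of the inverse of the decreasing function [Phi], extended by 0
   beyond the supremum of [Phi]. *)
Definition profile_at (Phi : R -> R) (s y : R) : Prop :=
  (0 < s <= 1 /\ Phi s = y) \/
  (s = 0 /\ forall t : R, 0 < t <= 1 -> Phi t < y).

Definition sqrt_complexity (rho : R -> R) : R :=
  (\int[mu]_x fisher_integrand p b rho x) `^ p^-1 * expR (b * renyi_entropy l rho).

Lemma weight_primitive_lt G s t : weight_primitive G -> 0 < s -> s < t -> t <= 1 ->
  G s < G t.
Proof.
move=> [dG cG _] s0 st t1; apply: (@derive_gt0_lt _ G (gn_deriv p b l)) => //.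
- by move=> x /andP[sx xt]; apply: dG; rewrite (lt_trans s0 sx) (lt_le_trans xt).
- by move=> x /andP[sx xt]; apply: cG; exact: lt_le_trans sx.
- move=> x /andP[sx xt]; have x0 := lt_trans s0 sx; have x1 := lt_le_trans xt t1.
  by rewrite mulr_gt0 ?powR_gt0 ?ell_gt0.
Qed.

Lemma weight_primitive_gt0 G s : weight_primitive G -> 0 < s <= 1 -> 0 < G s.
Proof.
move=> HG /andP[s0 s1]; have [_ _ G0] := HG.
have h0 : 0 < s / 2 by lra.
have h1 : s / 2 < s by lra.
have := weight_primitive_lt HG h0 h1 s1; apply: le_lt_trans.
rewrite -oppr_le0; apply/ler_addgt0Pr => e e0; rewrite add0r.
have [d /andP[d0 d1] hd] := G0 _ e0.
pose q := Num.min d (s / 4).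
have q0 : 0 < q by rewrite lt_min d0/=; lra.
have qh : q < s / 2 by rewrite gt_min; apply/orP; right; lra.
have := hd q; rewrite (ltW q0) ge_min lexx => /(_ isT) Gq.
have := weight_primitive_lt HG q0 qh (le_trans (ltW h1) s1).
move: Gq; rewrite ltr_norml => /andP[]; lra.
Qed.

Let inv_of_mul (x y z : R) : x != 0 -> z != 0 -> x * y = z^-1 -> z * y = x^-1.
Proof. by move=> x0 z0 E; apply: (mulfI x0); rewrite mulrCA E !mulfV. Qed.

Variables (Phi G : R -> R) (r0 : R).
Hypotheses (HPhi : profile_primitive Phi) (HG : weight_primitive G).
Hypothesis r01 : 0 < r0 < 1.
Hypothesis er0 : ell l r0 = (ps * zt)^-1.

Lemma gn_inequality rho : complexity_domain p b l rho ->
  2 * G 1 <= sqrt_complexity rho * Q r0 /\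
  (2 * G 1 = sqrt_complexity rho * Q r0 -> exists x0 k, 0 < k /\
   forall x, profile_at Phi (rho x * (2 * (k * (ps * zt * G 1)))) (`|x - x0| / k)).
Proof.
move=> [[rge0 crho drho mass] fishR renyiR].
have [dPhi cPhi Phi1] := HPhi; have [dG cG G0] := HG.
have G1 : 0 < G 1 by rewrite (weight_primitive_gt0 HG)// ltr01 lexx.
have [p0 ps0] := (p_gt0 p1, conj_exp_gt0 p1); have z0 := zeta_min_gt0 p1 bl.
have [m [x1 [x2 [m0 x12 rho_le [rho1 rho2] [rho_lt1 rho_lt2]]]]] :=
  density_max p1 b0 rge0 crho drho mass fishR.
have W_int := (renyi_existsP l0 rge0 crho mass m0 rho_le).1 renyiR.
set I := \int[mu]_x fisher_integrand p b rho x.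
pose A := fisher_scaled p b rho m; pose L := ell_integral l rho m.
have I0 : 0 <= I by apply: Rintegral_ge0 => x _; exact: fisher_integrand_ge0.
have A0 : 0 <= A by rewrite mulr_ge0// divr_ge0 ?powR_ge0// ltW.
have L0 : 0 <= L.
  apply: Rintegral_ge0 => x _; rewrite mulr_ge0 ?ell_ge0//.
  by rewrite divr_ge0// ltW.
have GG : 0 < 2 * G 1 by rewrite mulr_gt0.
have HAL k (k0 : 0 < k) : k * (2 * G 1) <= k `^ p * A / p + L / ps.
  exact: (gn_scale_bound p1 b0 rge0 crho drho mass fishR dG cG G0 m0 x12
    rho1 rho2 rho_lt1 rho_lt2 W_int k0).
have [Agt0 Lgt0 AL [k [k0 kA kL]]] := young_optimal p1 A0 L0 GG HAL.
have [] := renyi_mean l0 rge0 crho mass m0 rho_le renyiR Lgt0.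
set r := expR _ / m => r_01 er.
have r_gt0 : 0 < r by case/andP: r_01.
(* The powers of [m] in [A], [L] and [Q r] match because [(1 - b) - 1/p - 1/ps = - b]. *)
have SQ : sqrt_complexity rho * Q r = A `^ p^-1 * L `^ ps^-1.
  have LE : L `^ ps^-1 = m^-1 `^ ps^-1 * ell l r `^ ps^-1.
    by rewrite -powRM ?invr_ge0 ?ell_ge0 ?(ltW m0)// er mulKf// gt_eqF.
  have AE : A `^ p^-1 = m `^ (1 - b) * m^-1 `^ p^-1 * I `^ p^-1.
    rewrite /A /fisher_scaled -/I powRM ?divr_ge0 ?powR_ge0 ?(ltW m0)//.
    rewrite [X in X * _]powRM ?powR_ge0 ?invr_ge0 ?(ltW m0)//.
    by rewrite -powRrM mulfV ?powRr1 ?powR_ge0// gt_eqF.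
  rewrite LE AE /sqrt_complexity /gn_weight -/I.
  have -> : r `^ b = expR (- (b * renyi_entropy l rho)) * m^-1 `^ b.
    rewrite powRM ?expR_ge0 ?invr_ge0 ?(ltW m0)// (powRE _ (expR_gt0 _)) expRK.
    by rewrite mulrN.
  have -> : m^-1 `^ b = m `^ (1 - b) * m^-1 `^ p^-1 * m^-1 `^ ps^-1.
    rewrite -[m^-1]powR_inv1 ?(ltW m0)// -!powRrM -!powR_add//; congr (_ `^ _).
    by rewrite conj_expV//; ring.
  transitivity (m `^ (1 - b) * m^-1 `^ p^-1 * I `^ p^-1 *
    (m^-1 `^ ps^-1 * ell l r `^ ps^-1) * (expR (b * renyi_entropy l rho) *
    expR (- (b * renyi_entropy l rho)))); first by ring.
  by rewrite -expRD subrr expR0 mulr1.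
clearbody r.
have S0 : 0 < sqrt_complexity rho.
  have I_gt0 : 0 < I.
    rewrite lt_neqAle I0 andbT; apply/eqP => I_0.
    by move: Agt0; rewrite /A /fisher_scaled -/I -I_0 mulr0 ltxx.
  by rewrite mulr_gt0 ?expR_gt0// powR_gt0.
move: SQ S0; set S := sqrt_complexity rho => SQ S0; clearbody S.
have [Qle Qeq] := gn_weight_max p1 bl r01 er0 r_01.
have SQ0 : 2 * G 1 <= S * Q r by rewrite SQ.
have SQle : S * Q r <= S * Q r0.
  by rewrite ler_pM2l.
split; first exact: le_trans SQle.
move=> E.
have SQE : S * Q r = S * Q r0.
  apply/le_anti/andP; split; first exact: SQle.
  exact: (eq_ind _ (fun z => z <= S * Q r) SQ0 _ E).
have rr0 : r = r0.
  have QE : Q r = Q r0 by apply: (mulfI (lt0r_neq0 S0)); exact: SQE.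
  by apply/eqP; rewrite -Qeq QE.
have ALE : A `^ p^-1 * L `^ ps^-1 = 2 * G 1.
  exact: etrans (esym SQ) (etrans SQE (esym E)).
have kGL : k * (2 * G 1) = L by rewrite -ALE.
have kE : k * (2 * G 1) = k `^ p * A / p + L / ps.
  apply: (etrans kGL); apply: (etrans (esym (conj_exp_split p1 L))).
  by congr (_ / _ + _); apply: esym.
(* [ell r = m L] with [r = r0] gives [m^-1 = ps * zt * L], and [L = 2 k G 1]. So the two slopes
   carry exactly the mass [m^-1], whence [x2 <= x1] below. *)
have mL : 2 * (k * (ps * zt * G 1)) = m^-1.
  have kps : 2 * (k * (ps * zt * G 1)) = ps * zt * L by rewrite -kGL; ring.
  apply: (etrans kps); apply: (inv_of_mul (lt0r_neq0 m0)).
    exact: mulf_neq0 (lt0r_neq0 ps0) (lt0r_neq0 z0).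
  exact: etrans (esym er) (etrans (congr1 (ell l) rr0) er0).
have x21 : x2 = x1.
  have := gn_rigidity_mass p1 b0 bl rge0 crho drho mass fishR dG cG G0 m0 x12 rho_le
    rho1 rho2 rho_lt1 rho_lt2 W_int k0 kE.
  by rewrite mL gerDl subr_le0 => x21; apply/le_anti; rewrite x21 x12.
exists x1, k; split; first exact: k0.
move=> x; rewrite mL.
have [xx1|/ltW xx1] := leP x1 x.
  have t0 : 0 <= x - x2 by rewrite x21 subr_ge0.
  have := gn_rigidity_right p1 b0 rge0 crho drho mass fishR dPhi cPhi Phi1 dG cG G0 m0
    x12 rho1 rho2 rho_lt1 rho_lt2 W_int k0 kE t0.
  by rewrite mul1r addrC subrK x21 ger0_norm ?subr_ge0.
have t0 : 0 <= x1 - x by rewrite subr_ge0.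
have := gn_rigidity_left p1 b0 rge0 crho drho mass fishR dPhi cPhi Phi1 dG cG G0 m0
  x12 rho1 rho2 rho_lt1 rho_lt2 W_int k0 kE t0.
by rewrite mulN1r opprB addrC subrK distrC ger0_norm ?subr_ge0.
Qed.

End SharpInequality.

(** * The extremal densities *)

Section Candidate.
Context {R : realType}.
Variables p b l : R.
Hypotheses (p1 : 1 < p) (b0 : 0 < b) (l0 : 0 < l).
Notation ps := (conj_exp p).
Hypothesis bl : 1 - b * ps < l.
Local Notation mu := (@lebesgue_measure R).
Notation zt := (zeta_min p b l).
Notation Q := (gn_weight p b l).
Variables (Phi G w : R -> R).
Hypotheses (HPhi : profile_primitive p b l Phi) (HG : weight_primitive p b l G).
Hypothesis Hw : forall y : R, 0 <= y -> profile_at Phi (w y) y.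

Lemma profile_primitive_lt (s t : R) : 0 < s -> s < t -> t <= 1 -> Phi t < Phi s.
Proof.
have [dPhi cPhi _] := HPhi; move=> s0 st t1; rewrite -ltrN2.
apply: (@derive_gt0_lt _ (fun x => - Phi x)
  (fun x => - - (x `^ (b - 2) * ell l x `^ (- p^-1)))) => //.
- move=> x /andP[sx xt]; apply: is_deriveN; apply: dPhi.
  by rewrite (lt_trans s0 sx) (lt_le_trans xt).
- by move=> x /andP[sx xt]; apply: continuousN; apply: cPhi; exact: lt_le_trans sx.
- move=> x /andP[sx xt]; have x0 := lt_trans s0 sx; have x1 := lt_le_trans xt t1.
  by rewrite opprK mulr_gt0 ?powR_gt0 ?ell_gt0.
Qed.

Lemma profile_unique (s t y : R) : profile_at Phi s y -> profile_at Phi t y -> s = t.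
Proof.
move=> [[/andP[s0 s1] sy]|[s0 sy]] [[/andP[t0 t1] ty]|[t0 ty]].
- have [st|ts|//] := ltgtP s t.
  + by have := profile_primitive_lt s0 st t1; rewrite sy ty ltxx.
  + by have := profile_primitive_lt t0 ts s1; rewrite sy ty ltxx.
- by have := ty s; rewrite s0 s1 sy ltxx => /(_ isT).
- by have := sy t; rewrite t0 t1 ty ltxx => /(_ isT).
- by rewrite s0 t0.
Qed.

Let w_ge0 (y : R) : 0 <= y -> 0 <= w y.
Proof. by move=> /Hw [[/andP[/ltW]]|[->]]. Qed.

Let w_le1 (y : R) : 0 <= y -> w y <= 1.
Proof. by move=> /Hw [[/andP[]]|[-> _]]. Qed.

(** An order equivalence covering both cases of [profile_at]; monotonicity and continuity of [w]
    follow from it, whether its support is bounded or not. *)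
Let w_galois (s y : R) : 0 < s <= 1 -> 0 <= y -> (s <= w y) = (y <= Phi s).
Proof.
move=> /andP[s0 s1] /Hw [[/andP[wy0 wy1] E]|[-> H]].
  rewrite -[X in _ = (X <= _)]E.
  have [sw|ws|->] := ltgtP s (w y); last by rewrite lexx.
  - by rewrite ltW// profile_primitive_lt.
  - by apply/esym/negbTE; rewrite -ltNge profile_primitive_lt.
rewrite [s <= 0]leNgt s0; apply/esym/negbTE; rewrite -ltNge.
by apply: H; rewrite s0.
Qed.

Let Phi_ge0 (s : R) : 0 < s <= 1 -> 0 <= Phi s.
Proof.
have [_ _ Phi1] := HPhi; move=> /andP[s0]; rewrite le_eqVlt => /predU1P[->|s1].
  by rewrite Phi1.
by rewrite -Phi1 ltW// profile_primitive_lt.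
Qed.

Let w0 : w 0 = 1.
Proof.
have [_ _ Phi1] := HPhi; apply: (@profile_unique _ _ 0); first exact: Hw.
by left; split; [rewrite ltr01 lexx|].
Qed.

Let wPhi (s : R) : 0 < s <= 1 -> w (Phi s) = s.
Proof.
move=> s01; apply: (@profile_unique _ _ (Phi s)); first exact/Hw/Phi_ge0.
by left.
Qed.

Let w_lt1 (y : R) : 0 < y -> w y < 1.
Proof.
have [_ _ Phi1] := HPhi; move=> y0.
have one01 : 0 < (1 : R) <= 1 by rewrite ltr01 lexx.
by rewrite ltNge (w_galois one01 (ltW y0)) Phi1 -ltNge.
Qed.

Let w_nd (y z : R) : 0 <= y -> y <= z -> w z <= w y.
Proof.
move=> y0 yz; have z0 := le_trans y0 yz.
have := w_ge0 z0; rewrite le_eqVlt => /predU1P[<-|wz]; first exact: w_ge0.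
have wz1 : 0 < w z <= 1 by rewrite wz w_le1.
by rewrite w_galois// (le_trans yz)// -w_galois.
Qed.

Let v (y : R) := w `|y|.

Let v_ge0 y : 0 <= v y. Proof. exact: w_ge0. Qed.
Let v_le1 y : v y <= 1. Proof. exact: w_le1. Qed.

(** By [w_galois] the superlevel sets of [v] are given by [|y| <= Phi s], so only the continuity of
    the absolute value is used. *)
Let continuous_v : continuous v.
Proof.
move=> y; apply/cvgrPdist_lt => e e0.
have up : \forall z \near y, v z < v y + e.
  have [s1|s1] := ltP 1 (v y + e).
    by near=> z; rewrite (le_lt_trans (v_le1 z)).
  have s01 : 0 < v y + e <= 1 by rewrite s1 ltr_wpDl.
  have : Phi (v y + e) < `|y|.
    by rewrite ltNge -w_galois// -ltNge ltrDl.
  move=> Py; near=> z; rewrite ltNge w_galois// -ltNge.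
  by near: z; exact: (cvgr_gt _ (@norm_continuous _ _ y) _ Py).
have down : \forall z \near y, v y - e < v z.
  have [s0|s0] := ltP (v y - e) 0.
    by near=> z; rewrite (lt_le_trans s0).
  pose s := v y - e / 2.
  have s01 : 0 < s <= 1.
    by rewrite /s; apply/andP; split; [|have := v_le1 y]; lra.
  have Py : `|y| < Phi s.
    have vy01 : 0 < v y <= 1 by rewrite v_le1 andbT; lra.
    have : `|y| <= Phi (v y) by rewrite -w_galois.
    move=> /le_lt_trans; apply; apply: profile_primitive_lt; rewrite ?v_le1//.
      by case/andP: s01.
    by rewrite /s; lra.
  near=> z; apply: (@lt_le_trans _ _ s); first by rewrite /s; lra.
  rewrite w_galois// ltW//.
  by near: z; exact: (cvgr_lt _ (@norm_continuous _ _ y) _ Py).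
near=> z; rewrite ltr_norml; apply/andP; split.
- rewrite ltrBrDl ltrBlDr; near: z; exact: up.
- rewrite ltrBlDl -ltrBlDr; near: z; exact: down.
Unshelve. all: by end_near. Qed.

Let slope (y : R) := v y `^ (2 - b) * ell l (v y) `^ p^-1.

Let is_derive_w (y : R) : 0 < y -> 0 < w y ->
  is_derive y 1 w (- (w y `^ (2 - b) * ell l (w y) `^ p^-1)).
Proof.
have [dPhi cPhi _] := HPhi; move=> y0 wy.
have wy1 := w_lt1 y0; have e0 := ell_gt0 l wy wy1.
have PhiE : Phi (w y) = y.
  by have [[]|[wy_0]] := Hw (ltW y0); [|rewrite wy_0 ltxx in wy].
have wy01 : 0 < w y < 1 by rewrite wy.
have neq0 : - (w y `^ (b - 2) * ell l (w y) `^ (- p^-1)) != 0.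
  by rewrite oppr_eq0 gt_eqF// mulr_gt0 ?powR_gt0.
have := @is_derive_inverse _ Phi w _ (w y) _ _ (dPhi _ wy01) neq0.
rewrite PhiE invrN invfM -!powRN opprB opprK; apply.
- near=> t; apply: wPhi; apply/andP; split; first by near: t; exact: lt_nbhsr.
  by apply: ltW; near: t; exact: lt_nbhsl.
- by near=> t; apply: cPhi; near: t; exact: lt_nbhsr.
Unshelve. all: by end_near. Qed.

Let vN (y : R) : v (- y) = v y. Proof. by rewrite /v normrN. Qed.

Let v_pos (y : R) : 0 <= y -> v y = w y. Proof. by move=> y0; rewrite /v ger0_norm. Qed.

Let is_derive_even (f : R -> R) (d y : R) : (forall x, f (- x) = f x) ->
  is_derive (- y) 1 f d -> is_derive y 1 f (- d).
Proof.
move=> fN df; have -> : f = f \o -%R by apply/funext => x /=; rewrite fN.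
by rewrite -mulrN1; apply: is_derive1_comp.
Qed.

Let is_derive_v_pos (y : R) : 0 < y -> 0 < v y -> is_derive y 1 v (- slope y).
Proof.
move=> y0; rewrite /slope v_pos ?ltW// => wy.
have := is_derive_w y0 wy; apply: near_eq_is_derive.
by near=> t; rewrite v_pos// ltW//; near: t; exact: lt_nbhsr.
Unshelve. all: by end_near. Qed.

Let slopeN (y : R) : slope (- y) = slope y. Proof. by rewrite /slope vN. Qed.

Let continuous_slope (y : R) : 0 < v y -> {for y, continuous slope}.
Proof.
move=> vy; apply: continuousM.
  apply: (@continuous_comp _ _ _ v (fun s => s `^ (2 - b))); first exact: continuous_v.
  exact: continuous_powR.
apply: (@continuous_comp _ _ _ v (fun s => ell l s `^ p^-1)); first exact: continuous_v.
by apply: continuous_ell_powR; rewrite ?invr_gt0 ?(p_gt0 p1).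
Qed.

Let slope0 : slope 0 = 0.
Proof.
by rewrite /slope v_pos// w0 ell_ge1// [0 `^ _]powR0 ?mulr0// invr_eq0 gt_eqF ?(p_gt0 p1).
Qed.

(** As [slope 0 = 0], the two half-line formulas agree at the peak, where the even profile is
    differentiable with derivative 0. *)
Let dv (y : R) := - Num.sg y * slope y.

Let dv_pos (y : R) : 0 < y -> dv y = - slope y.
Proof. by move=> y0; rewrite /dv gtr0_sg// mulN1r. Qed.

Let dv_neg (y : R) : y < 0 -> dv y = slope y.
Proof. by move=> y0; rewrite /dv ltr0_sg// opprK mul1r. Qed.

Let v_near (y : R) : 0 < v y -> \forall z \near y, 0 < v z.
Proof. by move=> vy; exact: (cvgr_gt _ (@continuous_v y) _ vy). Qed.

Let is_derive_v_neq0 (y : R) : y != 0 -> 0 < v y -> is_derive y 1 v (dv y).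
Proof.
move=> y_neq0 vy; have [y0|y0|y_0] := ltgtP y 0; last by rewrite y_0 eqxx in y_neq0.
  rewrite dv_neg// -[slope y]opprK -slopeN; apply: is_derive_even; first exact: vN.
  by apply: is_derive_v_pos; rewrite ?oppr_gt0 ?vN.
by rewrite dv_pos//; exact: is_derive_v_pos.
Qed.

Let continuous_dv (y : R) : 0 < v y -> {for y, continuous dv}.
Proof.
move=> vy; rewrite /prop_for /continuous_at; have [y0|y0|y_0] := ltgtP y 0.
- have : {near y, slope =1 dv} by near=> z; rewrite dv_neg//; near: z; exact: lt_nbhsl.
  by move=> /near_eq_cvg/cvg_trans; rewrite dv_neg//; apply; exact: continuous_slope.
- have : {near y, (fun z => - slope z) =1 dv}.
    by near=> z; rewrite dv_pos//; near: z; exact: lt_nbhsr.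
  move=> /near_eq_cvg/cvg_trans; rewrite dv_pos//; apply.
  by apply: cvgN; exact: continuous_slope.
- rewrite y_0 in vy *; rewrite [dv 0]/dv sgr0 oppr0 mul0r.
  apply/cvgrPdist_lt => e e0.
  have /cvgrPdist_lt/(_ _ e0) := continuous_slope vy.
  rewrite slope0; apply: filterS => z; rewrite !sub0r !normrN; apply: le_lt_trans.
  rewrite /dv mulNr normrN normrM -[leRHS]mul1r ler_wpM2r//.
  by rewrite normr_sg; case: (_ == _).
Unshelve. all: by end_near. Qed.

Let is_derive_v (y : R) : 0 < v y -> is_derive y 1 v (dv y).
Proof.
move=> vy; have [y_0|y0] := eqVneq y 0; last exact: is_derive_v_neq0.
apply: is_derive_extend; [exact: continuous_v|exact: continuous_dv|].
near=> z => zy; apply: is_derive_v_neq0; first by rewrite -y_0.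
by near: z; exact: v_near.
Unshelve. all: by end_near. Qed.

Let v_le (y z : R) : 0 <= y -> y <= z -> v z <= v y.
Proof. by move=> y0 yz; rewrite !v_pos ?(le_trans y0)//; exact: w_nd. Qed.

Let v_small (d : R) : 0 < d <= 1 -> exists T : R, forall y, T < y -> v y < d.
Proof.
move=> d01; exists (Phi d) => y Ty.
have y0 : 0 <= y by rewrite (le_trans (Phi_ge0 d01))// ltW.
by rewrite ltNge v_pos// w_galois// -ltNge.
Qed.

Section Primitive.
Variables H f : R -> R.
Hypothesis dH : forall s : R, 0 < s < 1 ->
  is_derive s 1 H (s `^ (b - 2) * ell l s `^ (- p^-1) * f s).
Hypothesis cH : forall s : R, 0 < s -> {for s, continuous H}.
Hypothesis H_small : forall e : R, 0 < e ->
  exists2 d : R, 0 < d < 1 & forall s : R, 0 <= s <= d -> `|H s| < e.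
Hypothesis f0 : f 0 = 0.
Hypothesis f_ge0 : forall s : R, 0 <= s <= 1 -> 0 <= f s.
Hypothesis cfv : continuous (fun y => f (v y)).

Let H0 : H 0 = 0.
Proof.
apply/eqP; rewrite -normr_le0; apply/ler_addgt0Pr => e e0.
have [d /andP[d0 _] hd] := H_small e0; rewrite add0r ltW// hd//.
by rewrite lexx ltW.
Qed.

(** Primitive of [f(v)] on the right half-line, by the substitution [s = v(y)]: the derivative of
    [H] is [f] divided by the slope. *)
Let Tp y := H 1 - H (v y).

Let continuous_Tp : continuous Tp.
Proof.
move=> y; apply: (@continuousB _ _ _ (fun=> H 1) (H \o v)); first exact: cst_continuous.
have [vy|vy] := ltP 0 (v y).
  by apply: continuous_comp; [exact: continuous_v|exact: cH].
have vy0 : v y = 0 by apply/le_anti; rewrite vy v_ge0.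
apply/cvgrPdist_lt => e e0; have [d /andP[d0 _] hd] := H_small e0.
near=> z; rewrite /= vy0 H0 sub0r normrN; apply: hd; rewrite v_ge0/= ltW//.
by near: z; apply: (cvgr_lt _ (@continuous_v y)); rewrite vy0.
Unshelve. all: by end_near. Qed.

Let is_derive_Tp_pos (y : R) : 0 < y -> 0 < v y -> is_derive y 1 Tp (f (v y)).
Proof.
move=> y0 vy; have vy1 : v y < 1 by rewrite v_pos ?w_lt1// ltW.
have vy01 : 0 < v y < 1 by rewrite vy.
have e0 := ell_gt0 l vy vy1.
have dv_y := is_derive_v_pos y0 vy.
have := is_deriveN (is_derive1_comp (dH vy01) dv_y).
have -> : - (v y `^ (b - 2) * ell l (v y) `^ (- p^-1) * f (v y) * - slope y) = f (v y).
  rewrite /slope.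
  have E1 : v y `^ (b - 2) * v y `^ (2 - b) = 1.
    by rewrite -powR_add// -(opprB 2 b) addrC subrr powRr0.
  have E2 : ell l (v y) `^ (- p^-1) * ell l (v y) `^ p^-1 = 1.
    by rewrite -powR_add// addrC subrr powRr0.
  transitivity ((v y `^ (b - 2) * v y `^ (2 - b)) *
    (ell l (v y) `^ (- p^-1) * ell l (v y) `^ p^-1) * f (v y)); first by ring.
  by rewrite E1 E2 !mul1r.
move=> dHv; have := is_deriveD (is_derive_cst (H 1) y 1) dHv.
by rewrite add0r.
Qed.

Let is_derive_Tp_zero (z y : R) : 0 <= z -> z < y -> v z = 0 ->
  is_derive y 1 Tp (f (v y)).
Proof.
move=> z0 zy vz.
have v_out t : z <= t -> v t = 0.
  by move=> zt; apply/le_anti; rewrite v_ge0 andbT -vz v_le.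
rewrite v_out ?(ltW zy)// f0.
have := is_derive_cst (H 1) y 1; apply: near_eq_is_derive; near=> t.
rewrite /Tp v_out ?H0 ?subr0//; apply: ltW.
by near: t; exact: lt_nbhsr.
Unshelve. all: by end_near. Qed.

Let is_derive_Tp (y : R) : 0 < y -> is_derive y 1 Tp (f (v y)).
Proof.
move=> y0; have [vy|vy] := ltP 0 (v y); first exact: is_derive_Tp_pos.
have vy0 : v y = 0 by apply/le_anti; rewrite vy v_ge0.
(* If [v] vanishes at [y] but not before, [y] is the edge of the support: the two formulas hold on
   either side of it and are glued by continuity. *)
have [[z [z0 zy vz]]|nz] := pselect (exists z, [/\ 0 <= z, z < y & v z = 0]).
  exact: is_derive_Tp_zero zy vz.
apply: (@is_derive_extend _ (fun y => f (v y))); [exact: continuous_Tp|exact: cfv|].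
near=> z => zy; have z0 : 0 < z by near: z; exact: lt_nbhsr.
have [ltzy|] := ltP z y.
  apply: is_derive_Tp_pos => //; rewrite lt_neqAle v_ge0 andbT eq_sym.
  by apply/eqP => vz; apply: nz; exists z; rewrite ltW.
rewrite le_eqVlt eq_sym (negbTE zy)/= => ltyz.
exact: is_derive_Tp_zero (ltW y0) ltyz vy0.
Unshelve. all: by end_near. Qed.

(** Odd extension, a primitive on the whole line with limits [- H 1] and [H 1]. *)
Let T y := Num.sg y * Tp y.

Let Tp0 : Tp 0 = 0. Proof. by rewrite /Tp v_pos// w0 subrr. Qed.

Let TpN y : Tp (- y) = Tp y. Proof. by rewrite /Tp vN. Qed.

Let is_derive_T_neq0 (y : R) : y != 0 -> is_derive y 1 T (f (v y)).
Proof.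
move=> y_neq0; have [y0|y0|y_0] := ltgtP y 0; last by rewrite y_0 eqxx in y_neq0.
  have dTp : is_derive y 1 Tp (- f (v y)).
    apply: is_derive_even => //; rewrite -vN.
    by apply: is_derive_Tp; rewrite oppr_gt0.
  have := is_deriveN dTp; rewrite opprK; apply: near_eq_is_derive; near=> z.
  by rewrite /T ltr0_sg ?mulN1r//; near: z; exact: lt_nbhsl.
have := is_derive_Tp y0; apply: near_eq_is_derive; near=> z.
by rewrite /T gtr0_sg ?mul1r//; near: z; exact: lt_nbhsr.
Unshelve. all: by end_near. Qed.

Let is_derive_T (y : R) : is_derive y 1 T (f (v y)).
Proof.
have [y_0|y0] := eqVneq y 0; last exact: is_derive_T_neq0.
apply: (@is_derive_extend _ (fun y => f (v y))).
- rewrite y_0 /prop_for /continuous_at [T 0]/T sgr0 mul0r.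
  apply/cvgrPdist_lt => e e0.
  have /cvgrPdist_lt/(_ _ e0) := @continuous_Tp 0.
  rewrite Tp0; apply: filterS => z; rewrite !sub0r !normrN; apply: le_lt_trans.
  rewrite /T normrM -[leRHS]mul1r ler_wpM2r//.
  by rewrite normr_sg; case: (_ == _).
- exact: cfv.
- by near=> z => zy; apply: is_derive_T_neq0; rewrite -y_0.
Unshelve. all: by end_near. Qed.

Let cvg_Tp : Tp y @[y --> +oo] --> H 1.
Proof.
rewrite -[X in _ --> X]subr0; apply: cvgB; first exact: cvg_cst.
apply/cvgrPdist_lt => e e0; have [d /andP[d0 d1] hd] := H_small e0.
have d01 : 0 < d <= 1 by rewrite d0 ltW.
have [T0 hT0] := v_small d01.
near=> y; rewrite sub0r normrN; apply: hd; rewrite v_ge0/= ltW// hT0//.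
by near: y; apply: nbhs_pinfty_gt; rewrite num_real.
Unshelve. all: by end_near. Qed.

Let cvg_T : T y @[y --> +oo] --> H 1.
Proof.
apply: cvg_trans cvg_Tp; apply: near_eq_cvg; near=> y.
have y0 : 0 < y by near: y; exact: nbhs_pinfty_gt.
by rewrite /T gtr0_sg// mul1r.
Unshelve. all: by end_near. Qed.

Let cvg_TN : T y @[y --> -oo] --> - H 1.
Proof.
apply/cvgNy_compNP.
have -> : T \o -%R = fun y => - T y.
  by apply/funext => y; rewrite /T /= TpN sgrN mulNr.
exact: cvgN cvg_T.
Qed.

(** Used with [f s = s], [H = J] for the mass, and with [f s = s * ell l s], [H = G] for the entropy
    and Fisher integrals. *)
Lemma profile_integral x0 k : 0 < k ->
  mu.-integrable setT (EFin \o (fun x => f (w (`|x - x0| / k)))) /\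
  \int[mu]_x f (w (`|x - x0| / k)) = k * (2 * H 1).
Proof.
move=> k0.
have vE x : w (`|x - x0| / k) = v ((x - x0) / k).
  by rewrite /v normrM [`|k^-1|]ger0_norm// invr_ge0 ltW.
have -> : (fun x => f (w (`|x - x0| / k))) = fun x => f (v ((x - x0) / k)).
  by apply/funext => x; rewrite vE.
have [i e] := @ge0_integral_affine _ (fun y => f (v y)) T (- H 1) (H 1) x0 k k0
  (fun y => f_ge0 (introT andP (conj (v_ge0 y) (v_le1 y)))) cfv is_derive_T cvg_TN cvg_T.
split; first exact: i.
by rewrite e opprK; congr (_ * _); ring.
Qed.

End Primitive.

Let J s := ps * (zt * G s - Q s).

Let J1 : J 1 = ps * zt * G 1.
Proof. by rewrite /J gn_weight1// subr0 mulrA. Qed.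

Let J1_gt0 : 0 < J 1.
Proof.
have one01 : 0 < (1 : R) <= 1 by rewrite ltr01 lexx.
rewrite J1; apply: mulr_gt0; last exact: (weight_primitive_gt0 HG).
by apply: mulr_gt0; [exact: conj_exp_gt0|exact: zeta_min_gt0].
Qed.

Let J_small (e : R) : 0 < e ->
  exists2 d : R, 0 < d < 1 & forall s : R, 0 <= s <= d -> `|J s| < e.
Proof.
have [_ _ G0] := HG; have [ps0 z0] := (conj_exp_gt0 p1, zeta_min_gt0 p1 bl).
move=> e0; have ps2 : 0 < 2 * ps by apply: mulr_gt0.
have e1 : 0 < e / (2 * ps * zt) by apply: divr_gt0 => //; apply: mulr_gt0.
have e2 : 0 < e / (2 * ps) by apply: divr_gt0.
have [d /andP[d0 d1] hd] := G0 _ e1.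
have [d' /andP[d'0 _] hd'] := gn_weight_small p1 b0 bl e2.
exists (Num.min d d'); first by rewrite lt_min d0 d'0 gt_min d1.
move=> s /andP[s0]; rewrite le_min => /andP[sd sd'].
have {}hd := hd s; rewrite s0 sd in hd; have {hd}Gs := hd isT.
have {}hd' := hd' s; rewrite s0 sd' in hd'; have {hd'}Qs := hd' isT.
rewrite /J normrM gtr0_norm// mulrC -ltr_pdivlMr//.
rewrite (le_lt_trans (ler_normB _ _))// normrM [`|zt|]gtr0_norm//.
rewrite [`|Q s|]ger0_norm ?gn_weight_ge0//.
have -> : e / ps = zt * (e / (2 * ps * zt)) + e / (2 * ps).
  by field; rewrite (gt_eqF ps0) (gt_eqF z0).
by rewrite ltrD// ltr_pM2l.
Qed.

Let dJ (s : R) : 0 < s < 1 ->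
  is_derive s 1 J (s `^ (b - 2) * ell l s `^ (- p^-1) * s).
Proof.
have [dG _ _] := HG; move=> s01; have /andP[s0 _] := s01.
have -> : s `^ (b - 2) * ell l s `^ (- p^-1) * s = s `^ (b - 1) * ell l s `^ (- p^-1).
  rewrite mulrAC -[X in _ * X * _]powRr1 ?ltW// -powR_add//.
  by congr (_ `^ _ * _); ring.
exact: (is_derive_mass_primitive p1 s01 (dG _ s01)).
Qed.

Let cJ (s : R) : 0 < s -> {for s, continuous J}.
Proof.
have [_ cG _] := HG; move=> s0; apply: continuousM; first exact: cst_continuous.
apply: continuousB; last exact: continuous_gn_weight.
by apply: continuousM; [exact: cst_continuous|exact: cG].
Qed.

Let dG (s : R) : 0 < s < 1 ->
  is_derive s 1 G (s `^ (b - 2) * ell l s `^ (- p^-1) * (s * ell l s)).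
Proof.
have [dG _ _] := HG; move=> s01; have /andP[s0 s1] := s01.
have e0 := ell_gt0 l s0 s1; have := dG s s01; rewrite /gn_deriv.
have -> : s `^ (b - 1) = s `^ (b - 2) * s.
  by rewrite -[X in _ * X]powRr1 ?ltW// -powR_add//; congr (_ `^ _); ring.
have -> : ell l s `^ ps^-1 = ell l s `^ (- p^-1) * ell l s.
  rewrite -[X in _ * X]powRr1 ?ltW// -powR_add//; congr (_ `^ _).
  by rewrite conj_expV//; ring.
by congr is_derive; ring.
Qed.

Let cell : continuous (fun y => v y * ell l (v y)).
Proof.
move=> y; have [vy|vy] := ltP 0 (v y).
  apply: cvgM; first exact: continuous_v.
  by apply: (@continuous_comp _ _ _ v (ell l)); [exact: continuous_v|exact: continuous_ell].
have vy0 : v y = 0 by apply/le_anti; rewrite vy v_ge0.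
apply/cvgrPdist_lt => e e0.
have [|d /andP[d0 _] hd] := @powR_ell_small _ l 1 e ltr01 _ e0.
  by rewrite subrr.
near=> z; rewrite vy0 mul0r sub0r normrN ger0_norm ?mulr_ge0 ?ell_ge0//.
rewrite -[X in X * _](powRr1 (v_ge0 z)); apply: hd; rewrite v_ge0/= ltW//.
by near: z; apply: (cvgr_lt _ (@continuous_v y)); rewrite vy0.
Unshelve. all: by end_near. Qed.

Variables (x0 k : R).
Hypothesis k0 : 0 < k.
Local Notation z x := ((x - x0) / k).

Let wE x : w (`|x - x0| / k) = v (z x).
Proof. by rewrite /v normrM [`|k^-1|]ger0_norm// invr_ge0 ltW. Qed.

Let v_integral :
  mu.-integrable setT (EFin \o (fun x => v (z x))) /\
  \int[mu]_x v (z x) = k * (2 * J 1).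
Proof.
have [] := @profile_integral J id dJ cJ J_small erefl _ continuous_v x0 k k0.
  by move=> s /andP[].
by under [X in EFin \o X]eq_fun do rewrite wE;
  under eq_Rintegral do rewrite wE.
Qed.

Lemma profile_mass : \int[mu]_x w (`|x - x0| / k) = k * (2 * (ps * zt * G 1)).
Proof. by under eq_Rintegral do rewrite wE; rewrite v_integral.2 J1. Qed.

Let vell_integral :
  mu.-integrable setT (EFin \o (fun x => v (z x) * ell l (v (z x)))) /\
  \int[mu]_x (v (z x) * ell l (v (z x))) = k * (2 * G 1).
Proof.
have [_ cG G0] := HG.
have [] := @profile_integral G (fun s => s * ell l s) dG cG G0 _ _ cell x0 k k0.
- by rewrite mul0r.
- by move=> s /andP[s0 _]; rewrite mulr_ge0 ?ell_ge0.
by under [X in EFin \o X]eq_fun do rewrite wE;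
  under eq_Rintegral do rewrite wE.
Qed.

Definition profile_density x := w (`|x - x0| / k) / (2 * (k * (ps * zt * G 1))).
Local Notation rho := profile_density.
(** The maximum of [rho], as [v] has maximum 1. *)
Let m := (k * (2 * J 1))^-1.

Let kJ1 : 0 < k * (2 * J 1).
Proof. by apply: mulr_gt0 => //; apply: mulr_gt0. Qed.

Let m0 : 0 < m.
Proof. by rewrite invr_gt0 kJ1. Qed.

Let rhoE x : rho x = v (z x) * m.
Proof. by rewrite /rho wE /m J1 mulrCA. Qed.

Let crho : continuous rho.
Proof.
move=> x; have -> : rho = fun x => v (z x) * m by apply/funext => y; exact: rhoE.
apply: cvgM; last exact: cvg_cst.
apply: (@continuous_comp _ _ _ (fun x => z x) v); last exact: continuous_v.
apply: cvgM; last exact: cvg_cst.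
by apply: cvgB; [exact: cvg_id|exact: cvg_cst].
Qed.

Let rho_ge0 x : 0 <= rho x.
Proof. by rewrite rhoE mulr_ge0// ltW. Qed.

Let rho_gt0 x : (0 < rho x) = (0 < v (z x)).
Proof. by rewrite rhoE pmulr_lgt0. Qed.

Let drho x := dv (z x) / k * m.

Let is_derive_rho (x : R) : 0 < rho x -> is_derive x 1 rho (drho x).
Proof.
rewrite rho_gt0 => vx.
have -> : rho = fun x => v (z x) * m by apply/funext => y; exact: rhoE.
have dz : is_derive x 1 (fun x => z x) k^-1.
  by apply: is_derive_eq; rewrite /GRing.scale/=; ring.
have dvz := @is_derive1_comp _ v (fun x => z x) x _ _ (is_derive_v vx) dz.
apply: (is_derive_eq (is_deriveM dvz (is_derive_cst m x 1))).
by rewrite /GRing.scale/= /drho; ring.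
Qed.

Let mass : (\int[mu]_x (rho x)%:E = 1)%E.
Proof.
have [vi ve] := v_integral.
have ri : mu.-integrable setT (EFin \o rho).
  have := integrableZl measurableT m vi.
  by apply: eq_integrable => // x _; rewrite /= rhoE EFinM muleC.
have rint : \int[mu]_x rho x = 1.
  under eq_Rintegral do rewrite rhoE.
  rewrite RintegralZr// ve /m mulfV//.
  exact/lt0r_neq0/kJ1.
have := integrable_fin_num measurableT ri => /fineK <-.
by rewrite -[fine _]/(\int[mu]_x rho x) rint.
Qed.

Lemma profile_density_smooth : smooth_density rho.
Proof.
split; [exact: rho_ge0|exact: crho| |exact: mass].
move=> x rx; have dr := is_derive_rho rx; split; first by case: dr.
rewrite /prop_for /continuous_at derive1E (@derive_val _ _ _ _ _ _ _ dr).
have : {near x, drho =1 derive1 rho}.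
  near=> y; have ry : 0 < rho y.
    by near: y; exact: (cvgr_gt _ (@crho x) _ rx).
  by rewrite derive1E (@derive_val _ _ _ _ _ _ _ (is_derive_rho ry)).
move=> /near_eq_cvg/cvg_trans; apply.
apply: cvgM; last exact: cvg_cst.
apply: cvgM; last exact: cvg_cst.
apply: (@continuous_comp _ _ _ (fun x => z x) dv).
  apply: cvgM; last exact: cvg_cst.
  by apply: cvgB; [exact: cvg_id|exact: cvg_cst].
by apply: continuous_dv; rewrite -rho_gt0.
Unshelve. all: by end_near. Qed.

(** The equality case of Young's inequality: it makes the Fisher integrand a constant multiple of
    [v ell(v)], so that one integral gives both functionals. *)
Let abs_slope (y : R) : 0 < v y -> `|v y `^ (b - 2) * dv y| `^ p = ell l (v y).
Proof.
move=> vy; have p0 := p_gt0 p1.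
have sE : v y `^ (b - 2) * slope y = ell l (v y) `^ p^-1.
  rewrite /slope mulrA -powR_add// -(opprB 2 b) addrC subrr powRr0 mul1r//.
rewrite /dv mulrCA normrM sE (ger0_norm (powR_ge0 _ p^-1)).
rewrite normrN normr_sg; have [y0|y0] := eqVneq y 0.
  by rewrite y0 v_pos// w0 ell_ge1// mul0r powR0 ?gt_eqF.
by rewrite mul1r -powRrM mulVf ?gt_eqF// powRr1 ?ell_ge0.
Qed.

Let C := (m `^ (b - 1) / k) `^ p * m.

Let C_ge0 : 0 <= C. Proof. by rewrite mulr_ge0 ?powR_ge0// ltW. Qed.

Let fisherE x : fisher_integrand p b rho x = C * (v (z x) * ell l (v (z x))).
Proof.
have [vx|vx] := ltP 0 (v (z x)); last first.
  have v_0 : v (z x) = 0 by apply/le_anti; rewrite vx v_ge0.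
  by rewrite /fisher_integrand rhoE v_0 !(mul0r, mulr0).
have rx : 0 < rho x by rewrite rho_gt0.
rewrite (fisher_integrandE p b rx (is_derive_rho rx)) rhoE /drho.
have -> : (v (z x) * m) `^ (b - 2) * (dv (z x) / k * m) =
    (m `^ (b - 1) / k) * (v (z x) `^ (b - 2) * dv (z x)).
  rewrite powRM ?(ltW m0)//.
  have -> : m `^ (b - 1) = m `^ (b - 2) * m.
    by rewrite -[X in _ * X]powRr1 ?(ltW m0)// -powR_add//; congr (_ `^ _); ring.
  by ring.
rewrite normrM powRM// abs_slope// ger0_norm.
  by rewrite /C; ring.
by rewrite mulr_ge0 ?powR_ge0// invr_ge0 ltW.
Qed.

Let rho_le x : rho x <= m.
Proof. by rewrite rhoE ler_piMl// ltW. Qed.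

Let rho_m x : rho x / m = v (z x).
Proof. by rewrite rhoE mulfK// lt0r_neq0. Qed.

Lemma profile_density_domain : complexity_domain p b l rho.
Proof.
have [vi ve] := vell_integral; split; first exact: profile_density_smooth.
- apply/fisher_existsE => //.
  have := integrableZl measurableT C vi.
  by apply: eq_integrable => // x _; rewrite /= fisherE EFinM.
- apply/(renyi_existsP l0 rho_ge0 crho mass m0 rho_le).
  by move: vi; apply: eq_integrable => // x _; rewrite /= rho_m.
Qed.

Lemma profile_density_value (r0 : R) : 0 < r0 < 1 -> ell l r0 = (ps * zt)^-1 ->
  sqrt_complexity p b l rho * Q r0 = 2 * G 1.
Proof.
move=> r01 er0; have [vi ve] := vell_integral.
have [_ fishR renyiR] := profile_density_domain.
have [p0 ps0] := (p_gt0 p1, conj_exp_gt0 p1); have z0 := zeta_min_gt0 p1 bl.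
have one01 : 0 < (1 : R) <= 1 by rewrite ltr01 lexx.
have G1 : 0 < G 1 by exact: (weight_primitive_gt0 HG).
have I_E : \int[mu]_x fisher_integrand p b rho x = C * (k * (2 * G 1)).
  by under eq_Rintegral do rewrite fisherE; rewrite RintegralZl// ve.
have W_E : \int[mu]_x (rho x / m * ell l (rho x / m)) = k * (2 * G 1).
  by under eq_Rintegral do rewrite rho_m; exact: ve.
have kG0 : 0 < k * (2 * G 1) by apply: mulr_gt0 => //; apply: mulr_gt0.
have W_gt0 : 0 < \int[mu]_x (rho x / m * ell l (rho x / m)) by rewrite W_E.
have [] := renyi_mean l0 rho_ge0 crho mass m0 rho_le renyiR W_gt0.
set r := expR _ / m => r_01; rewrite W_E => er.
(* Unit mass fixes the height [m] in such a way that [ell r] is the critical value. *)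
have mG : m * (k * (2 * G 1)) = (ps * zt)^-1.
  rewrite /m J1; field.
  by rewrite (gt_eqF k0) (gt_eqF ps0) (gt_eqF z0) (gt_eqF G1).
have rr0 : r = r0.
  apply: (@ell_inj _ l).
  - by case/andP: r_01 => -> /ltW.
  - by case/andP: r01 => -> /ltW.
  - by rewrite er0 -mG.
rewrite /sqrt_complexity I_E /gn_weight er0 -mG.
have -> : r0 `^ b = expR (- (b * renyi_entropy l rho)) * m^-1 `^ b.
  have mV0 : 0 <= m^-1 by rewrite invr_ge0; exact: ltW m0.
  rewrite -rr0 /r (@powRM _ (expR _) m^-1 b (expR_ge0 _) mV0).
  rewrite (powRE _ (expR_gt0 _)) expRK.
  by rewrite mulrN.
have CE : C `^ p^-1 = m `^ (b - 1) / k * m `^ p^-1.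
  rewrite /C powRM ?powR_ge0 ?(ltW m0)// -powRrM mulfV ?(gt_eqF p0)// powRr1//.
  by rewrite mulr_ge0 ?powR_ge0// invr_ge0 ltW.
rewrite (@powRM _ C (k * (2 * G 1)) p^-1 C_ge0 (ltW kG0)) CE.
rewrite (@powRM _ m (k * (2 * G 1)) ps^-1 (ltW m0) (ltW kG0)).
have kGE : (k * (2 * G 1)) `^ p^-1 * (k * (2 * G 1)) `^ ps^-1 = k * (2 * G 1).
  rewrite -powR_add// conj_expV//.
  have -> : p^-1 + (1 - p^-1) = 1 by ring.
  by rewrite powRr1// ltW.
(* All powers of [m] cancel, as [b - 1 + 1/p - b + 1/ps = 0]. *)
have mE : m `^ (b - 1) * m `^ p^-1 * m^-1 `^ b * m `^ ps^-1 = 1.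
  rewrite -[m^-1]powR_inv1 ?(ltW m0)// -powRrM -!powR_add//.
  have -> : b - 1 + p^-1 + -1 * b + ps^-1 = 0 by rewrite conj_expV//; ring.
  by rewrite powRr0.
transitivity ((m `^ (b - 1) * m `^ p^-1 * m^-1 `^ b * m `^ ps^-1) *
  ((k * (2 * G 1)) `^ p^-1 * (k * (2 * G 1)) `^ ps^-1) / k *
  (expR (b * renyi_entropy l rho) * expR (- (b * renyi_entropy l rho)))); first by ring.
rewrite mE kGE -expRD subrr expR0 mulr1 mul1r.
by rewrite mulrAC mulfV ?mul1r// gt_eqF.
Qed.

End Candidate.

(** * Incomplete beta and gamma integrals *)

Section IncompleteIntegrals.
Context {R : realType}.
Variables p l : R.
Hypothesis p1 : 1 < p.
Notation ps := (conj_exp p).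
Local Notation mu := (@lebesgue_measure R).

(** The case [g = b - 1], of either sign, is [profile_primitive]; a positive [g] will serve for
    [weight_primitive], after integration by parts. *)
Definition psi_primitive (g : R) (Psi : R -> R) : Prop :=
  [/\ forall s : R, 0 < s < 1 ->
        is_derive s 1 Psi (- (s `^ (g - 1) * ell l s `^ (- p^-1))),
      forall s : R, 0 < s -> {for s, continuous Psi} & Psi 1 = 0].

Let a := ps^-1.
Let a0 : 0 < a. Proof. by rewrite invr_gt0 conj_exp_gt0. Qed.
Let aE : a - 1 = - p^-1. Proof. by rewrite /a conj_expV//; ring. Qed.

Section Gamma.
Variable c : R.

(** Incomplete gamma integral with a rate [c] of any sign: positive for the usual one, zero for the
    pure power, negative for arguments below 0. *)
Definition exp_integral x := \int[mu]_(t in `[0, x]) (t `^ (a - 1) * expR (- (c * t))).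

Let cexp : continuous (fun t : R => expR (- (c * t))).
Proof.
move=> t; apply: (@continuous_comp _ _ _ (fun t => - (c * t)) expR); last exact: continuous_expR.
by apply: continuousN; apply: continuousM; [exact: cst_continuous|exact: cvg_id].
Qed.

Let mexp : measurable_fun setT (fun t : R => expR (- (c * t))).
Proof. exact: continuous_measurable_fun. Qed.

Let exp_bound (x t : R) : 0 <= t <= x -> `|expR (- (c * t))| <= expR (`|c| * x).
Proof.
move=> /andP[t0 tx]; rewrite ger0_norm ?expR_ge0// ler_expR.
apply: (@le_trans _ _ (`|c| * t)); last by rewrite ler_wpM2l.
by rewrite (le_trans (ler_norm _))// normrN normrM (ger0_norm t0).
Qed.

Lemma exp_integral_le0 (x : R) : x <= 0 -> exp_integral x = 0.
Proof. exact: weighted_power_integral_le0. Qed.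

Lemma is_derive_exp_integral (x : R) : 0 < x ->
  is_derive x 1 exp_integral (x `^ (a - 1) * expR (- (c * x))).
Proof.
move=> x0; have x1 : x < x + 1 by rewrite ltrDl.
by apply: (is_derive_weighted_power_integral a0 mexp x0 x1 (exp_bound (x := x + 1))); exact: cexp.
Qed.

Lemma continuous_exp_integral : continuous exp_integral.
Proof.
move=> x; have [x0|x0|->] := ltgtP x 0.
- have : {near x, cst 0 =1 exp_integral}.
    by near=> y; rewrite exp_integral_le0// ltW//; near: y; exact: lt_nbhsl.
  move=> /near_eq_cvg/cvg_trans; apply.
  by rewrite exp_integral_le0 ?ltW//; exact: cvg_cst.
- exact: is_derive_continuous (is_derive_exp_integral x0).
- exact: (continuous_weighted_power_integral a0 mexp ltr01 (exp_bound (x := 1))).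
Unshelve. all: by end_near. Qed.

Lemma exp_integral_lt (x y : R) : 0 <= x -> x < y -> exp_integral x < exp_integral y.
Proof.
move=> x0 xy; apply: (@derive_gt0_lt _ _ (fun x => x `^ (a - 1) * expR (- (c * x)))) => //.
- by move=> t /andP[xt _]; apply: is_derive_exp_integral; exact: le_lt_trans xt.
- by move=> t _; exact: continuous_exp_integral.
- by move=> t /andP[xt _]; rewrite mulr_gt0 ?expR_gt0// powR_gt0// (le_lt_trans x0).
Qed.

Lemma exp_integral_ge0 (x : R) : 0 <= x -> 0 <= exp_integral x.
Proof.
rewrite le_eqVlt => /predU1P[<-|x0]; first by rewrite exp_integral_le0.
by rewrite -(exp_integral_le0 (lexx 0)) ltW// exp_integral_lt.
Qed.

End Gamma.

(** Both sides vanish at 0 and have the same derivative, which stands in for a change of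
    variables. *)
Lemma exp_integral_scale (c k x : R) : 0 < k -> 0 <= x ->
  exp_integral (k * c) x = k `^ (- a) * exp_integral c (k * x).
Proof.
move=> k0 x0; apply/eqP; rewrite -subr_eq0; apply/eqP.
have -> : 0 = exp_integral (k * c) 0 - k `^ (- a) * exp_integral c (k * 0).
  by rewrite mulr0 !exp_integral_le0// mulr0 subrr.
have ck : continuous (fun x : R => k * x).
  by move=> t; apply: cvgM; [exact: cvg_cst|exact: cvg_id].
apply/esym; apply: (@derive0_eq _
  (fun x => exp_integral (k * c) x - k `^ (- a) * exp_integral c (k * x))
  (fun x => x `^ (a - 1) * expR (- (k * c * x)) -
    k `^ (- a) * ((k * x) `^ (a - 1) * expR (- (c * (k * x))) * k))) => //.
- move=> t /andP[t0 _]; apply: is_deriveB; first exact: is_derive_exp_integral.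
  apply: is_deriveZ; have dk : is_derive t 1 (fun x : R => k * x) k.
    by apply: is_derive_eq; rewrite /GRing.scale/= mulr1.
  apply: (@is_derive1_comp _ (exp_integral c) (fun x => k * x)) => //.
  by apply: is_derive_exp_integral; rewrite mulr_gt0.
- move=> t _; apply: continuousB; first exact: continuous_exp_integral.
  apply: continuousM; first exact: cst_continuous.
  apply: (@continuous_comp _ _ _ (fun x => k * x) (exp_integral c)).
    exact: ck.
  exact: continuous_exp_integral.
- move=> t /andP[t0 _]; rewrite powRM ?ltW//.
  have kE : k `^ (- a) * k `^ (a - 1) * k = 1.
    rewrite -[X in _ * _ * X]powRr1 ?ltW// -!powR_add//.
    have -> : - a + (a - 1) + 1 = 0 by ring.
    by rewrite powRr0.
  have -> : c * (k * t) = k * c * t by ring.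
  transitivity (t `^ (a - 1) * expR (- (k * c * t)) *
    (1 - k `^ (- a) * k `^ (a - 1) * k)); first by ring.
  by rewrite kE subrr mulr0.
Qed.

Lemma exp_integral_0 (x : R) : 0 <= x -> exp_integral 0 x = ps * x `^ a.
Proof.
move=> x0; pose f y := exp_integral 0 y - ps * Num.max 0 y `^ a.
have f0 : f 0 = 0.
  by rewrite /f exp_integral_le0// maxxx powR0 ?mulr0 ?subrr// gt_eqF.
suff : f 0 = f x.
  by rewrite f0 /f (max_idPr x0) => /esym/eqP; rewrite subr_eq0 => /eqP.
apply: (@derive0_eq _ f
  (fun x => x `^ (a - 1) * expR (- (0 * x)) - ps * (a * x `^ (a - 1)))) => //.
- move=> t /andP[t0 _]; apply: is_deriveB; first exact: is_derive_exp_integral.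
  apply: is_deriveZ; have := is_derive1_powR a t0; apply: near_eq_is_derive.
  near=> y; rewrite (max_idPr _)// ltW//; near: y; exact: lt_nbhsr.
- move=> t _; apply: continuousB; first exact: continuous_exp_integral.
  by apply: continuousM; [exact: cst_continuous|exact: continuous_powR_ge0].
- move=> t _; rewrite mul0r oppr0 expR0 mulr1 mulrA mulfV ?mul1r ?subrr//.
  by rewrite gt_eqF// conj_exp_gt0.
Unshelve. all: by end_near. Qed.

(** Substitution [t = - ln s], which is [ell 1 s]. *)
Lemma psi_primitive_exp (g : R) : l = 1 ->
  psi_primitive g (fun s => exp_integral g (- ln s)).
Proof.
move=> l1; split.
- move=> s /andP[s0 s1]; have ls : 0 < - ln s by rewrite oppr_gt0 ln_lt0// s0.
  have dl : is_derive s 1 (fun s => - ln s) (- s^-1).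
    exact: (is_deriveN (is_derive1_ln s0)).
  have := @is_derive1_comp _ (exp_integral g) (fun s => - ln s) s _ _
    (is_derive_exp_integral g ls) dl.
  have -> : (- ln s) `^ (a - 1) * expR (- (g * - ln s)) * - s^-1 =
      - (s `^ (g - 1) * ell l s `^ (- p^-1)) => //.
  rewrite l1 ellE_1 ?s0 ?ltW// aE (mulrN g) opprK.
  by rewrite -(powRE g s0) (powR_add g (-1) s0) powR_inv1 ?(ltW s0)//; ring.
- move=> s s0; apply: (@continuous_comp _ _ _ (fun s => - ln s) (exp_integral g)).
    exact: is_derive_continuous (is_deriveN (is_derive1_ln s0)).
  exact: continuous_exp_integral.
- by rewrite ln1 oppr0 exp_integral_le0.
Qed.

Section Beta.
Variable q : R.

Let g (t : R) := (1 - t) `^ (q - 1).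

Let mg : measurable_fun setT g.
Proof.
apply: (@measurableT_comp _ _ _ _ _ _ (fun t : R => t `^ (q - 1))).
  exact: measurable_powR.
by apply: measurable_funB.
Qed.

Let g_bound (x t : R) : x < 1 -> 0 <= t <= x -> `|g t| <= 1 + (1 - x) `^ (q - 1).
Proof.
move=> x1 /andP[t0 tx]; have t1 : t < 1 := le_lt_trans tx x1.
rewrite /g ger0_norm ?powR_ge0//; have [q1|q1] := leP 0 (q - 1).
  have : (1 - t) `^ (q - 1) <= 1 `^ (q - 1).
    by apply: ge0_ler_powR; rewrite ?nnegrE//; lra.
  by rewrite powR1 => /le_trans; apply; rewrite lerDl powR_ge0.
have -> : q - 1 = - (1 - q) by ring.
have xt : (1 - x) `^ (1 - q) <= (1 - t) `^ (1 - q).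
  by apply: ge0_ler_powR; rewrite ?nnegrE; lra.
rewrite !powRN; apply: (@le_trans _ _ ((1 - x) `^ (1 - q))^-1); last by rewrite lerDr.
by rewrite lef_pV2 ?posrE ?powR_gt0 ?subr_gt0.
Qed.

Lemma inc_beta_le0 (x : R) : x <= 0 -> inc_beta a q x = 0.
Proof. exact: (@weighted_power_integral_le0 _ a g). Qed.

Lemma is_derive_inc_beta (x : R) : 0 < x < 1 ->
  is_derive x 1 (inc_beta a q) (x `^ (a - 1) * (1 - x) `^ (q - 1)).
Proof.
move=> /andP[x0 x1]; pose u := (1 + x) / 2.
have xu : x < u by rewrite /u; lra.
have u1 : u < 1 by rewrite /u; lra.
apply: (is_derive_weighted_power_integral a0 mg x0 xu (fun t => g_bound u1)).
apply: (@continuous_comp _ _ _ (fun t : R => 1 - t) (fun t => t `^ (q - 1))).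
  by apply: continuousB; [exact: cst_continuous|exact: cvg_id].
by apply: continuous_powR; rewrite subr_gt0.
Qed.

Lemma continuous_inc_beta (x : R) : x < 1 -> {for x, continuous (inc_beta a q)}.
Proof.
move=> x1; rewrite /prop_for /continuous_at; have [x0|x0|x_0] := ltgtP x 0.
- have : {near x, cst 0 =1 inc_beta a q}.
    by near=> y; rewrite inc_beta_le0// ltW//; near: y; exact: lt_nbhsl.
  move=> /near_eq_cvg/cvg_trans; apply.
  by rewrite inc_beta_le0 ?ltW//; exact: cvg_cst.
- by apply: (is_derive_continuous (is_derive_inc_beta _)); rewrite x0.
- rewrite x_0; have h0 : 0 < 2^-1 :> R by lra.
  have h1 : 2^-1 < 1 :> R by lra.
  exact: (continuous_weighted_power_integral a0 mg h0 (fun t => g_bound h1)).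
Unshelve. all: by end_near. Qed.

Lemma inc_beta_lt (x y : R) : 0 <= x -> x < y -> y < 1 -> inc_beta a q x < inc_beta a q y.
Proof.
move=> x0 xy y1.
apply: (@derive_gt0_lt _ _ (fun x => x `^ (a - 1) * (1 - x) `^ (q - 1))) => //.
- move=> t /andP[xt ty]; apply: is_derive_inc_beta.
  by rewrite (le_lt_trans x0 xt) (lt_trans ty).
- by move=> t /andP[_ ty]; apply: continuous_inc_beta; exact: le_lt_trans y1.
- move=> t /andP[xt ty]; rewrite mulr_gt0 ?powR_gt0 ?(le_lt_trans x0 xt)//.
  by rewrite subr_gt0 (lt_trans ty).
Qed.

End Beta.

(** Substitution [t = 1 - s^d]. For [l < 1] one has [ell = s^(-d) (1 - s^d) / d], and the factor
    [s^(-d)], raised to the power [- 1/p], accounts for the indicator term [1/p] in [q]. *)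
Lemma psi_primitive_beta (g : R) : 0 < l -> l != 1 -> let d := `|1 - l| in
  let q := g / d + (0 <= 1 - l)%R%:R / p in
  psi_primitive g (fun s => d `^ (- a) * inc_beta a q (1 - s `^ d)).
Proof.
move=> l0 l1 d q; have d0 : 0 < d by rewrite normr_gt0 subr_eq0 eq_sym.
have z1 (s : R) : 0 < s -> 1 - s `^ d < 1 by move=> s0; rewrite gtrBl powR_gt0.
split.
- move=> s /andP[s0 s1]; have s01 : 0 < s <= 1 by rewrite s0 ltW.
  have sd1 : s `^ d < 1.
    have := @gt0_ltr_powR _ d d0 s 1; rewrite powR1; apply; rewrite ?nnegrE//.
    exact: ltW.
  have zs : 0 < 1 - s `^ d < 1 by rewrite subr_gt0 sd1 z1.
  have dz : is_derive s 1 (fun s => 1 - s `^ d) (- (d * s `^ (d - 1))).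
    have := is_deriveB (is_derive_cst (1 : R) s 1) (is_derive1_powR d s0).
    by rewrite sub0r.
  have := is_deriveZ (d `^ (- a)) (@is_derive1_comp _ (inc_beta a q)
    (fun s => 1 - s `^ d) s _ _ (is_derive_inc_beta q zs) dz).
  have -> // : d `^ (- a) *: ((1 - s `^ d) `^ (a - 1) * (1 - (1 - s `^ d)) `^ (q - 1) *
      - (d * s `^ (d - 1))) = - (s `^ (g - 1) * ell l s `^ (- p^-1)).
  rewrite subKr -powRrM aE /GRing.scale/=.
  have dE : d `^ (- a) * d = d `^ p^-1.
    rewrite -[X in _ * X]powRr1 ?ltW// -powR_add//; congr (_ `^ _).
    by rewrite /a conj_expV//; ring.
  have eE : ell l s `^ (- p^-1) = (1 - s `^ d) `^ (- p^-1) * d `^ p^-1 *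
      s `^ (d * ((0 <= 1 - l)%R%:R / p)).
    have z0 : 0 <= 1 - s `^ d by rewrite ltW//; case/andP: zs.
    rewrite ellE_neq1//; have [l_lt1|l_gt1] := leP l 1; last first.
      have dl : d = l - 1 by rewrite /d distrC gtr0_norm// subr_gt0.
      rewrite [(0 <= _)%R]leNgt subr_lt0 l_gt1 mul0r mulr0 powRr0 mulr1 -dl.
      by rewrite powRM ?invr_ge0 ?(ltW d0)// -[d^-1]powR_inv1 ?ltW// -powRrM mulrNN mul1r.
    have dl : d = 1 - l by rewrite /d ger0_norm// subr_ge0.
    rewrite subr_ge0 l_lt1 mul1r.
    have -> : (1 - s `^ (l - 1)) / (l - 1) = (1 - s `^ d) * d^-1 * s `^ (- d).
      have -> : l - 1 = - d by rewrite dl opprB.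
      rewrite powRN; field.
      by rewrite (gt_eqF d0) gt_eqF ?powR_gt0.
    rewrite powRM ?mulr_ge0 ?invr_ge0 ?powR_ge0 ?(ltW d0)//.
    rewrite powRM ?invr_ge0 ?(ltW d0)// -[d^-1]powR_inv1 ?ltW// -!powRrM.
    by rewrite !mulrNN mul1r.
  rewrite eE.
  have sE : s `^ (d * (q - 1)) * s `^ (d - 1) =
      s `^ (g - 1) * s `^ (d * ((0 <= 1 - l)%R%:R / p)).
    rewrite -!powR_add//; congr (_ `^ _); rewrite /q; field.
    by rewrite (gt_eqF d0) (gt_eqF (p_gt0 p1)).
  transitivity (- ((1 - s `^ d) `^ (- p^-1) * (d `^ (- a) * d) *
    (s `^ (d * (q - 1)) * s `^ (d - 1)))); first by ring.
  by rewrite dE sE; ring.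
- move=> s s0; apply: continuousM; first exact: cst_continuous.
  apply: (@continuous_comp _ _ _ (fun s => 1 - s `^ d) (inc_beta a q)).
    by apply: continuousB; [exact: cst_continuous|exact: continuous_powR].
  by apply: continuous_inc_beta; exact: z1.
- by rewrite powR1 subrr inc_beta_le0// mulr0.
Qed.

End IncompleteIntegrals.

Section Construction.
Context {R : realType}.
Variables p b l : R.
Hypotheses (p1 : 1 < p) (b0 : 0 < b) (l0 : 0 < l).
Notation ps := (conj_exp p).
Hypothesis bl : 1 - b * ps < l.
Notation zt := (zeta_min p b l).
Notation Q := (gn_weight p b l).

Section PsiLimit.
Variables (g : R) (Psi : R -> R).
Hypotheses (g0 : 0 < g) (HPsi : psi_primitive p l g Psi).

Lemma psi_primitive_lt (s t : R) : 0 < s -> s < t -> t <= 1 -> Psi t < Psi s.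
Proof.
have [dPsi cPsi _] := HPsi; move=> s0 st t1; rewrite -ltrN2.
apply: (@derive_gt0_lt _ (fun x => - Psi x)
  (fun x => - - (x `^ (g - 1) * ell l x `^ (- p^-1)))) => //.
- move=> x /andP[sx xt]; apply: is_deriveN; apply: dPsi.
  by rewrite (lt_trans s0 sx) (lt_le_trans xt).
- by move=> x /andP[sx xt]; apply: continuousN; apply: cPsi; exact: lt_le_trans sx.
- move=> x /andP[sx xt]; have x0 := lt_trans s0 sx; have x1 := lt_le_trans xt t1.
  by rewrite opprK mulr_gt0 ?powR_gt0 ?ell_gt0.
Qed.

(** Below [h] the factor [ell^(-1/p)] is at most its value [c] at [h], and [c s^(g-1)] has the
    primitive [c s^g / g], bounded near 0 because [g > 0]. *)
Let psi_bounded : exists M, forall s : R, 0 < s <= 1 -> Psi s <= M.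
Proof.
have [dPsi cPsi _] := HPsi.
have [h h0 h1] : exists2 h : R, 0 < h & h < 1 by exists 2^-1; lra.
pose c := ell l h `^ (- p^-1).
have c0 : 0 <= c by exact: powR_ge0.
exists (Psi h + c * (h `^ g / g)) => s /andP[s0 s1].
have pg t : 0 <= c * (t `^ g / g).
  by rewrite mulr_ge0// divr_ge0 ?powR_ge0// ltW.
have [sh|hs] := ltP s h; last first.
  rewrite -[leLHS]addr0; apply: lerD => //.
  move: hs; rewrite le_eqVlt => /predU1P[->//|hs].
  by rewrite ltW// psi_primitive_lt.
apply: (@le_trans _ _ (Psi s + c * (s `^ g / g))); first by rewrite lerDl.
apply: (@derive_ge0_le _ (fun t => Psi t + c * (t `^ g / g))
  (fun t => - (t `^ (g - 1) * ell l t `^ (- p^-1)) + c * t `^ (g - 1))).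
- exact: ltW.
- move=> t /andP[st th]; have t0 := lt_trans s0 st.
  apply: is_deriveD; first by apply: dPsi; rewrite t0 (lt_trans th).
  apply: is_deriveZ; have dt := is_derive1_powR g t0.
  apply: is_derive_eq; rewrite /GRing.scale/=.
  by field; rewrite gt_eqF.
- move=> t /andP[st th]; have t0 := lt_le_trans s0 st.
  apply: continuousD; first exact: cPsi.
  apply: continuousM; first exact: cst_continuous.
  by apply: continuousM; [exact: continuous_powR|exact: cst_continuous].
- move=> t /andP[st th]; have t0 := lt_trans s0 st.
  have t1 := lt_trans th h1.
  have key : ell l t `^ (- p^-1) <= c.
    have et : ell l h <= ell l t by rewrite ltW// ell_lt// ltW.
    rewrite /c (powRN (ell l t) p^-1) (powRN (ell l h) p^-1).
    rewrite lef_pV2; last 2 first.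
    - by rewrite posrE powR_gt0// ell_gt0.
    - by rewrite posrE powR_gt0// ell_gt0.
    apply: ge0_ler_powR; rewrite ?nnegrE ?ell_ge0//.
    by rewrite invr_ge0 ltW// p_gt0.
  rewrite addrC subr_ge0 [leRHS]mulrC.
  by apply: ler_wpM2l; [exact: powR_ge0|exact: key].
Qed.

(** The limit of [Psi] at 0, that is, a complete beta or gamma integral up to a factor; as [Psi]
    decreases on []0, 1]], a supremum replaces the limit. *)
Definition psi_sup := sup [set Psi s | s in [set s : R | 0 < s <= 1]].

Let psi_has_sup : has_sup [set Psi s | s in [set s : R | 0 < s <= 1]].
Proof.
have [M hM] := psi_bounded; split.
  by exists (Psi 1), 1 => //=; rewrite ltr01 lexx.
by exists M => _ [s s01 <-]; exact: hM.
Qed.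

Lemma psi_le_sup (s : R) : 0 < s <= 1 -> Psi s <= psi_sup.
Proof. by move=> s01; apply: ub_le_sup; [case: psi_has_sup|exists s]. Qed.

Lemma psi_sup_near (e : R) : 0 < e ->
  exists2 d : R, 0 < d < 1 & forall s : R, 0 < s <= d -> psi_sup - e < Psi s.
Proof.
move=> e0; have [_ [t /andP[t0 t1] <-] Pt] := sup_adherent e0 psi_has_sup.
exists (t / 2); first by apply/andP; split; lra.
move=> s /andP[s0 st]; apply: (lt_trans Pt).
by apply: psi_primitive_lt => //; lra.
Qed.

End PsiLimit.

(** Integration by parts gives [zt G' = Q' + s^(b-1) ell^(-1/p) / ps] and also
    [b G' = Q' + s^(b+l-2) ell^(-1/p) / ps]. The first is used for [l <= 1] and the second for
    [l > 1]: the resulting exponent is positive, and for [l != 1] the beta function has the second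
    argument of the explicit bound. *)
Definition dual_exponent := b + Num.max (l - 1) 0.
Definition dual_coef := if l <= 1 then zt else b.

Lemma dual_exponent_gt0 : 0 < dual_exponent.
Proof. by rewrite ltr_wpDr// le_max lexx orbT. Qed.

Lemma dual_coef_gt0 : 0 < dual_coef.
Proof. by rewrite /dual_coef; case: ifP => // _; exact: zeta_min_gt0. Qed.

Variable Psi : R -> R.
Hypothesis HPsi : psi_primitive p l dual_exponent Psi.
Let B := psi_sup Psi.

(* Integrating by parts reduces [G] to a primitive of [s^(g-1) ell^(-1/p)], where
   [g = dual_exponent], which is an incomplete beta or gamma integral. *)
Definition weight_of_psi (s : R) : R :=
  if 0 < s then ((B - Psi s) / ps + Q s) / dual_coef else 0.

Lemma weight_of_psi1 : weight_of_psi 1 = B / (ps * dual_coef).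
Proof.
have [_ _ Psi1] := HPsi; rewrite /weight_of_psi ltr01 Psi1 subr0 gn_weight1// addr0.
by rewrite (invfM ps) mulrA.
Qed.

Lemma weight_of_psi_primitive : weight_primitive p b l weight_of_psi.
Proof.
have [dPsi cPsi Psi1] := HPsi; have ps0 := conj_exp_gt0 p1.
have k0 := dual_coef_gt0; have ge0 := dual_exponent_gt0.
split.
- move=> s s01; have /andP[s0 s1] := s01; have e0 := ell_gt0 l s0 s1.
  have d1 : is_derive s 1 (fun s => B - Psi s)
      (s `^ (dual_exponent - 1) * ell l s `^ (- p^-1)).
    have := is_deriveB (is_derive_cst B s 1) (dPsi _ s01).
    by rewrite sub0r opprK.
  have d2 := is_derive_gn_weight b l p1 s01.
  have d3 : is_derive s 1 (fun s => ((B - Psi s) / ps + Q s) / dual_coef)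
     ((s `^ (dual_exponent - 1) * ell l s `^ (- p^-1) / ps + dgn_weight p b l s) / dual_coef).
    apply: is_derive_eq; rewrite /GRing.scale/=; ring.
  have -> : gn_deriv p b l s = (s `^ (dual_exponent - 1) * ell l s `^ (- p^-1) / ps +
      dgn_weight p b l s) / dual_coef.
    have eE : ell l s `^ ps^-1 = ell l s `^ (- p^-1) * ell l s.
      rewrite -[X in _ * X]powRr1 ?ltW// -powR_add//; congr (_ `^ _).
      by rewrite conj_expV//; ring.
    apply: (mulIf (lt0r_neq0 k0)); rewrite divfK ?(lt0r_neq0 k0)//.
    rewrite /gn_deriv /dgn_weight eE /dual_exponent /dual_coef.
    have [l1|l1] := leP l 1.
      by rewrite (max_idPr _) ?subr_le0// addr0; ring.
    rewrite (max_idPl _) ?subr_ge0 ?ltW//.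
    (* For [l > 1] the identity [s^(l-1) = 1 - (l-1) ell] turns the coefficient [zt] into [b]. *)
    have -> : b + (l - 1) - 1 = (b - 1) + (l - 1) by ring.
    have s01' : 0 < s <= 1 by rewrite s0 ltW.
    rewrite (powR_add (b - 1) (l - 1) s0) (powR_ell l s01') /zeta_min.
    by ring.
  move: d3; apply: near_eq_is_derive; near=> t.
  by rewrite /weight_of_psi ifT//; near: t; exact: lt_nbhsr.
- move=> s s0; rewrite /prop_for /continuous_at.
  have : {near s, (fun s => ((B - Psi s) / ps + Q s) / dual_coef) =1 weight_of_psi}.
    by near=> t; rewrite /weight_of_psi ifT//; near: t; exact: lt_nbhsr.
  move=> /near_eq_cvg/cvg_trans; apply; rewrite /weight_of_psi ifT//.
  apply: cvgM; last exact: cvg_cst.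
  apply: cvgD; last exact: continuous_gn_weight.
  apply: cvgM; last exact: cvg_cst.
  by apply: cvgB; [exact: cvg_cst|exact: cPsi].
- move=> e e0; have ek : 0 < e * dual_coef by apply: mulr_gt0.
  have e1 : 0 < e * dual_coef * ps / 2 by apply: divr_gt0 => //; apply: mulr_gt0.
  have e2 : 0 < e * dual_coef / 2 by apply: divr_gt0.
  have [d /andP[d0 d1] hd] := psi_sup_near ge0 HPsi e1.
  have [d' /andP[d'0 _] hd'] := gn_weight_small p1 b0 bl e2.
  exists (Num.min d d'); first by rewrite lt_min d0 d'0 gt_min d1.
  (* At [s = 0] the default value 0 of [weight_of_psi] is what is required. *)
  move=> s /andP[]; rewrite le_eqVlt => /predU1P[<-|s0].
    by rewrite /weight_of_psi ltxx normr0.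
  rewrite le_min => /andP[sd sd'].
  have {}hd := hd s; rewrite s0 sd in hd; have {hd}Ps := hd isT.
  have {}hd' := hd' s; rewrite (ltW s0) sd' in hd'; have {hd'}Qs := hd' isT.
  have s01 : 0 < s <= 1 by rewrite s0 (le_trans sd)// ltW.
  have Bs := psi_le_sup ge0 HPsi s01.
  have Q0 := gn_weight_ge0 p b l s.
  have BP : 0 <= (B - Psi s) / ps by rewrite divr_ge0 ?subr_ge0// ltW.
  rewrite /weight_of_psi s0 ger0_norm; last first.
    by rewrite divr_ge0 ?addr_ge0// ltW.
  rewrite ltr_pdivrMr//.
  have : (B - Psi s) / ps < e * dual_coef / 2.
    by rewrite ltr_pdivrMr//; rewrite -/B in Ps; lra.
  by lra.
Unshelve. all: by end_near. Qed.

End Construction.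

(** * The complex incomplete gamma function *)

Section GammaBridge.
Context {R : realType}.
Local Notation mu := (@lebesgue_measure R).
Local Notation C := (@Complex R).

Lemma ge0_integral_reflect (h : R -> R) (v : R) :
  measurable_fun setT h -> (forall t, 0 <= h t) ->
  (\int[mu]_(t in `[(- v)%R, 0%R]) (h (- t)%R)%:E = \int[mu]_(t in `[0%R, v]) (h t)%:E)%E.
Proof.
move=> mh h0.
have -> : `[(- v)%R, 0%R]%classic = (-%R : _ -> measurableTypeR R) @^-1` `[0%R, v].
  by apply/seteqP; split => t /=; rewrite !in_itv/= oppr_ge0 lerNl andbC.
have moppr : measurable_fun setT (-%R : measurableTypeR R -> measurableTypeR R).
  exact: oppr_measurable.
have mh' : @measurable_fun _ _ (measurableTypeR R) _ `[0%R, v] (EFin \o h).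
  by apply/measurable_EFinP; exact: measurable_funTS.
have := @ge0_integral_pushforward _ _ (measurableTypeR R) (measurableTypeR R) R -%R
  moppr mu `[0%R, v]%classic (EFin \o h) (measurable_itv _) mh' (fun y _ => h0 y).
move=> <-; apply: eq_measure_integral => /= A mA _.
by have := @lebesgue_measureN R A mA.
Qed.

Lemma cpow_ge0 (t r : R) : 0 <= t -> cpow t r = C (t `^ r) 0.
Proof. by move=> t0; rewrite /cpow t0 mulr0 cos0 sin0 mulr1 mulr0 ger0_norm. Qed.

Lemma cpow_lt0 (t r : R) : t < 0 ->
  cpow t r = C ((- t) `^ r * cos (r * pi)) ((- t) `^ r * sin (r * pi)).
Proof. by move=> t0; rewrite /cpow leNgt t0/= ltr0_norm. Qed.

Lemma mul_real_complex (x y z : R) :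
  C x y * real_complex R z = C (x * z) (y * z) :> R[i].
Proof. by apply/eqP; rewrite eq_complex /= !mulr0 subr0 add0r !eqxx. Qed.

Variable p : R.
Hypothesis p1 : 1 < p.
Notation ps := (conj_exp p).
Let a := ps^-1.
Let a0 : 0 < a. Proof. by rewrite invr_gt0 conj_exp_gt0. Qed.
Let a1 : a < 1.
Proof. by rewrite /a conj_expV// gtrBl invr_gt0 p_gt0. Qed.

Let integrand_ge0 (t : R) : 0 <= t ->
  cpow t (a - 1) * real_complex R (expR (- t)) = C (t `^ (a - 1) * expR (- t)) 0.
Proof. by move=> t0; rewrite cpow_ge0// mul_real_complex mul0r. Qed.

Let integrand_lt0 (t : R) : t < 0 ->
  cpow t (a - 1) * real_complex R (expR (- t)) =
  C ((- t) `^ (a - 1) * expR (- t) * cos ((a - 1) * pi))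
    ((- t) `^ (a - 1) * expR (- t) * sin ((a - 1) * pi)).
Proof.
by move=> t0; rewrite cpow_lt0// mul_real_complex; congr C; rewrite mulrAC.
Qed.

Lemma inc_gamma_ge0 (x : R) : 0 <= x -> inc_gamma a x = C (exp_integral p 1 x) 0.
Proof.
move=> x0; rewrite /inc_gamma /oriented_integral x0; congr C.
  apply: eq_Rintegral => t tx.
  have t0 : 0 <= t by move: tx; rewrite inE/= in_itv/= => /andP[].
  by rewrite integrand_ge0//= mul1r.
rewrite (_ : \int[_]_(_ in _) _ = \int[mu]_(t in `[0, x]) (cst 0 t)).
  by rewrite /Rintegral integral0.
apply: eq_Rintegral => t tx.
  have t0 : 0 <= t by move: tx; rewrite inE/= in_itv/= => /andP[].
by rewrite integrand_ge0.
Qed.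

Let reflected (x k : R) : x < 0 ->
  \int[mu]_(t in `[x, 0]) ((- t) `^ (a - 1) * expR (- t) * k) =
  k * exp_integral p (-1) (- x).
Proof.
move=> x0; have x0' : 0 < - x by rewrite oppr_gt0.
pose h (t : R) := t `^ (a - 1) * expR (- (-1 * t)).
have cexp : continuous (fun t : R => expR (- (-1 * t))).
  move=> t; apply: (@continuous_comp _ _ _ (fun t : R => - (-1 * t)) expR); last exact: continuous_expR.
  by apply: continuousN; apply: continuousM; [exact: cst_continuous|exact: cvg_id].
have mexp : measurable_fun setT (fun t : R => expR (- (-1 * t))).
  exact: continuous_measurable_fun.
have mh : measurable_fun setT h.
  by apply: measurable_funM; [exact: measurable_powR|exact: mexp].
have mhN : measurable_fun setT (h \o -%R).
  have mN : measurable_fun setT (-%R : R -> R) by exact: oppr_measurable.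
  exact: (measurableT_comp mh mN).
have h0 t : 0 <= h t by rewrite mulr_ge0 ?powR_ge0 ?expR_ge0.
have E := ge0_integral_reflect (- x) mh h0; rewrite opprK in E.
have hb (t : R) : 0 <= t <= - x -> `|expR (- (-1 * t))| <= expR (- x).
  by move=> /andP[_ tx]; rewrite ger0_norm ?expR_ge0// ler_expR; lra.
have hi : mu.-integrable `[0, - x] (EFin \o h).
  exact: (integrable_powR_mul a0 mexp x0' hb).
have hi' : mu.-integrable `[x, 0] (EFin \o (h \o -%R)).
  apply/integrableP; split.
    apply/measurable_EFinP; apply: measurable_funTS.
    exact: mhN.
  have /integrableP[_] := hi.
  under eq_integral do rewrite /= ger0_norm//.
  by rewrite -E; under [in X in _ -> X]eq_integral do rewrite /= ger0_norm//.
transitivity (\int[mu]_(t in `[x, 0]) ((h \o -%R) t * k)).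
  by apply: eq_Rintegral => t _; rewrite /h/= mulN1r opprK.
rewrite RintegralZr// mulrC; congr (_ * _).
by rewrite /exp_integral /Rintegral/= -E.
Qed.

(** The integrand has constant phase [(a - 1) pi] on the negative axis, and the reversed orientation
    adds [pi], so the values lie on the half-line of direction [exp(i a pi)]. *)
Lemma inc_gamma_lt0 (x : R) : x < 0 -> inc_gamma a x =
  C (cos (a * pi) * exp_integral p (-1) (- x)) (sin (a * pi) * exp_integral p (-1) (- x)).
Proof.
move=> x0; have nx : (0 <= x) = false by apply/negbTE; rewrite -ltNge.
rewrite /inc_gamma /oriented_integral !(ifF _ _ nx).
(* The endpoint 0 has another phase but contributes 0: [powR] gives it the value 0, the exponent
   [a - 1] being nonzero. *)
have E0 : (0 : R) `^ (a - 1) = 0 by rewrite powR0// subr_eq0 lt_eqF.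
have aE : a * pi = (a - 1) * pi + pi by ring.
congr C.
- rewrite aE cosDpi mulNr -(reflected _ x0); congr (- _).
  apply: eq_Rintegral => t tx.
  have : t <= 0 by move: tx; rewrite inE/= in_itv/= => /andP[].
  rewrite le_eqVlt => /predU1P[->|t0].
    by rewrite integrand_ge0//= oppr0 E0 !mul0r.
  by rewrite integrand_lt0.
- rewrite aE sinDpi mulNr -(reflected _ x0); congr (- _).
  apply: eq_Rintegral => t tx.
  have : t <= 0 by move: tx; rewrite inE/= in_itv/= => /andP[].
  rewrite le_eqVlt => /predU1P[->|t0].
    by rewrite integrand_ge0//= oppr0 E0 !mul0r.
  by rewrite integrand_lt0.
Qed.

End GammaBridge.

Section EulerLimits.
Context {R : realType}.

(** The monotone limit is taken in the extended reals, since a complete beta integral may be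
    infinite. *)
Lemma cvg_at_left_ereal_sup (f : R -> R) :
  (forall x y : R, 0 <= x -> x < y -> y < 1 -> f x < f y) ->
  (f x)%:E @[x --> (1 : R)^'-] --> ereal_sup [set (f x)%:E | x in [set x : R | 0 <= x < 1]].
Proof.
move=> f_lt; set S := image _ _.
have S0 : S (f 0)%:E by exists 0 => //=; rewrite lexx ltr01.
have above (x : R) : 0 <= x < 1 -> ((f x)%:E <= ereal_sup S)%E.
  by move=> x01; apply: ereal_sup_ubound; exists x.
have near_above (t : R) : 0 <= t < 1 -> \forall x \near (1 : R)^'-, f t <= f x /\ 0 <= x < 1.
  move=> /andP[t0 t1]; near=> x.
  have tx : t < x by near: x; exact: nbhs_left_gt.
  have x1 : x < 1 by near: x; exact: nbhs_left_lt.
  by split; [rewrite ltW// f_lt|rewrite x1 (le_trans t0)// ltW].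
case E : (ereal_sup S) => [M| |].
- apply: cvg_EFin; first by apply: nearW => x.
  apply/cvgrPdist_lt => e e0.
  have Sfin : ereal_sup S \is a fin_num by rewrite E.
  have [_ [t t01 <-]] := ub_ereal_sup_adherent e0 Sfin.
  rewrite E -EFinB lte_fin => Mt.
  near=> x => /=; have [tx x01] : f t <= f x /\ 0 <= x < 1.
    by near: x; exact: near_above.
  have := above x x01; rewrite E lee_fin => xM.
  by rewrite ger0_norm ?subr_ge0//; lra.
- apply/cvgeyPge => A; have [_ [t t01 <-] At] : exists2 y, S y & (A%:E < y)%E.
    by apply/ereal_sup_gt; rewrite E ltry.
  near=> x; have [tx _] : f t <= f x /\ 0 <= x < 1 by near: x; exact: near_above.
  by rewrite lee_fin (le_trans _ tx)// -lee_fin ltW.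
- by have := ereal_sup_ubound S0; rewrite E.
Unshelve. all: by end_near. Qed.

Lemma sup_approx (A : set R) (M : R) : (forall x, A x -> x <= M) ->
  (forall e : R, 0 < e -> exists2 x, A x & M - e < x) -> sup A = M.
Proof.
move=> AM Ae; have [y Ay _] := Ae 1 ltr01.
have hA : has_sup A by split; [exists y|exists M].
apply/le_anti/andP; split; first by apply: ge_sup => //; exists y.
apply/ler_addgt0Pr => e e0; have [x Ax Mx] := Ae e e0.
have := ub_le_sup hA.2 Ax; lra.
Qed.

Variable p : R.
Hypothesis p1 : 1 < p.
Notation ps := (conj_exp p).
Let a := ps^-1.

Section Beta.
Variable q : R.

Let euler_betaE :
  euler_beta a q = ereal_sup [set (inc_beta a q x)%:E | x in [set x : R | 0 <= x < 1]].
Proof. by apply: cvg_lim => //; apply: cvg_at_left_ereal_sup; exact: inc_beta_lt. Qed.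

Lemma inc_beta_le_euler (x : R) : 0 <= x < 1 -> ((inc_beta a q x)%:E <= euler_beta a q)%E.
Proof. by move=> x01; rewrite euler_betaE; apply: ereal_sup_ubound; exists x. Qed.

(** The correspondence [x = 1 - s^d] matches the two suprema, and [g > 0] makes the second one
    finite. *)
Lemma euler_beta_psi (l g : R) : 0 < l -> l != 1 -> 0 < g ->
  q = g / `|1 - l| + (0 <= 1 - l)%R%:R / p ->
  let Psi := fun s => `|1 - l| `^ (- a) * inc_beta a q (1 - s `^ `|1 - l|) in
  euler_beta a q = (`|1 - l| `^ a * psi_sup Psi)%:E.
Proof.
move=> l0 l1 g0 qE Psi; have d0 : 0 < `|1 - l| by rewrite normr_gt0 subr_eq0 eq_sym.
have HPsi : psi_primitive p l g Psi by rewrite /Psi qE; exact: psi_primitive_beta.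
move: @Psi HPsi d0; set d := `|1 - l| => Psi HPsi d0.
have da0 : 0 < d `^ a by exact: powR_gt0.
have PsiE s : inc_beta a q (1 - s `^ d) = d `^ a * Psi s.
  by rewrite /Psi mulrA (powRN d a) mulfV ?mul1r// lt0r_neq0.
rewrite euler_betaE; apply/le_anti/andP; split.
- apply: ge_ereal_sup => _ [x /andP[x0 x1] <-]; rewrite lee_fin.
  have x1' : 0 < 1 - x by rewrite subr_gt0.
  pose s := (1 - x) `^ d^-1.
  have sd : s `^ d = 1 - x by rewrite /s -powRrM mulVf ?powRr1 ?ltW// lt0r_neq0.
  have -> : x = 1 - s `^ d by rewrite sd; ring.
  rewrite PsiE (ler_pM2l da0); apply: (psi_le_sup p1 g0 HPsi).
  rewrite powR_gt0//=.
  have := @ge0_ler_powR _ d^-1 _ (1 - x) 1; rewrite powR1; apply; rewrite ?nnegrE.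
  + by rewrite invr_ge0 ltW.
  + exact: ltW.
  + by [].
  + by lra.
- apply/lee_addgt0Pr => e e0.
  have e1 : 0 < e / d `^ a by apply: divr_gt0.
  have [s /andP[s0 s1] hs] := psi_sup_near p1 g0 HPsi e1.
  have {}hs : psi_sup Psi - e / d `^ a < Psi s by apply: hs; rewrite s0 lexx.
  apply: (@le_trans _ _ ((inc_beta a q (1 - s `^ d))%:E + e%:E)%E); last first.
    apply: leeD => //; apply: ereal_sup_ubound; exists (1 - s `^ d) => //=.
    rewrite subr_ge0 gtrBl powR_gt0// andbT.
    have := @ge0_ler_powR _ d (ltW d0) s 1; rewrite powR1; apply; rewrite ?nnegrE//.
    + exact: ltW.
    + exact: ltW.
  rewrite -EFinD lee_fin PsiE -lerBlDr -[X in _ - X](divfK (lt0r_neq0 da0)).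
  by rewrite [X in _ - X]mulrC -mulrBr (ler_pM2l da0) ltW.
Qed.

End Beta.

Let exp_integral_nd : {homo (exp_integral p (1 : R)) : x y / x <= y}.
Proof.
move=> x y; rewrite le_eqVlt => /predU1P[->//|xy].
have [x0|x0] := leP 0 x; first by rewrite ltW// exp_integral_lt.
rewrite (exp_integral_le0 p 1 (ltW x0)); have [y0|y0] := leP 0 y.
  exact: exp_integral_ge0.
by rewrite (exp_integral_le0 p 1 (ltW y0)).
Qed.

(** Convergence of the gamma integral is the boundedness of [Psi] for [l = 1], [g = 1]. *)
Let exp_integral_ub (x : R) : exp_integral p 1 x <= psi_sup (fun s => exp_integral p 1 (- ln s)).
Proof.
have HPsi := psi_primitive_exp p1 1 (erefl (1 : R)).
apply: (@le_trans _ _ (exp_integral p 1 (Num.max 0 x))).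
  by apply: exp_integral_nd; rewrite le_max lexx orbT.
have -> : Num.max 0 x = - ln (expR (- Num.max 0 x)) by rewrite expRK opprK.
apply: (psi_le_sup p1 ltr01 HPsi (s := expR (- Num.max 0 x))).
by rewrite expR_gt0 -expR0 ler_expR oppr_le0 le_max lexx.
Qed.

Let euler_gammaE : euler_gamma a = sup (range (exp_integral p 1)).
Proof.
apply: cvg_lim => //; apply: (cvg_trans _ (@nondecreasing_cvgr _ _ exp_integral_nd _)).
  apply: near_eq_cvg; near=> x; have x0 : 0 <= x by near: x; exact: nbhs_pinfty_ge.
  by rewrite inc_gamma_ge0.
by exists (psi_sup (fun s => exp_integral p 1 (- ln s))) => _ [x _ <-]; exact: exp_integral_ub.
Unshelve. all: by end_near. Qed.

Let has_sup_exp : has_sup (range (exp_integral p (1 : R))).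
Proof.
split; first by exists (exp_integral p 1 0), 0.
by exists (psi_sup (fun s => exp_integral p 1 (- ln s))) => _ [x _ <-]; exact: exp_integral_ub.
Qed.

Lemma exp_integral_lt_euler (x : R) : 0 <= x -> exp_integral p 1 x < euler_gamma a.
Proof.
move=> x0; have x1 : x < x + 1 by rewrite ltrDl.
apply: (lt_le_trans (exp_integral_lt p1 1 x0 x1)); rewrite euler_gammaE.
by apply: ub_le_sup; [exact: has_sup_exp.2|exists (x + 1)].
Qed.

Lemma exp_integral_onto (y : R) : 0 <= y < euler_gamma a ->
  exists2 x, 0 <= x & exp_integral p 1 x = y.
Proof.
move=> /andP[y0]; rewrite euler_gammaE => /(sup_gt _)[|_ [t _ <-] yt].
  by exists (exp_integral p 1 0), 0.
have t0 : 0 <= t.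
  by rewrite leNgt; apply/negP => t0; move: yt; rewrite (exp_integral_le0 p 1 (ltW t0)) ltNge y0.
have [|x /andP[x0 _] <-] := @intermediate_value _ (exp_integral p 1) 0 t y t0
  (fun x _ => @continuous_exp_integral _ _ p1 1 x).
  by rewrite exp_integral_le0// y0 ltW.
by exists x.
Qed.

Lemma psi_sup_exp (b : R) : 0 < b ->
  psi_sup (fun s => exp_integral p b (- ln s)) = b `^ (- a) * euler_gamma a.
Proof.
move=> b0; have ba0 : 0 < b `^ (- a) by exact: powR_gt0.
have scale (x : R) : 0 <= x -> exp_integral p b x = b `^ (- a) * exp_integral p 1 (b * x).
  by move=> x0; rewrite -exp_integral_scale// mulr1.
apply: sup_approx.
- move=> _ [s /andP[s0 s1] <-]; have ls : 0 <= - ln s by rewrite oppr_ge0 ln_le0.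
  rewrite scale// ler_wpM2l ?(ltW ba0)// ltW// exp_integral_lt_euler//.
  by apply: mulr_ge0 => //; exact: ltW.
- move=> e e0; have e1 : 0 < e / b `^ (- a) by apply: divr_gt0.
  have [_ [t _ <-]] := sup_adherent e1 has_sup_exp; rewrite -euler_gammaE => Et.
  pose t' := Num.max 0 t.
  have t'0 : 0 <= t' by rewrite le_max lexx.
  have tt' : exp_integral p 1 t <= exp_integral p 1 t'.
    by apply: exp_integral_nd; rewrite le_max lexx orbT.
  have tb0 : 0 <= t' / b by apply: divr_ge0 => //; exact: ltW.
  exists (exp_integral p b (t' / b)).
    exists (expR (- (t' / b))) => /=; last by rewrite expRK opprK.
    by rewrite expR_gt0 -expR0 ler_expR oppr_le0.
  rewrite scale// [b * _]mulrC divfK ?(lt0r_neq0 b0)//.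
  rewrite -[X in _ - X](divfK (lt0r_neq0 ba0)) [X in _ - X]mulrC -mulrBr.
  by rewrite ltr_pM2l// (lt_le_trans Et).
Qed.

End EulerLimits.

Section OptimalRatio.
Context {R : realType}.
Variables p b l : R.
Hypotheses (p1 : 1 < p) (b0 : 0 < b) (l0 : 0 < l).
Notation ps := (conj_exp p).
Hypothesis bl : 1 - b * ps < l.
Notation zt := (zeta_min p b l).

(** Solution of [ell l r = (ps * zt)^-1]: for [l != 1] this reads [r^(l-1) = 1 - (l-1) / (ps * zt)],
    which is [b / zt]. *)
Definition optimal_ratio : R :=
  if l == 1 then expR (- (ps * b)^-1) else (b / zt) `^ (l - 1)^-1.

Lemma optimal_ratioP : 0 < optimal_ratio < 1 /\ ell l optimal_ratio = (ps * zt)^-1.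
Proof.
have [ps0 z0] := (conj_exp_gt0 p1, zeta_min_gt0 p1 bl).
have bz : 0 < b / zt by apply: divr_gt0.
have pz : 0 < (ps * zt)^-1 by rewrite invr_gt0; apply: mulr_gt0.
have r0 : 0 < optimal_ratio.
  by rewrite /optimal_ratio; case: ifP => _; [exact: expR_gt0|exact: powR_gt0].
have tE : tlog l optimal_ratio = (ps * zt)^-1.
  rewrite /tlog /optimal_ratio; case: eqVneq => [l1|l1].
    by rewrite expRK opprK /zeta_min l1 subrr mul0r addr0.
  have l1' : l - 1 != 0 by rewrite subr_eq0.
  rewrite -powRrM mulVf// powRr1 ?(ltW bz)// /zeta_min.
  field; rewrite l1' (lt0r_neq0 ps0) andbT/=.
  have := lt0r_neq0 (mulr_gt0 z0 ps0).
  by rewrite /zeta_min mulrDl divfK ?(lt0r_neq0 ps0).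
have [] := @ell_tlog _ l _ r0; first by rewrite tE.
by move=> r1 ->; rewrite r0 r1.
Qed.

End OptimalRatio.

(** * Closed forms of the extremal profile *)

Section Kernels.
Context {R : realType}.
Variable p : R.
Hypothesis p1 : 1 < p.
Notation ps := (conj_exp p).
Let a := ps^-1.
Local Notation C := (@Complex R).
Let ps0 : 0 < ps. Proof. exact: conj_exp_gt0. Qed.
Let a0 : 0 < a. Proof. by rewrite invr_gt0. Qed.
Let a1 : a < 1.
Proof. by rewrite /a conj_expV// gtrBl invr_gt0 p_gt0. Qed.

Let powR_opK (x r : R) : 0 < x -> x `^ (- r) * x `^ r = 1.
Proof. by move=> x0; rewrite (powRN x r) mulVf// lt0r_neq0// powR_gt0. Qed.

(** Of the two factors [d^a], one undoes the scaling inside the kernel and the other the factor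
    [d^(-a)] of the primitive. *)
Lemma gauss_beta_profile (b l y : R) : 0 < l -> l != 1 -> 0 <= y ->
  let d := `|1 - l| in
  profile_at (fun s => d `^ (- a) * inc_beta a (gauss_q p b l) (1 - s `^ d))
    (gauss_beta_kernel p b l (y / (ps / (d `^ a * d `^ a)))) y.
Proof.
move=> l0 l1 y0 d; have d0 : 0 < d by rewrite normr_gt0 subr_eq0 eq_sym.
have da0 : 0 < d `^ a by exact: powR_gt0.
rewrite /gauss_beta_kernel -/a -/d; set q := gauss_q p b l.
have -> : ps * `|y / (ps / (d `^ a * d `^ a))| / d `^ a = d `^ a * y.
  rewrite ger0_norm; last first.
    apply: divr_ge0 => //; apply: divr_ge0; first exact: ltW.
    by apply: mulr_ge0; exact: ltW.
  by field; rewrite (lt0r_neq0 ps0) (lt0r_neq0 da0).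
set Y := d `^ a * y.
have Y0 : 0 <= Y by apply: mulr_ge0 => //; exact: ltW.
have [[x [/andP[x0 x1] xY]]|nx] := pselect (exists x, 0 <= x < 1 /\ inc_beta a q x = Y).
  have -> : inc_beta_inv a q Y = x.
    apply: xget_subset1; first by rewrite /= x0 x1.
    move=> u v [/andP[u0 u1] uY] [/andP[v0 v1] vY].
    have [uv|vu|//] := ltgtP u v.
      by have := inc_beta_lt p1 q u0 uv v1; rewrite uY vY ltxx.
    by have := inc_beta_lt p1 q v0 vu u1; rewrite uY vY ltxx.
  have x01 : 0 <= x < 1 by rewrite x0 x1.
  have x1' : 0 < 1 - x by rewrite subr_gt0.
  rewrite indicE mem_set; last by split => //; rewrite -xY; exact: inc_beta_le_euler.
  rewrite mulr1; left; split.
    rewrite powR_gt0//=.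
    have := @ge0_ler_powR _ d^-1 _ (1 - x) 1; rewrite powR1; apply; rewrite ?nnegrE.
    - by rewrite invr_ge0 ltW.
    - exact: ltW.
    - by [].
    - by lra.
  rewrite -powRrM mulVf ?(lt0r_neq0 d0)// powRr1 ?(ltW x1')// subKr xY.
  by rewrite /Y mulrA powR_opK// mul1r.
(* Outside the range of the incomplete beta function the default value 1 makes the kernel vanish,
   whatever the indicator. *)
have -> : inc_beta_inv a q Y = 1.
  by apply: xgetPN => x xY; apply: nx; exists x.
have di0 : d^-1 != 0 by rewrite invr_eq0 lt0r_neq0.
rewrite subrr (powR0 di0) mul0r; right; split=> // t /andP[t0 t1].
have td1 : t `^ d <= 1.
  have := @ge0_ler_powR _ d (ltW d0) t 1; rewrite powR1; apply; rewrite ?nnegrE//.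
  exact: ltW.
have td0 : 0 < t `^ d by exact: powR_gt0.
set x := 1 - t `^ d; have x0 : 0 <= x by rewrite subr_ge0.
have x1 : x < 1 by rewrite gtrBl.
have xY : inc_beta a q x < Y.
  rewrite ltNge; apply/negP => Yx; apply: nx.
  have cu (u : R) : 0 <= u <= x -> {for u, continuous (inc_beta a q)}.
    by move=> /andP[_ ux]; apply: continuous_inc_beta => //; exact: le_lt_trans x1.
  have [|u /andP[u0 ux] uY] := @intermediate_value _ (inc_beta a q) 0 x Y x0 cu.
    by rewrite (inc_beta_le0 p q (lexx 0)) Y0 Yx.
  by exists u; rewrite u0 (le_lt_trans ux).
by rewrite -(ltr_pM2l da0) mulrA [d `^ a * _]mulrC powR_opK// mul1r.
Qed.

(** With [0 < a < 1] the half-line of direction [exp(i a pi)] leaves the real axis, so the sign of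
    the argument can be recovered from the value of [inc_gamma]. *)
Let sin_a0 : 0 < sin (a * pi).
Proof.
apply: sin_gt0_pi; rewrite mulr_gt0 ?pi_gt0//=.
by rewrite gtr_pMl ?pi_gt0.
Qed.

Let inc_gamma_le0 (x : R) : x <= 0 -> inc_gamma a x =
  C (cos (a * pi) * exp_integral p (-1) (- x)) (sin (a * pi) * exp_integral p (-1) (- x)).
Proof.
rewrite le_eqVlt => /predU1P[->|x0]; last exact: inc_gamma_lt0.
by rewrite inc_gamma_ge0// oppr0 !(exp_integral_le0 _ _ (lexx 0)) !mulr0.
Qed.

Let exp_integral_inj (c x y : R) : 0 <= x -> 0 <= y ->
  exp_integral p c x = exp_integral p c y -> x = y.
Proof.
move=> x0 y0 E; have [xy|yx|//] := ltgtP x y.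
  by have := exp_integral_lt p1 c x0 xy; rewrite E ltxx.
by have := exp_integral_lt p1 c y0 yx; rewrite E ltxx.
Qed.

Let inc_gamma_inv_pos (x : R) : 0 <= x ->
  inc_gamma_inv a (C (exp_integral p 1 x) 0) = x.
Proof.
move=> x0; suff H (u : R) : inc_gamma a u = C (exp_integral p 1 x) 0 -> u = x.
  by apply: xget_subset1; [exact: inc_gamma_ge0|move=> u v /= /H -> /H ->].
have [u0|u0] := leP 0 u.
  by rewrite inc_gamma_ge0// => -[]; exact: exp_integral_inj.
rewrite inc_gamma_lt0// => -[_ /eqP]; rewrite mulf_eq0 (gt_eqF sin_a0)/= => /eqP E.
have u0' : 0 < - u by rewrite oppr_gt0.
by have := exp_integral_lt p1 (-1) (lexx 0) u0'; rewrite E exp_integral_le0// ltxx.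
Qed.

Let inc_gamma_inv_neg (u : R) : 0 <= u ->
  inc_gamma_inv a (C (cos (a * pi) * exp_integral p (-1) u)
    (sin (a * pi) * exp_integral p (-1) u)) = - u.
Proof.
move=> u0; set z := C _ _; suff H (x : R) : inc_gamma a x = z -> x = - u.
  apply: xget_subset1; last by move=> x y /= /H -> /H ->.
  by rewrite /= inc_gamma_le0 ?oppr_le0// opprK.
rewrite /z; have [x0|x0] := leP x 0.
  rewrite inc_gamma_le0// => -[_ /(mulfI (lt0r_neq0 sin_a0)) E].
  by rewrite -(@exp_integral_inj (-1) (- x) u) ?opprK ?oppr_ge0.
rewrite inc_gamma_ge0 ?ltW// => -[E1 /esym/eqP]; rewrite mulf_eq0 (gt_eqF sin_a0)/= => /eqP E.
by have := exp_integral_lt p1 1 (lexx 0) x0; rewrite E1 E mulr0 exp_integral_le0// ltxx.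
Qed.

(** For rate [-1] the integrand exceeds that for rate 0, whose integral [ps * x^a] is unbounded; [v]
    is where the latter equals [y]. *)
Let exp_integral_onto_neg (y : R) : 0 <= y -> exists2 u, 0 <= u & exp_integral p (-1) u = y.
Proof.
move=> y0; pose v := (y / ps) `^ ps.
have v0 : 0 <= v by exact: powR_ge0.
have yv : exp_integral p 0 v = y.
  rewrite exp_integral_0// /v -powRrM mulfV ?(lt0r_neq0 ps0)// powRr1.
    by rewrite mulrC divfK// lt0r_neq0.
  by apply: divr_ge0 => //; exact: ltW.
have yv' : y <= exp_integral p (-1) v.
  pose f (x : R) := exp_integral p (-1) x - exp_integral p 0 x.
  have f0 : f 0 = 0 by rewrite /f !(exp_integral_le0 _ _ (lexx 0)) subrr.
  have fv : f 0 <= f v.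
    apply: (@derive_ge0_le _ f
      (fun x => x `^ (a - 1) * expR (- (-1 * x)) - x `^ (a - 1) * expR (- (0 * x)))).
    - exact: v0.
    - by move=> t /andP[t0 _]; apply: is_deriveB; exact: is_derive_exp_integral.
    - by move=> t _; apply: continuousB; exact: continuous_exp_integral.
    - move=> t /andP[t0 _]; rewrite -mulrBr mulr_ge0 ?powR_ge0// subr_ge0 ler_expR.
      by lra.
  by move: fv; rewrite f0 /f yv subr_ge0.
have [|u /andP[u0 _] uy] := @intermediate_value _ (exp_integral p (-1)) 0 v y v0
  (fun x _ => @continuous_exp_integral _ _ p1 (-1) x).
  by rewrite exp_integral_le0// y0 yv'.
by exists u.
Qed.

(** With [k = |b - 1|], scaling reduces the rate [b - 1] to [1] if [b > 1] and to [-1] if [b < 1]: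
    the positive and the negative arguments of [inc_gamma]. The divisor [b^(-a) ps] gives the
    kernel's argument the modulus [k^a y]. *)
Lemma gauss_gamma_profile (b y : R) : 0 < b -> b != 1 -> 0 <= y ->
  profile_at (fun s => exp_integral p (b - 1) (- ln s))
    (gauss_gamma_kernel p b (y / (b `^ (- a) * ps))) y.
Proof.
move=> b0 b1 y0; have [k kb] : exists k : R, k = `|b - 1| by exists `|b - 1|.
have k0 : 0 < k by rewrite kb normr_gt0 subr_eq0.
have ba0 : 0 < b `^ (- a) by exact: powR_gt0.
have ka0 : 0 < k `^ a by exact: powR_gt0.
rewrite /gauss_gamma_kernel -/a; set r := ps * _.
have [Y Ydef] : exists Y : R, Y = k `^ a * y by exists (k `^ a * y).
have Y0 : 0 <= Y by rewrite Ydef; apply: mulr_ge0 => //; exact: ltW.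
have YE : `|(b - 1) / b| `^ a * r = Y.
  rewrite normrM -kb ger0_norm ?invr_ge0 ?(ltW b0)// /r ger0_norm; last first.
    by apply: divr_ge0 => //; apply: mulr_ge0; exact: ltW.
  rewrite powRM ?invr_ge0 ?(ltW b0) ?(ltW k0)// -[b^-1]powR_inv1 ?(ltW b0)// -powRrM mulN1r.
  by rewrite Ydef; field; rewrite (lt0r_neq0 ps0) (lt0r_neq0 ba0).
clearbody r.
have scale (c s : R) : 0 < s <= 1 ->
    exp_integral p (k * c) (- ln s) = k `^ (- a) * exp_integral p c (k * - ln s).
  by move=> /andP[s0 s1]; rewrite exp_integral_scale// oppr_ge0 ln_le0.
have hit (c x : R) : 0 <= x -> exp_integral p c x = Y ->
    0 < expR (- (x / k)) <= 1 /\ exp_integral p (k * c) (- ln (expR (- (x / k)))) = y.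
  move=> x0 xY; have s01 : 0 < expR (- (x / k)) <= 1.
    by rewrite expR_gt0 -expR0 ler_expR oppr_le0 divr_ge0// ltW.
  split => //; rewrite scale// expRK opprK [k * _]mulrC divfK ?(lt0r_neq0 k0)// xY.
  by rewrite Ydef mulrA powR_opK// mul1r.
rewrite YE; have [b_gt1|b_lt1] := ltP 1 b.
  have kE : b - 1 = k by rewrite kb gtr0_norm// subr_gt0.
  have bb0 : 0 <= (b - 1) / b by rewrite kE divr_ge0// ltW.
  rewrite cpow_ge0// mul_real_complex mul0r -{1}(ger0_norm bb0) YE kE.
  have [Yg|Yg] := ltP Y (euler_gamma a).
    have Y01 : 0 <= Y < euler_gamma a by rewrite Y0.
    have [x x0 xY] := exp_integral_onto p1 Y01.
    rewrite -xY inc_gamma_inv_pos// indicE mem_set ?mulr1; last first.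
      by split; [rewrite xY|rewrite lte_fin xY].
    by have := hit 1 x x0 xY; rewrite mulr1; left.
  rewrite indicE memNset ?mulr0; last by move=> [_]; rewrite lte_fin ltNge Yg.
  right; split=> // t t01; rewrite -[k in exp_integral _ k]mulr1 scale//.
  have lt0 : 0 <= k * - ln t.
    by apply: mulr_ge0; [exact: ltW|rewrite oppr_ge0 ln_le0//; case/andP: t01].
  rewrite -(ltr_pM2l ka0) mulrA [k `^ a * _]mulrC powR_opK// mul1r -Ydef.
  exact: lt_le_trans (exp_integral_lt_euler p1 lt0) Yg.
have bl1 : b < 1 by rewrite lt_neqAle b1.
have kE : b - 1 = k * -1 by rewrite kb ltr0_norm ?subr_lt0//; ring.
have bb0 : (b - 1) / b < 0 by rewrite ltr_pdivrMr// mul0r subr_lt0.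
have [u u0 uY] := exp_integral_onto_neg Y0.
have -> : cpow ((b - 1) / b) a * real_complex R r =
    C (cos (a * pi) * exp_integral p (-1) u) (sin (a * pi) * exp_integral p (-1) u).
  rewrite cpow_lt0// mul_real_complex uY -YE ltr0_norm//.
  by congr C; rewrite mulrAC mulrC.
rewrite inc_gamma_inv_neg// indicE mem_set ?mulr1; last by split => //; exact: ltry.
have -> : - (- u / (b - 1)) = - (u / k).
  by rewrite kE; field; rewrite (lt0r_neq0 k0).
by rewrite kE; left; apply: hit; [exact: u0|exact: uY].
Qed.

Lemma gauss_exp_profile (y : R) : 0 <= y ->
  profile_at (fun s => exp_integral p 0 (- ln s)) (expR (- `|y / ps| `^ ps)) y.
Proof.
move=> y0; have yp : 0 <= y / ps by apply: divr_ge0 => //; exact: ltW.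
left; split; first by rewrite expR_gt0 -expR0 ler_expR oppr_le0 powR_ge0.
rewrite expRK opprK (ger0_norm yp) exp_integral_0 ?powR_ge0//.
by rewrite -powRrM mulfV ?(lt0r_neq0 ps0)// powRr1// mulrC divfK// lt0r_neq0.
Qed.

Lemma gauss_kernel_norm (b l x : R) : gauss_kernel p b l `|x| = gauss_kernel p b l x.
Proof. by rewrite /gauss_kernel /gauss_beta_kernel /gauss_gamma_kernel normr_id. Qed.

(** Unifies the three formulas, so that extremality is treated only once, in terms of [Phi] and its
    inverse [w]. *)
Lemma gauss_kernel_profile (b l : R) : 0 < b -> 0 < l ->
  exists Phi w (c : R), [/\ 0 < c, profile_primitive p b l Phi,
    forall y : R, 0 <= y -> profile_at Phi (w y) y &
    forall x : R, gauss_kernel p b l x = w (`|x| / c)].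
Proof.
move=> b0 l0.
suff [Phi [c [c0 HPhi Hw]]] : exists Phi (c : R), [/\ 0 < c, profile_primitive p b l Phi &
    forall y : R, 0 <= y -> profile_at Phi (gauss_kernel p b l (y / c)) y].
  exists Phi, (fun y => gauss_kernel p b l (y / c)), c^-1.
  split; [by rewrite invr_gt0|exact: HPhi|exact: Hw|].
  by move=> x; rewrite invrK (mulfK (lt0r_neq0 c0)) gauss_kernel_norm.
have prim Psi : psi_primitive p l (b - 1) Psi -> profile_primitive p b l Psi.
  move=> [dPsi cPsi Psi1]; split=> // s s01; have := dPsi s s01.
  by have -> : b - 1 - 1 = b - 2 by ring.
have [l1|l1] := eqVneq l 1; last first.
  have d0 : 0 < `|1 - l| by rewrite normr_gt0 subr_eq0 eq_sym.
  exists (fun s => `|1 - l| `^ (- a) * inc_beta a (gauss_q p b l) (1 - s `^ `|1 - l|)).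
  exists (ps / (`|1 - l| `^ a * `|1 - l| `^ a)); split.
  - by apply: divr_gt0 => //; apply: mulr_gt0; exact: powR_gt0.
  - by apply: prim; exact: psi_primitive_beta.
  - by move=> y y0; rewrite /gauss_kernel l1; exact: gauss_beta_profile.
have [b1|b1] := eqVneq b 1.
  exists (fun s => exp_integral p (b - 1) (- ln s)), ps; split.
  - exact: ps0.
  - by apply: prim; exact: psi_primitive_exp.
  - move=> y y0; rewrite /gauss_kernel l1 b1 eqxx/= subrr; exact: gauss_exp_profile.
exists (fun s => exp_integral p (b - 1) (- ln s)), (b `^ (- a) * ps); split.
- by apply: mulr_gt0 => //; exact: powR_gt0.
- by apply: prim; exact: psi_primitive_exp.
- by move=> y y0; rewrite /gauss_kernel l1 eqxx/= b1; exact: gauss_gamma_profile.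
Qed.

End Kernels.

(** * The optimal bound *)

Section Extremals.
Context {R : realType}.
Variables p b l : R.
Hypotheses (p1 : 1 < p) (b0 : 0 < b) (l0 : 0 < l).
Notation ps := (conj_exp p).
Hypothesis bl : 1 - b * ps < l.
Local Notation mu := (@lebesgue_measure R).
Notation zt := (zeta_min p b l).
Notation Q := (gn_weight p b l).

Definition dual_primitive (s : R) : R :=
  if l == 1 then exp_integral p (dual_exponent b l) (- ln s)
  else `|1 - l| `^ (- ps^-1) * inc_beta ps^-1
    (dual_exponent b l / `|1 - l| + (0 <= 1 - l)%R%:R / p) (1 - s `^ `|1 - l|).

Lemma dual_primitiveP : psi_primitive p l (dual_exponent b l) dual_primitive.
Proof.
rewrite /dual_primitive; case: eqVneq => l1; first exact: psi_primitive_exp.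
exact: psi_primitive_beta.
Qed.

(** The number [2 G(1) / Q(r0)], with [G] integrated by parts. *)
Definition gn_constant : R :=
  2 * (psi_sup dual_primitive / (ps * dual_coef p b l)) / Q (optimal_ratio p b l).

Notation G := (weight_of_psi p b l dual_primitive).
Notation r0 := (optimal_ratio p b l).

Let HG : weight_primitive p b l G.
Proof. exact: (weight_of_psi_primitive p1 b0 bl dual_primitiveP). Qed.

Let G1E : G 1 = psi_sup dual_primitive / (ps * dual_coef p b l).
Proof. exact: weight_of_psi1 dual_primitiveP. Qed.

Let G1_gt0 : 0 < G 1.
Proof. by apply: (weight_primitive_gt0 HG); rewrite ltr01 lexx. Qed.

Let Qr0 : 0 < Q r0.
Proof. by have [r01 _] := optimal_ratioP p1 b0 bl; exact: gn_weight_gt0. Qed.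

Lemma gn_constant_gt0 : 0 < gn_constant.
Proof. by rewrite /gn_constant -G1E; apply: divr_gt0 => //; exact: mulr_gt0. Qed.

Let sqrt_complexity_ge0 rho : 0 <= sqrt_complexity p b l rho.
Proof. by rewrite mulr_ge0 ?powR_ge0 ?expR_ge0. Qed.

Let complexity_sqr rho : complexity_domain p b l rho ->
  complexity p b l rho = sqrt_complexity p b l rho ^+ 2.
Proof. by move=> [[rge0 _ _ _] _ _]; rewrite complexityE. Qed.

Let sqrt_ge rho : complexity_domain p b l rho -> gn_constant <= sqrt_complexity p b l rho.
Proof.
have [r01 er0] := optimal_ratioP p1 b0 bl.
have [Phi [w [c [c0 HPhi Hw _]]]] := gauss_kernel_profile p1 b0 l0.
move=> /(gn_inequality p1 b0 l0 bl HPhi HG r01 er0)[H _].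
by rewrite /gn_constant -G1E ler_pdivrMr.
Qed.

Lemma complexity_ge rho : complexity_domain p b l rho ->
  gn_constant ^+ 2 <= complexity p b l rho.
Proof.
move=> Hrho; rewrite (complexity_sqr Hrho) ler_sqr ?nnegrE ?sqrt_ge//.
exact: ltW gn_constant_gt0.
Qed.

Let m0 : 0 < ps * zt * G 1.
Proof.
apply: mulr_gt0; last exact: G1_gt0.
by apply: mulr_gt0; [exact: conj_exp_gt0|exact: zeta_min_gt0].
Qed.

Let kernel_mass Phi w (c : R) : 0 < c -> profile_primitive p b l Phi ->
  (forall y : R, 0 <= y -> profile_at Phi (w y) y) ->
  (forall x : R, gauss_kernel p b l x = w (`|x| / c)) ->
  \int[mu]_t gauss_kernel p b l t = c * (2 * (ps * zt * G 1)).
Proof.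
move=> c0 HPhi Hw kE; rewrite -(profile_mass p1 b0 bl HPhi HG Hw 0 c0).
by apply: eq_Rintegral => x _; rewrite kE subr0.
Qed.

Lemma gauss_kernel_mass_gt0 : 0 < \int[mu]_t gauss_kernel p b l t.
Proof.
have [Phi [w [c [c0 HPhi Hw kE]]]] := gauss_kernel_profile p1 b0 l0.
rewrite (kernel_mass c0 HPhi Hw kE); apply: mulr_gt0; first exact: c0.
by apply: mulr_gt0; [exact: ltr0n|exact: m0].
Qed.

(** Both families consist of the translates and dilates of one profile of unit mass; the scale [s]
    of the Gaussian is the scale [s * c] of the profile. *)
Lemma extremal_set : exists Phi w, [/\ profile_primitive p b l Phi,
  forall y : R, 0 <= y -> profile_at Phi (w y) y &
  shift_scale_class (gauss p b l) =
    [set rho | exists x0 k : R, 0 < k /\ rho = profile_density p b l G w x0 k]].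
Proof.
have [Phi [w [c [c0 HPhi Hw kE]]]] := gauss_kernel_profile p1 b0 l0.
exists Phi, w; split; [exact: HPhi|exact: Hw|].
have gE (x0 s x : R) : 0 < s ->
    s^-1 * gauss p b l ((x - x0) / s) = profile_density p b l G w x0 (s * c) x.
  move=> s0; rewrite /gauss (kernel_mass c0 HPhi Hw kE) kE /profile_density normrM.
  rewrite [`|s^-1|]ger0_norm ?invr_ge0 ?(ltW s0)// -(mulrA _ s^-1) -(invfM s).
  move: (ps * zt * G 1) (lt0r_neq0 m0) => J J0.
  by field; rewrite J0 (lt0r_neq0 c0) (lt0r_neq0 s0).
apply/seteqP; split=> [rho [x0 [s [s0 ->]]]|rho [x0 [k [k0 ->]]]].
  exists x0, (s * c); split; first exact: mulr_gt0.
  by apply/funext => x; exact: gE.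
exists x0, (k / c); have s0 : 0 < k / c by apply: divr_gt0.
split; first exact: s0.
by apply/funext => x; rewrite gE// divfK// lt0r_neq0.
Qed.

Lemma extremals : shift_scale_class (gauss p b l) =
  [set rho | complexity_domain p b l rho /\ complexity p b l rho = gn_constant ^+ 2].
Proof.
have [r01 er0] := optimal_ratioP p1 b0 bl.
have [Phi [w [HPhi Hw ->]]] := extremal_set.
apply/seteqP; split=> [rho [x0 [k [k0 ->]]]|rho [Hrho E]].
  have D := profile_density_domain p1 b0 l0 bl HPhi HG Hw x0 k0; split; first exact: D.
  have := profile_density_value p1 b0 l0 bl HPhi HG Hw x0 k0 r01 er0.
  rewrite (complexity_sqr D) /gn_constant -G1E => <-.
  by rewrite (mulfK (lt0r_neq0 Qr0)).
have SE : sqrt_complexity p b l rho = gn_constant.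
  move: E; rewrite (complexity_sqr Hrho) => /eqP; rewrite eqrXn2 ?sqrt_complexity_ge0//.
    by move/eqP.
  exact: ltW gn_constant_gt0.
(* Equality in the sharp inequality makes [rho] a value of the inverse of [Phi], which
   [profile_unique] identifies with [w]. *)
have [_] := gn_inequality p1 b0 l0 bl HPhi HG r01 er0 Hrho.
rewrite SE /gn_constant -G1E (divfK (lt0r_neq0 Qr0)) => /(_ erefl)[x0 [k [k0 H]]].
exists x0, k; split; first exact: k0.
apply/funext => x; rewrite /profile_density.
have mk : 2 * (k * (ps * zt * G 1)) != 0.
  by apply/lt0r_neq0/mulr_gt0; [exact: ltr0n|exact: mulr_gt0].
apply: (canRL (mulfK mk)); apply: (profile_unique HPhi (H x)); apply: Hw.
by apply: divr_ge0; [exact: normr_ge0|exact: ltW].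
Qed.

Let gauss_extremal : complexity_domain p b l (gauss p b l) /\
  complexity p b l (gauss p b l) = gn_constant ^+ 2.
Proof.
suff : shift_scale_class (gauss p b l) (gauss p b l) by rewrite extremals.
exists 0, 1; split; first exact: ltr01.
by apply/funext => x; rewrite invr1 mul1r mulr1 subr0.
Qed.

Lemma minimizersE : minimizers p b l = shift_scale_class (gauss p b l).
Proof.
rewrite extremals; have [D E] := gauss_extremal.
apply/seteqP; split=> rho [Hrho H]; (split; first exact: Hrho).
  apply/le_anti/andP; split; last exact: complexity_ge.
  by rewrite -E; exact: H.
by move=> f Hf; rewrite H; exact: complexity_ge.
Qed.

Lemma optimal_boundE : optimal_bound p b l = gn_constant ^+ 2.
Proof.
have [D E] := gauss_extremal; apply/le_anti/andP; split.
  rewrite -E; apply: ge_inf; last by exists (gauss p b l).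
  by exists (gn_constant ^+ 2) => _ [f Hf <-]; exact: complexity_ge.
apply: lb_le_inf; first by exists (complexity p b l (gauss p b l)), (gauss p b l).
by move=> _ [f Hf <-]; exact: complexity_ge.
Qed.

End Extremals.

Section ExplicitBound.
Context {R : realType}.
Variables p b l : R.
Hypotheses (p1 : 1 < p) (b0 : 0 < b) (l0 : 0 < l).
Notation ps := (conj_exp p).
Hypothesis bl : 1 - b * ps < l.
Notation zt := (zeta_min p b l).
Notation Q := (gn_weight p b l).
Let a := ps^-1.
Let ps0 : 0 < ps. Proof. exact: conj_exp_gt0. Qed.
Let zt0 : 0 < zt. Proof. exact: zeta_min_gt0. Qed.
Let pV : p^-1 = 1 - a. Proof. by rewrite /a conj_expV//; ring. Qed.

Let weight_optimal (r : R) : r = optimal_ratio p b l -> Q r = r `^ b * (ps * zt) `^ (- a).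
Proof.
move=> ->; have [_ er0] := optimal_ratioP p1 b0 bl; rewrite /gn_weight er0.
have pz0 : 0 < ps * zt by apply: mulr_gt0.
by rewrite -(powR_inv1 (ltW pz0)) -powRrM mulN1r.
Qed.

Let powRV (x r : R) : 0 < x -> (x `^ (- r))^-1 = x `^ r.
Proof. by move=> x0; rewrite (powRN x r) invrK. Qed.

Lemma gn_constant_shannon : l = 1 ->
  gn_constant p b l = 2 * expR a * euler_gamma a / (b * ps `^ p^-1).
Proof.
move=> l1; have ztE : zt = b by rewrite /zeta_min l1 subrr mul0r addr0.
have psb0 : 0 < ps * b by apply: mulr_gt0.
have B : psi_sup (dual_primitive p b l) = b `^ (- a) * euler_gamma a.
  rewrite -psi_sup_exp//; congr psi_sup; apply/funext => s.
  by rewrite /dual_primitive l1 eqxx /dual_exponent subrr maxxx addr0.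
rewrite /gn_constant B (weight_optimal erefl) ztE /dual_coef l1 lexx -l1 ztE.
rewrite /optimal_ratio l1 eqxx (powRE _ (expR_gt0 _)) expRK.
have -> : b * - (ps * b)^-1 = - a by rewrite /a; field; rewrite (lt0r_neq0 ps0) (lt0r_neq0 b0).
rewrite expRN (powRM _ (ltW ps0) (ltW b0)) pV (powR_add 1 (- a) ps0) powRr1 ?(ltW ps0)//.
have e0 := expR_gt0 a.
have h1 : 0 < ps `^ (- a) by exact: powR_gt0.
have h2 : 0 < b `^ (- a) by exact: powR_gt0.
field; rewrite (lt0r_neq0 e0) (lt0r_neq0 h1) (lt0r_neq0 h2) (lt0r_neq0 b0).
by rewrite (lt0r_neq0 ps0).
Qed.

Section Neq1.
Hypothesis l1 : l != 1.
Let d := `|1 - l|.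
Let d0 : 0 < d. Proof. by rewrite normr_gt0 subr_eq0 eq_sym. Qed.
Notation z := (zeta_par p b l).
Notation k := (dual_coef p b l).
Let k0 : 0 < k. Proof. exact: dual_coef_gt0. Qed.

(** [z] and [k] are the larger and the smaller of [b] and [zt], which differ by [d / ps]; the
    exponents below are computed from this. *)
Let zeta_cases : (l < 1 /\ [/\ z = b, k = zt & zt = b - d / ps]) \/
  (1 < l /\ [/\ z = zt, k = b & zt = b + d / ps]).
Proof.
rewrite /zeta_par /dual_coef /d; have [l_lt|l_gt|l_1] := ltgtP l 1.
- left; split=> //; rewrite ger0_norm ?subr_ge0 ?(ltW l_lt)//.
  rewrite (max_idPr _) ?subr_le0 ?(ltW l_lt)// mul0r addr0; split=> //.
  by rewrite /zeta_min; ring.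
- right; split=> //; rewrite distrC ger0_norm ?subr_ge0 ?(ltW l_gt)//.
  by rewrite (max_idPl _) ?subr_ge0 ?(ltW l_gt).
- by move: l1; rewrite l_1 eqxx.
Qed.

Let z0 : 0 < z.
Proof. by have [[_ [-> _ _]]|[_ [-> _ _]]] := zeta_cases. Qed.

Let zkE : ps * z - d = ps * k.
Proof.
have [[_ [-> -> ->]]|[_ [-> -> ->]]] := zeta_cases.
- by field; exact: lt0r_neq0.
- by field; exact: lt0r_neq0.
Qed.

Let ratioE : optimal_ratio p b l `^ b = (z / k) `^ (- (b / d)).
Proof.
have E : (b / zt) `^ (l - 1)^-1 = (z / k) `^ (- d^-1).
  have [[l_lt [-> -> _]]|[l_gt [-> -> _]]] := zeta_cases.
    by congr (_ `^ _); rewrite /d ger0_norm ?subr_ge0 ?(ltW l_lt)// -invrN opprB.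
  rewrite -[b / zt]invrK invf_div -[(zt / b)^-1]powR_inv1; last first.
    by apply: divr_ge0; exact: ltW.
  by rewrite -powRrM mulN1r; congr (_ `^ - _^-1); rewrite /d distrC ger0_norm ?subr_ge0 ?(ltW l_gt).
rewrite /optimal_ratio (negbTE l1) E -powRrM; congr (_ `^ _).
by field; exact: lt0r_neq0.
Qed.

Let betaE : fine (euler_beta a (z / d + p^-1)) = d `^ a * psi_sup (dual_primitive p b l).
Proof.
have qE : z / d + p^-1 = dual_exponent b l / d + (0 <= 1 - l)%R%:R / p.
  rewrite /dual_exponent; have [[l_lt [-> _ _]]|[l_gt [-> _ ->]]] := zeta_cases.
    rewrite (max_idPr _) ?subr_le0 ?(ltW l_lt)// addr0.
    by rewrite subr_ge0 (ltW l_lt) mul1r.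
  have -> : (0 <= 1 - l)%R = false by apply/negbTE; rewrite -ltNge subr_lt0.
  rewrite (max_idPl _) ?subr_ge0 ?(ltW l_gt)// mul0r addr0 pV.
  have -> : l - 1 = d by rewrite /d distrC ger0_norm ?subr_ge0 ?(ltW l_gt).
  by rewrite /a; field; rewrite (lt0r_neq0 ps0) (lt0r_neq0 d0).
rewrite (euler_beta_psi p1 l0 l1 (dual_exponent_gt0 l b0) qE)/=.
congr (_ * psi_sup _); apply/funext => s.
by rewrite /dual_primitive (negbTE l1) qE.
Qed.

Lemma gn_constant_renyi : gn_constant p b l =
  2 / (ps * z) * (ps * z / d) `^ a * (ps * z / (ps * z - d)) `^ (z / d + p^-1) *
    fine (euler_beta a (z / d + p^-1)).
Proof.
rewrite betaE zkE /gn_constant (weight_optimal erefl) ratioE.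
move: (psi_sup _) => B.
have zk0 : 0 < z / k by apply: divr_gt0.
have -> : ps * z / (ps * k) = z / k.
  by field; rewrite (lt0r_neq0 ps0) (lt0r_neq0 k0).
have psz0 : 0 < ps * z by apply: mulr_gt0.
have pszt0 : 0 < ps * zt by apply: mulr_gt0.
have dE : (ps * z / d) `^ a * d `^ a = (ps * z) `^ a.
  rewrite -powRM ?(ltW d0)//; last by apply: divr_ge0; exact: ltW.
  by rewrite divfK// lt0r_neq0.
rewrite (invfM (_ `^ - (b / d))) (powRV _ zk0) (powRV _ pszt0).
transitivity (2 * B * (z / k) `^ (b / d) * ((ps * zt) `^ a / (ps * k))); first by field;
  rewrite (lt0r_neq0 ps0) (lt0r_neq0 k0).
transitivity (2 * B * ((ps * z / d) `^ a * d `^ a) / (ps * z) *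
  (z / k) `^ (z / d + p^-1)); last by field; rewrite (lt0r_neq0 ps0) (lt0r_neq0 z0).
rewrite dE.
suff E : (z / k) `^ (b / d) * ((ps * zt) `^ a / (ps * k)) =
    (ps * z) `^ a / (ps * z) * (z / k) `^ (z / d + p^-1).
  by rewrite -[LHS]mulrA E; ring.
have subK (x : R) : 0 < x -> x `^ a / x = x `^ (- p^-1).
  move=> x0; rewrite -[X in _ / X]powRr1 ?(ltW x0)// -powRN -powR_add//.
  by congr (_ `^ _); rewrite pV; ring.
(* The exponent [z / d + 1/p] is [b / d + 1/p] for [l < 1] and [b / d + 1] for [l > 1]. *)
have [[l_lt [zE kE _]]|[l_gt [zE kE ztE]]] := zeta_cases.
  rewrite kE zE; rewrite zE kE in zk0.
  rewrite (powR_add (b / d) p^-1 zk0) (subK _ pszt0).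
  rewrite zE in psz0; rewrite (subK _ psz0) mulrCA; congr (_ * _).
  rewrite -{1}[ps * b](divfK (lt0r_neq0 pszt0)).
  have -> : ps * b / (ps * zt) * (ps * zt) = b / zt * (ps * zt).
    by field; rewrite (lt0r_neq0 ps0) (lt0r_neq0 zt0).
  rewrite (powRM _ (ltW zk0) (ltW pszt0)) [RHS]mulrAC -(powR_add _ _ zk0).
  by rewrite addNr powRr0 mul1r.
rewrite kE zE; rewrite zE kE in zk0.
have -> : zt / d + p^-1 = b / d + 1.
  rewrite ztE pV /a; field; rewrite (lt0r_neq0 ps0) (lt0r_neq0 d0)//.
rewrite (powR_add (b / d) 1 zk0) powRr1 ?(ltW zk0)//.
by field; rewrite (lt0r_neq0 ps0) (lt0r_neq0 b0) (lt0r_neq0 zt0).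
Qed.

End Neq1.

Lemma explicit_boundE : explicit_bound p b l = gn_constant p b l ^+ 2.
Proof.
rewrite /explicit_bound; have [l1|l1] := eqVneq l 1.
  by rewrite (gn_constant_shannon l1).
by rewrite (gn_constant_renyi l1).
Qed.

End ExplicitBound.

(** * The involution on the parameter domain *)

Section Involution.
Context {R : realType}.
Variables p b l : R.
Hypotheses (p1 : 1 < p) (b0 : 0 < b) (l0 : 0 < l).
Notation ps := (conj_exp p).
Hypothesis bl : 1 - b * ps < l.
Local Notation mu := (@lebesgue_measure R).
Let ps0 : 0 < ps. Proof. exact: conj_exp_gt0. Qed.
Let pV : p^-1 = 1 - ps^-1. Proof. by rewrite conj_expV//; ring. Qed.

Notation b' := ((b * ps + l - 1) / (l * ps)).
Notation l' := (l^-1).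

(** The image of [b] is [zeta_min / l] and the image of [zeta_min] is [b / l]; the positivity of the
    latter is the domain condition. *)
Lemma involution_domain : [/\ 0 < b', 0 < l' & 1 - b' * ps < l'].
Proof.
split.
  by apply: divr_gt0; [rewrite subr_gt0 -ltrBlDl|exact: mulr_gt0].
  by rewrite invr_gt0.
have -> : b' * ps = (b * ps + l - 1) / l by field; rewrite (lt0r_neq0 ps0) (lt0r_neq0 l0).
rewrite -subr_gt0.
have -> : l' - (1 - (b * ps + l - 1) / l) = b * ps / l by field; exact: lt0r_neq0.
by apply: divr_gt0 => //; exact: mulr_gt0.
Qed.

Lemma involution_TK : involution_T p (b', l') = (b, l).
Proof.
rewrite /involution_T/= invrK; congr pair.
by field; rewrite (lt0r_neq0 ps0) (lt0r_neq0 l0).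
Qed.

Let dist' : `|1 - l'| = `|1 - l| / l.
Proof.
have -> : 1 - l' = - (1 - l) / l by field; exact: lt0r_neq0.
by rewrite normrM normrN [`|l^-1|]ger0_norm// invr_ge0 ltW.
Qed.

Let eq1' : (l' == 1) = (l == 1).
Proof. by rewrite invr_eq1. Qed.

(** [zeta_par] is the larger of [b] and [zeta_min], which the involution exchanges up to the factor
    [1 / l]. *)
Let zeta' : zeta_par p b' l' = zeta_par p b l / l.
Proof.
rewrite /zeta_par; have [l1|l1] := leP l 1.
  have l'1 : 1 <= l' by rewrite invf_ge1.
  rewrite (max_idPl _) ?subr_ge0// (max_idPr _) ?subr_le0//.
  by field; rewrite (lt0r_neq0 ps0) (lt0r_neq0 l0).
have l'1 : l' <= 1 by rewrite invf_le1// ltW.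
rewrite (max_idPr _) ?subr_le0// (max_idPl _) ?subr_ge0 ?(ltW l1)//.
by field; rewrite (lt0r_neq0 ps0) (lt0r_neq0 l0).
Qed.

(** [z] and [d] are both divided by [l]: their quotients are unchanged, and only the prefactor
    [2 / (ps z)] is multiplied by [l], before squaring. *)
Lemma explicit_bound_involution :
  explicit_bound p b' l' = l ^+ 2 * explicit_bound p b l.
Proof.
rewrite /explicit_bound eq1'; have [l1|l1] := eqVneq l 1; rewrite /=.
  have -> : b' = b by rewrite l1; field; exact: lt0r_neq0.
  by rewrite l1 expr1n mul1r.
have d0 : 0 < `|1 - l| by rewrite normr_gt0 subr_eq0 eq_sym.
rewrite dist' zeta'; move: d0; set d := `|1 - l|; set z := zeta_par p b l => d0.
have z0 : 0 < z by apply: (lt_le_trans b0); rewrite lerDl divr_ge0 ?le_max ?lexx ?orbT// ltW.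
clearbody d z.
have l_neq0 := lt0r_neq0 l0; have ps_neq0 := lt0r_neq0 ps0.
have z_neq0 := lt0r_neq0 z0; have d_neq0 := lt0r_neq0 d0.
have -> : z / l / (d / l) = z / d by field; rewrite d_neq0.
have -> : ps * (z / l) / (d / l) = ps * z / d by field; rewrite d_neq0.
have -> : ps * (z / l) / (ps * (z / l) - d / l) = ps * z / (ps * z - d).
  have -> : ps * (z / l) - d / l = (ps * z - d) / l by ring.
  by rewrite mulrA -mulf_div divff ?mulr1 ?invr_eq0.
have -> : 2 / (ps * (z / l)) = l * (2 / (ps * z)) by field; rewrite z_neq0 ps_neq0.
rewrite -[RHS]exprMn; congr (_ ^+ _); ring.
Qed.

Lemma gauss_kernel_ge0 (b1 l1 x : R) : 0 <= gauss_kernel p b1 l1 x.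
Proof.
rewrite /gauss_kernel /gauss_beta_kernel /gauss_gamma_kernel indicE indicE.
by case: ifP => _; [|case: ifP => _]; rewrite ?mulr_ge0 ?powR_ge0 ?expR_ge0// ler0n.
Qed.

(** For [l != 1], [gauss_q] is invariant while [d] is divided by [l]: the exponent [1 / d] is
    multiplied by [l], and the argument is rescaled by [l^(1/ps)]. *)
Lemma gauss_kernel_involution (x : R) :
  gauss_kernel p b' l' x = gauss_kernel p b l (l `^ ps^-1 * x) `^ l.
Proof.
have [l1|l1] := eqVneq l 1.
  have -> : b' = b by rewrite l1; field; exact: lt0r_neq0.
  by rewrite l1 invr1 powR1 mul1r (powRr1 (gauss_kernel_ge0 _ _ _)).
have d0 : 0 < `|1 - l| by rewrite normr_gt0 subr_eq0 eq_sym.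
have l_neq0 := lt0r_neq0 l0; have ps_neq0 := lt0r_neq0 ps0; have d_neq0 := lt0r_neq0 d0.
rewrite /gauss_kernel eq1' l1 /gauss_beta_kernel.
have -> : gauss_q p b' l' = gauss_q p b l.
  rewrite /gauss_q dist'; have [l_lt1|l_gt1] := leP l 1.
    have l_lt : l < 1 by rewrite lt_neqAle l1.
    have -> : (0 <= 1 - l')%R = false.
      by apply/negbTE; rewrite -ltNge subr_lt0 invf_gt1.
    rewrite subr_ge0 l_lt1 mul0r addr0 mul1r pV.
    have -> : `|1 - l| = 1 - l by rewrite ger0_norm ?subr_ge0.
    by field; rewrite ps_neq0 l_neq0 andbT subr_eq0 eq_sym.
  have l'1 : l' <= 1 by rewrite invf_le1// ltW.
  have -> : (0 <= 1 - l)%R = false by apply/negbTE; rewrite -ltNge subr_lt0.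
  rewrite subr_ge0 l'1 mul0r addr0 mul1r pV.
  have -> : `|1 - l| = l - 1 by rewrite distrC ger0_norm ?subr_ge0 ?(ltW l_gt1).
  by field; rewrite ps_neq0 l_neq0 subr_eq0 l1.
have la0 : 0 < l `^ ps^-1 by exact: powR_gt0.
have -> : ps * `|l `^ ps^-1 * x| / `|1 - l| `^ ps^-1 = ps * `|x| / `|1 - l'| `^ ps^-1.
  rewrite normrM (ger0_norm (ltW la0)) dist' powRM ?invr_ge0 ?(ltW l0)//.
  rewrite -[l^-1]powR_inv1 ?(ltW l0)// -powRrM mulN1r powRN.
  have da0 : 0 < `|1 - l| `^ ps^-1 by exact: powR_gt0.
  by field; rewrite (lt0r_neq0 la0) (lt0r_neq0 da0).
have -> : `|1 - l'|^-1 = `|1 - l|^-1 * l by rewrite dist' invf_div mulrC.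
rewrite (powRM _ (powR_ge0 _ _)) indicE ?ler0n// -powRrM; congr (_ * _).
(* An indicator is unchanged by the power [l]. *)
by case: (_ \in _); rewrite ?powR1 ?(powR0 l_neq0).
Qed.

Lemma minimizers_involution rho rho' :
  minimizers p b l rho -> minimizers p b' l' rho' ->
  proportional_upto_shift_scale rho' (fun x => rho x `^ l).
Proof.
have [b'0 l'0 bl'] := involution_domain.
rewrite !minimizersE// => -[x0 [s [s0 ->]]] [x0' [s' [s'0 ->]]].
have M0 := gauss_kernel_mass_gt0 p1 b0 l0 bl.
have M'0 := gauss_kernel_mass_gt0 p1 b'0 l'0 bl'.
have la0 : 0 < l `^ ps^-1 by exact: powR_gt0.
rewrite /gauss; move: (\int[mu]_t gauss_kernel p b l t) M0 => M M0.
move: (\int[mu]_t _) M'0 => M' M'0.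
(* [t] and the shift match the arguments of the two kernels; the constant below collects their
   normalizations. *)
pose t := s' / (s * l `^ ps^-1).
have t0 : 0 < t by apply: divr_gt0 => //; exact: mulr_gt0.
exists ((s * M) `^ l / (s' * M')), (x0' - x0 * t), t; split=> [||x].
- by apply: divr_gt0; [apply: powR_gt0|]; exact: mulr_gt0.
- exact: t0.
rewrite gauss_kernel_involution.
have -> : ((x - (x0' - x0 * t)) / t - x0) / s = l `^ ps^-1 * ((x - x0') / s').
  rewrite /t; field.
  by rewrite (lt0r_neq0 s0) (lt0r_neq0 s'0) (lt0r_neq0 la0).
have := gauss_kernel_ge0 b l (l `^ ps^-1 * ((x - x0') / s')).
move: (gauss_kernel p b l _) => k k0.
have sM0 : 0 < s * M by exact: mulr_gt0.
have sMl : 0 < (s * M) `^ l by exact: powR_gt0.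
have -> : s^-1 * (k / M) = k / (s * M).
  by field; rewrite (lt0r_neq0 s0) (lt0r_neq0 M0).
have -> : (k / (s * M)) `^ l = k `^ l / (s * M) `^ l.
  have iM0 : 0 <= (s * M)^-1 by rewrite invr_ge0 ltW.
  by rewrite (powRM _ k0 iM0) -(powR_inv1 (ltW sM0)) -powRrM mulN1r powRN.
by field; rewrite (lt0r_neq0 s'0) (lt0r_neq0 M'0) (lt0r_neq0 sMl).
Qed.

End Involution.

Theorem proposition5 (R : realType) (p : R) (hp : 1 < p) :
  forall b l : R, param_domain p (b, l) ->
  [/\ (* non-trivial lower bound *)
      0 < optimal_bound p b l /\
      (forall rho, complexity_domain p b l rho ->
         optimal_bound p b l <= complexity p b l rho),
      (* minimizers *)
      minimizers p b l = shift_scale_class (gauss p b l),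
      (* symmetry under the involution *)
      forall b' l' : R, involution_T p (b, l) = (b', l') ->
      [/\ param_domain p (b', l'),
          involution_T p (b', l') = (b, l),
          forall rho rho', minimizers p b l rho -> minimizers p b' l' rho' ->
            proportional_upto_shift_scale rho' (fun x => rho x `^ l) &
          optimal_bound p b' l' = l ^+ 2 * optimal_bound p b l] &
      (* value of the tight bound *)
      optimal_bound p b l = explicit_bound p b l].
Proof.
move=> b l [/= b0 l0 bl].
have bE (c m : R) : 0 < c -> 0 < m -> 1 - c * conj_exp p < m ->
    optimal_bound p c m = explicit_bound p c m.
  by move=> c0 m0 cm; rewrite optimal_boundE// explicit_boundE.
split.
- rewrite optimal_boundE//; split; last by move=> rho; exact: complexity_ge.
  by rewrite exprn_gt0// gn_constant_gt0.
- exact: minimizersE.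
- move=> _ _ [<- <-]; have [b'0 l'0 bl'] := involution_domain hp b0 l0 bl.
  split.
  + by [].
  + exact: involution_TK.
  + by move=> rho rho'; exact: minimizers_involution.
  + by rewrite !bE//; exact: explicit_bound_involution.
- exact: bE.
Qed.
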